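(* Let $Y$ be a strictly non-degenerate, div-integrable diagonal doubly-resonant saddle-node in $(\mathbb{C}^3,0)$ with $\mathrm{D}_0Y=\mathrm{diag}(0,-\lambda,\lambda)$, $\lambda\in\mathbb{C}^*$, with formal normal form $Y_{\mathrm{norm}}$ and sectorial normalizing maps $\Phi_+,\Phi_-$. Let $\epsilon\in\left]0,\frac\pi2\right[$, $r>0$ and $$S_\pm=\Big\{x\in\mathbb{C}: 0<|x|<r,\ \big|\arg\big(\tfrac{\pm x}{i\lambda}\big)\big|<\tfrac{\pi}{2}+\epsilon\Big\}.$$ Let $\varphi_+$ and $\varphi_-$ be two germs of sectorial fibered diffeomorphisms in $S_+\times(\mathbb{C}^2,0)$ and $S_-\times(\mathbb{C}^2,0)$ respectively, which are tangent to the identity and such that $(\varphi_\pm)_*(Y)=Y_{\mathrm{norm}}$. Then $\varphi_+$ and $\varphi_-$ necessarily coincide, as germs, with $\Phi_+$ and $\Phi_-$ respectively.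
   Context: Coordinates on $\mathbb{C}^3$ are $(x,\mathbf y)=(x,y_1,y_2)$; $(\mathbb{C}^2,0)$ denotes an arbitrarily small neighborhood of $0$. $\Phi_*(Y)=(\mathrm{D}\Phi\cdot Y)\circ\Phi^{-1}$. Fibered means of the form $(x,\mathbf y)\mapsto(x,\phi(x,\mathbf y))$. A diagonal doubly-resonant saddle-node is a germ of analytic vector field $Y=x^2\partial_x+(-\lambda y_1+F_1(x,\mathbf y))\partial_{y_1}+(\lambda y_2+F_2(x,\mathbf y))\partial_{y_2}$ with $\lambda\in\mathbb{C}^*$, $F_1,F_2\in\mathbb{C}\{x,\mathbf y\}$ of order at least two. With $\mathbf A(x)$ the $2\times2$ matrix of the part of the $(\partial_{y_1},\partial_{y_2})$-components linear in $\mathbf y$, $\mathrm{res}(Y)=(\mathrm{Tr}\,\mathbf A(x)/x)_{|x=0}$; $Y$ is strictly non-degenerate if $\Re(\mathrm{res}(Y))>0$. $Y$ is div-integrable if $Y_{|\{x=0\}}$ is analytically conjugate to some $U(\mathbf y)(\lambda_1y_1\partial_{y_1}+\lambda_2y_2\partial_{y_2})$ with $U\in\mathbb{C}\{\mathbf y\}$, $U(0)\neq0$. For such $Y$ there is a unique formal fibered diffeomorphism $\hat\Phi$ tangent to the identity with $\hat\Phi_*(Y)=Y_{\mathrm{norm}}=x^2\partial_x+(-\lambda+a_1x-c(y_1y_2))y_1\partial_{y_1}+(\lambda+a_2x+c(y_1y_2))y_2\partial_{y_2}$, where $a_1+a_2=\mathrm{res}(Y)$ and $c\in v\mathbb{C}\{v\}$;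 $Y_{\mathrm{norm}}$ is the formal normal form. The sectorial normalizing maps $\Phi_\pm$ are the germs of analytic sectorial fibered diffeomorphisms in $S_\pm\times(\mathbb{C}^2,0)$, tangent to the identity, conjugating $Y$ to $Y_{\mathrm{norm}}$ and admitting $\hat\Phi$ as weak Gevrey-1 asymptotic expansion (they exist, and they are the 1-sums of $\hat\Phi$ along the directions $\arg(\pm i\lambda)$). Here a function $f=\sum_{\mathbf j}F_{\mathbf j}(x)\mathbf y^{\mathbf j}$, analytic and bounded on $S\times\mathbf D(\mathbf 0,\mathbf r)$, has $\sum_{\mathbf j}\hat F_{\mathbf j}(x)\mathbf y^{\mathbf j}$ as weak Gevrey-1 asymptotic expansion if each $F_{\mathbf j}$ has $\hat F_{\mathbf j}=\sum_k F_{\mathbf j,k}x^k$ as Gevrey-1 asymptotic expansion on $S$: on every closed subsector, $|F_{\mathbf j}(x)-\sum_{k<N}F_{\mathbf j,k}x^k|\le AC^NN!|x|^N$ for all $N$. A germ of sectorial fibered diffeomorphism in $S\times(\mathbb{C}^2,0)$ is a holomorphic fibered map on $S\times\mathbf D(\mathbf 0,\mathbf r)$ for some polydisc, biholomorphic onto its image (maps coinciding after shrinking the radii being identified); tangent to the identity means $\Phi(x,\mathbf y)-(x,\mathbf y)=O(\|(x,\mathbf y)\|^2)$ as $(x,\mathbf y)\to0$ in the domain. *)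

(* Defs.v *)
From Stdlib Require Import Reals Factorial.
From Coquelicot Require Import Coquelicot.
Local Open Scope C_scope.

Definition C2 : NormedModule C_AbsRing :=
  prod_NormedModule C_AbsRing C_NormedModule C_NormedModule.

(* Points are (x, (y1, y2)). *)
Definition C3 : NormedModule C_AbsRing :=
  prod_NormedModule C_AbsRing C_NormedModule C2.

Definition polydisc (r1 r2 : R) (y : C2) : Prop :=
  Cmod (fst y) < r1 /\ Cmod (snd y) < r2.

Definition tube (S : C -> Prop) (r1 r2 : R) (p : C3) : Prop :=
  S (fst p) /\ polydisc r1 r2 (snd p).

(* Points of S x D(0, (delta, delta)) with |x| < delta: these sets are
   the traces on S x C^2 of a basis of neighborhoods of 0 in C^3. *)
Definition small_tube (S : C -> Prop) (delta : R) (p : C3) : Prop :=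
  tube S delta delta p /\ Cmod (fst p) < delta.

(* [filterdiff] over [C_AbsRing] is the complex (C-linear) Frechet
   differential. *)

Definition holomorphic_on {U V : NormedModule C_AbsRing}
    (D : U -> Prop) (f : U -> V) : Prop :=
  forall p, D p -> ex_filterdiff f (locally p).

Definition biholomorphic_onto_image {U V : NormedModule C_AbsRing}
    (D : U -> Prop) (f : U -> V) : Prop :=
  let image := fun q => exists p, D p /\ f p = q in
  holomorphic_on D f /\
  open image /\
  exists g : V -> U, holomorphic_on image g /\ forall p, D p -> g (f p) = p.

(* f_*(Y) = Z on f(D), that is (Df . Y) o f^-1 = Z evaluated at the points
   f(p), p in D. *)
Definition pushes_forward {U V : NormedModule C_AbsRing} (D : U -> Prop)
    (f : U -> V) (Y : U -> U) (Z : V -> V) : Prop :=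
  forall p, D p ->
    exists df : U -> V, filterdiff f (locally p) df /\ df (Y p) = Z (f p).

(* [CLim], [eval1], [eval2] and [eval3] are total; their values are meaningful
   only for convergent sequences and series. *)

Definition CLim (u : nat -> C) : C :=
  (real (Lim_seq (fun n => Re (u n))), real (Lim_seq (fun n => Im (u n)))).

Definition psum2 {G : AbelianMonoid} (t : nat -> nat -> G) (n : nat) : G :=
  sum_n (fun j => sum_n (fun k => t j k) n) n.

Definition psum3 {G : AbelianMonoid} (t : nat -> nat -> nat -> G) (n : nat) : G :=
  sum_n (fun i => psum2 (t i) n) n.

Definition eval1 (c : nat -> C) (v : C) : C :=
  CLim (sum_n (fun n => c n * v ^ n)).

Definition eval2 (u : nat -> nat -> C) (y : C2) : C :=
  CLim (psum2 (fun j k => u j k * fst y ^ j * snd y ^ k)).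

(* Formal power series in (x, y1, y2): [F i j k] is the coefficient of x^i y1^j y2^k. *)

Definition fps : Type := nat -> nat -> nat -> C.

Definition eval3 (F : fps) (p : C3) : C :=
  CLim (psum3 (fun i j k =>
    F i j k * fst p ^ i * fst (snd p) ^ j * snd (snd p) ^ k)).

Definition convergent1 (c : nat -> C) : Prop :=
  exists A rho : R, (0 < rho)%R /\ forall n, (Cmod (c n) * rho ^ n <= A)%R.

Definition convergent2 (u : nat -> nat -> C) : Prop :=
  exists A rho : R, (0 < rho)%R /\
    forall j k, (Cmod (u j k) * rho ^ (j + k) <= A)%R.

Definition convergent3 (F : fps) : Prop :=
  exists A rho : R, (0 < rho)%R /\
    forall i j k, (Cmod (F i j k) * rho ^ (i + j + k) <= A)%R.

Definition order_ge (d : nat) (F : fps) : Prop :=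
  forall i j k, (i + j + k < d)%nat -> F i j k = 0.

Definition fps_monomial (i0 j0 k0 : nat) : fps := fun i j k =>
  if (Nat.eqb i i0 && Nat.eqb j j0 && Nat.eqb k k0)%bool then 1 else 0.

Definition fps_X : fps := fps_monomial 1 0 0.
Definition fps_Y1 : fps := fps_monomial 0 1 0.
Definition fps_Y2 : fps := fps_monomial 0 0 1.
Definition fps_one : fps := fps_monomial 0 0 0.

Definition fps_add (F G : fps) : fps := fun i j k => F i j k + G i j k.
Definition fps_sub (F G : fps) : fps := fun i j k => F i j k - G i j k.
Definition fps_scal (a : C) (F : fps) : fps := fun i j k => a * F i j k.

Definition fps_mul (F G : fps) : fps := fun i j k =>
  sum_n (fun i' => sum_n (fun j' => sum_n (fun k' =>
    F i' j' k' * G (i - i')%nat (j - j')%nat (k - k')%nat) k) j) i.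

Fixpoint fps_pow (F : fps) (n : nat) : fps :=
  match n with
  | O => fps_one
  | S m => fps_mul F (fps_pow F m)
  end.

Definition fps_dx (F : fps) : fps := fun i j k => INR (S i) * F (S i) j k.
Definition fps_dy1 (F : fps) : fps := fun i j k => INR (S j) * F i (S j) k.
Definition fps_dy2 (F : fps) : fps := fun i j k => INR (S k) * F i j (S k).

(* The composition c(F), for F without constant term: F^n has order >= n, so
   that only the powers n <= i+j+k contribute to the coefficient (i, j, k). *)
Definition fps_comp (c : nat -> C) (F : fps) : fps := fun i j k =>
  sum_n (fun n => c n * fps_pow F n i j k) (i + j + k).

Record saddle_node : Type := SaddleNode {
  lam : C;
  F1 : fps;
  F2 : fps;
  lam_neq0 : lam <> 0;
  F1_convergent : convergent3 F1;
  F2_convergent : convergent3 F2;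
  F1_order : order_ge 2 F1;
  F2_order : order_ge 2 F2
}.

Definition saddle_node_field (Y : saddle_node) (p : C3) : C3 :=
  let x := fst p in let y1 := fst (snd p) in let y2 := snd (snd p) in
  (x ^ 2, (- lam Y * y1 + eval3 (F1 Y) p, lam Y * y2 + eval3 (F2 Y) p)).

Definition formal_comp1 (Y : saddle_node) : fps :=
  fps_add (fps_scal (- lam Y) fps_Y1) (F1 Y).

Definition formal_comp2 (Y : saddle_node) : fps :=
  fps_add (fps_scal (lam Y) fps_Y2) (F2 Y).

(* Coefficients of the power series Tr A(x). *)
Definition trace_linear_part (Y : saddle_node) (n : nat) : C :=
  formal_comp1 Y n 1%nat 0%nat + formal_comp2 Y n 0%nat 1%nat.

(* Tr A(x) vanishes at x = 0, and [PS_decr_1] divides it by x. *)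
Definition residue (Y : saddle_node) : C :=
  PS_decr_1 (trace_linear_part Y) 0%nat.

Definition strictly_nondegenerate (Y : saddle_node) : Prop :=
  (0 < Re (residue Y))%R.

Definition div_integrable (Y : saddle_node) : Prop :=
  exists (l1 l2 : C) (u : nat -> nat -> C) (psi : C2 -> C2) (delta : R),
    convergent2 u /\ u 0%nat 0%nat <> 0 /\
    (0 < delta)%R /\
    psi zero = zero /\
    biholomorphic_onto_image (polydisc delta delta) psi /\
    pushes_forward (polydisc delta delta) psi
      (fun y => snd (saddle_node_field Y (RtoC 0, y)))
      (fun z => (eval2 u z * (l1 * fst z), eval2 u z * (l2 * snd z))).

Record normal_form : Type := NormalForm {
  nf_a1 : C;
  nf_a2 : C;
  nf_c : nat -> C;
  nf_c_convergent : convergent1 nf_c;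
  nf_c_0 : nf_c 0%nat = 0
}.

Definition normal_form_field (lam : C) (N : normal_form) (p : C3) : C3 :=
  let x := fst p in let y1 := fst (snd p) in let y2 := snd (snd p) in
  (x ^ 2,
    ((- lam + nf_a1 N * x - eval1 (nf_c N) (y1 * y2)) * y1,
     (lam + nf_a2 N * x + eval1 (nf_c N) (y1 * y2)) * y2)).

(* The derivation Y applied to a formal power series. *)
Definition formal_lie (Y : saddle_node) (F : fps) : fps :=
  fps_add (fps_mul (fps_mul fps_X fps_X) (fps_dx F))
    (fps_add (fps_mul (formal_comp1 Y) (fps_dy1 F))
             (fps_mul (formal_comp2 Y) (fps_dy2 F))).

(* The formal fibered diffeomorphism (x, y) |-> (x, u1(x,y), u2(x,y)) is tangent
   to the identity and pushes Y forward to the normal form N. *)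
Definition formal_normalization (Y : saddle_node) (N : normal_form)
    (u1 u2 : fps) : Prop :=
  nf_a1 N + nf_a2 N = residue Y /\
  order_ge 2 (fps_sub u1 fps_Y1) /\
  order_ge 2 (fps_sub u2 fps_Y2) /\
  (forall i j k, formal_lie Y u1 i j k =
    fps_mul (fps_sub (fps_add (fps_scal (- lam Y) fps_one)
                              (fps_scal (nf_a1 N) fps_X))
                     (fps_comp (nf_c N) (fps_mul u1 u2))) u1 i j k) /\
  (forall i j k, formal_lie Y u2 i j k =
    fps_mul (fps_add (fps_add (fps_scal (lam Y) fps_one)
                              (fps_scal (nf_a2 N) fps_X))
                     (fps_comp (nf_c N) (fps_mul u1 u2))) u2 i j k).

Definition is_arg (z : C) (t : R) : Prop :=
  (- PI < t <= PI)%R /\ z = Cmod z * (cos t, sin t).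

(* [sector lam 1 eps r] and [sector lam (-1) eps r] are S_+ and S_-. *)
Definition sector (lam : C) (sgn eps r : R) (x : C) : Prop :=
  (0 < Cmod x < r)%R /\
  exists t : R, is_arg (sgn * x / (Ci * lam)) t /\ (Rabs t < PI / 2 + eps)%R.

Definition closed_sector (alpha beta rho : R) (x : C) : Prop :=
  (0 < Cmod x <= rho)%R /\
  exists t : R, (alpha <= t <= beta)%R /\ x = Cmod x * (cos t, sin t).

Definition truncated (a : nat -> C) (N : nat) (x : C) : C :=
  match N with
  | O => 0
  | S m => sum_n (fun k => a k * x ^ k) m
  end.

Definition gevrey1 (S : C -> Prop) (f : C -> C) (a : nat -> C) : Prop :=
  forall alpha beta rho : R,
    (forall x, closed_sector alpha beta rho x -> S x) ->
    exists A B : R, forall (N : nat) (x : C), closed_sector alpha beta rho x ->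
      (Cmod (f x - truncated a N x) <= A * B ^ N * INR (fact N) * Cmod x ^ N)%R.

(* f(x, y) = sum_{j,k} f_{j,k}(x) y1^j y2^k is bounded on some S x D(0, (r1, r2)),
   and each f_{j,k} has sum_i F_{i,j,k} x^i as Gevrey-1 asymptotic expansion. *)
Definition weak_gevrey1 (S : C -> Prop) (f : C3 -> C) (F : fps) : Prop :=
  exists (r1 r2 M : R) (fc : nat -> nat -> C -> C),
    (0 < r1)%R /\ (0 < r2)%R /\
    (forall p : C3, tube S r1 r2 p ->
      let x := fst p in let y1 := fst (snd p) in let y2 := snd (snd p) in
      (Cmod (f p) <= M)%R /\
      (exists B : R, forall n,
        (psum2 (fun j k => Cmod (fc j k x * y1 ^ j * y2 ^ k)) n <= B)%R) /\
      f p = eval2 (fun j k => fc j k x) (snd p)) /\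
    forall j k, gevrey1 S (fc j k) (fun i => F i j k).

(* A germ in S x (C^2, 0) is represented by a total map [C3 -> C3], which is
   relevant only on S x D(0, (r1, r2)) for small radii r1 and r2. *)

Definition sectorial_diffeo (S : C -> Prop) (Phi : C3 -> C3) : Prop :=
  exists r1 r2 : R, (0 < r1)%R /\ (0 < r2)%R /\
    (forall p, tube S r1 r2 p -> fst (Phi p) = fst p) /\
    biholomorphic_onto_image (tube S r1 r2) Phi.

Definition tangent_to_id (S : C -> Prop) (Phi : C3 -> C3) : Prop :=
  exists K delta : R, (0 < delta)%R /\
    forall p, small_tube S delta p ->
      (norm (minus (Phi p) p) <= K * norm p ^ 2)%R.

(* Y and its normal form are germs at 0 of C^3, so the identity
   Phi_*(Y) = Y_norm is between germs at 0: it is required on the points of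
   S x (C^2, 0) close enough to 0. *)
Definition normalizes (Y : saddle_node) (N : normal_form) (S : C -> Prop)
    (Phi : C3 -> C3) : Prop :=
  exists delta : R, (0 < delta)%R /\
    pushes_forward (small_tube S delta) Phi
      (saddle_node_field Y) (normal_form_field (lam Y) N).

Definition sectorial_normalizing_map (Y : saddle_node) (N : normal_form)
    (u1 u2 : fps) (S : C -> Prop) (Phi : C3 -> C3) : Prop :=
  sectorial_diffeo S Phi /\
  tangent_to_id S Phi /\
  normalizes Y N S Phi /\
  weak_gevrey1 S (fun p => fst (snd (Phi p))) u1 /\
  weak_gevrey1 S (fun p => snd (snd (Phi p))) u2.

Definition eq_germ (S : C -> Prop) (Phi Psi : C3 -> C3) : Prop :=
  exists r1 r2 : R, (0 < r1)%R /\ (0 < r2)%R /\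
    forall p, tube S r1 r2 p -> Phi p = Psi p.

(* Main.v *)
Require Import Defs.
From Stdlib Require Import Reals Arith Lra Lia Classical ClassicalEpsilon FunctionalExtensionality.
From Coquelicot Require Import Coquelicot.

(* Since [Phi] is close to the identity, [psi = phi o Phi^-1] is an isotropy of the normal form, tangent to the
   identity.  Put [k0 = +-i lambda]; the region [Re (k0 / x) > R0] lies in the sector, and along the real curves
   [k0 / x = Z0 + (1 +- i) t] the trajectories of the normal form satisfy [v = y1 y2 ~ x^(a1+a2) -> 0], because
   [Re (a1 + a2) > 0], while [y1] is multiplied by a factor [E(t)] that grows or decays exponentially according to
   the sign.  A first integral [f] with [f = O(1/v)] is a Laurent series in [y1] at fixed [(x, v)], whose coefficients
   are transported by powers of [E(t)]; hence only the constant one survives, and [f] depends on [v] alone.  Applied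
   to [psi1 psi2 / v], then to [psi1 / y1], this and tangency to the identity give [psi = id] on the region.  The
   identity theorem extends [phi = Phi] to the whole sector. *)

(** On the straight path [m = 0] the leading phase of [y1] only rotates, because [lam = i q k0] with
    [q] real and nonzero; the tilts [m = 1] and [m = -1] give it a real part of either sign while
    [x] and [v] still tend to 0. Both tilted paths start at the same point, so together they kill
    the Laurent coefficients of both signs. The obstacle is that trajectories leave the polydisc,
    since [y1] or [y2] grows: no single point can be followed for long. Laurent coefficients can,
    because they do not depend on the radius: the circle is carried along for a short time and then
    put back to its place. The bound [O(1/v)] is enough because [v] decays only like a power of [t],
    against an exponential. The product has to be settled first: in the equation of [psi1 psi2] the
    terms in [lam] and [c] cancel, whereas that of [psi1] contains [c(psi1 psi2)] and agrees with
    the equation of [y1] only once [psi1 psi2 = y1 y2] is known. The value of a first integral is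
    read off late on the path, where [x], [y1], [y2] are all small and tangency to the identity says
    something. *)

Local Open Scope C_scope.

(** * First-order expansions *)

(* First-order expansion at a point known only through the size [r] of the increment: [f = f0 + L + o(r)], [L = O(r)].
   It covers complex derivatives, derivatives of curves and partial derivatives on C^3 at once. *)
Definition expands {T : Type} (r : T -> R) (f : T -> C) (f0 : C) (L : T -> C) : Prop :=
  (forall eps : R, (0 < eps)%R -> exists d : R, (0 < d)%R /\
     forall q, (r q < d)%R -> (Cmod (f q - f0 - L q) <= eps * r q)%R) /\
  (exists M : R, (0 <= M)%R /\ forall q, (Cmod (L q) <= M * r q)%R).

Lemma Cmod_0_eq (z : C) : (forall e : R, (0 < e)%R -> (Cmod z <= e)%R) -> z = 0.
Proof.
intros H; apply Cmod_eq_0.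
destruct (Rle_lt_dec (Cmod z) 0) as [h|h].
- apply Rle_antisym; auto; apply Cmod_ge_0.
- specialize (H (Cmod z / 2)%R); lra.
Qed.

Lemma Cmod_sub_comm (a b : C) : Cmod (a - b) = Cmod (b - a).
Proof. rewrite <- Cmod_opp; f_equal; ring. Qed.

Lemma Cmod_tri (a b c : C) : (Cmod (a - c) <= Cmod (a - b) + Cmod (b - c))%R.
Proof. replace (a - c) with ((a - b) + (b - c)) by ring; apply Cmod_triangle. Qed.

Lemma Cmod_rev (a b : C) : (Cmod a <= Cmod b + Cmod (a - b))%R.
Proof. replace a with (b + (a - b)) at 1 by ring; apply Cmod_triangle. Qed.

Lemma Cmod_sub_le (a b : C) : (Cmod (a - b) <= Cmod a + Cmod b)%R.
Proof. unfold Cminus; rewrite <- (Cmod_opp b); apply Cmod_triangle. Qed.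

Lemma expands_ext {T} (r : T -> R) f g f0 L L' :
  (forall q, f q = g q) -> (forall q, L q = L' q) -> expands r f f0 L -> expands r g f0 L'.
Proof.
intros H1 H2 [H3 [M [H4 H5]]]; split.
- intros e he; destruct (H3 e he) as [d [hd H]]; exists d; split; auto.
  intros q hq; rewrite <- H1, <- H2; auto.
- exists M; split; auto; intros q; rewrite <- H2; auto.
Qed.

Lemma expands_ext_loc {T} (r : T -> R) f g f0 L (d0 : R) : (0 < d0)%R ->
  (forall q, (r q < d0)%R -> f q = g q) -> expands r f f0 L -> expands r g f0 L.
Proof.
intros hd0 H1 [H3 H4]; split; auto.
intros e he; destruct (H3 e he) as [d [hd H]]; exists (Rmin d d0); split.
- apply Rmin_pos; auto.
- intros q hq; rewrite <- H1; [apply H|]; eapply Rlt_le_trans; eauto using Rmin_l, Rmin_r.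
Qed.

Section Rules.
Context {T : Type} (r : T -> R) (r_pos : forall q, (0 <= r q)%R).

Lemma expands_const c : expands r (fun _ => c) c (fun _ => 0).
Proof.
split.
- intros e he; exists 1%R; split; [lra|]; intros q _.
  replace (c - c - 0) with (RtoC 0) by ring; rewrite Cmod_0.
  apply Rmult_le_pos; auto; lra.
- exists 0%R; split; [lra|]; intros; rewrite Cmod_0; lra.
Qed.

Lemma expands_cont f f0 L : expands r f f0 L ->
  forall eps : R, (0 < eps)%R -> exists d : R, (0 < d)%R /\
     forall q, (r q < d)%R -> (Cmod (f q - f0) <= eps)%R.
Proof.
intros [H [M [HM HL]]] e he.
destruct (H 1%R) as [d [hd Hd]]; [lra|].
exists (Rmin d (e / (1 + M)))%R; split.
- apply Rmin_pos; auto; apply Rdiv_lt_0_compat; lra.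
- intros q hq.
  assert (h1 : (r q < d)%R) by (eapply Rlt_le_trans; [exact hq|apply Rmin_l]).
  assert (h2 : (r q < e / (1 + M))%R) by (eapply Rlt_le_trans; [exact hq|apply Rmin_r]).
  assert (h3 := Hd q h1). assert (h4 := HL q).
  assert (h5 := Cmod_rev (f q - f0) (L q)).
  apply Rle_trans with ((1 + M) * r q)%R; [lra|].
  apply Rlt_le. apply Rmult_lt_compat_l with (r := (1 + M)%R) in h2; [|lra].
  replace ((1 + M) * (e / (1 + M)))%R with e in h2 by (field; lra). lra.
Qed.

Lemma expands_plus f f0 L g g0 L' : expands r f f0 L -> expands r g g0 L' ->
  expands r (fun q => f q + g q) (f0 + g0) (fun q => L q + L' q).
Proof.
intros [H1 [M [HM HL]]] [H2 [M' [HM' HL']]]; split.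
- intros e he. destruct (H1 (e/2)%R) as [d [hd Hd]]; [lra|]. destruct (H2 (e/2)%R) as [d' [hd' Hd']]; [lra|].
  exists (Rmin d d'); split; [apply Rmin_pos; auto|].
  intros q hq.
  assert (h1 : (r q < d)%R) by (eapply Rlt_le_trans; [exact hq|apply Rmin_l]).
  assert (h2 : (r q < d')%R) by (eapply Rlt_le_trans; [exact hq|apply Rmin_r]).
  replace (f q + g q - (f0 + g0) - (L q + L' q)) with ((f q - f0 - L q) + (g q - g0 - L' q)) by ring.
  eapply Rle_trans; [apply Cmod_triangle|]. specialize (Hd q h1); specialize (Hd' q h2); lra.
- exists (M + M')%R; split; [lra|]; intros q. eapply Rle_trans; [apply Cmod_triangle|].
  specialize (HL q); specialize (HL' q); lra.
Qed.

Lemma expands_mult f f0 L g g0 L' : expands r f f0 L -> expands r g g0 L' ->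
  expands r (fun q => f q * g q) (f0 * g0) (fun q => L q * g0 + f0 * L' q).
Proof.
intros Hf Hg.
destruct (expands_cont _ _ _ Hg) with (eps := 1%R) as [d0 [hd0 Hd0]]; [lra|].
pose proof (expands_cont _ _ _ Hg) as Cg.
destruct Hf as [H1 [M [HM HL]]], Hg as [H2 [M' [HM' HL']]]; split.
- intros e he.
  (* [K] dominates [Cmod (g q)] near the point, [Cmod f0] and [M] at once, so that each of the three
     terms of the remainder costs at most a third of [e]. *)
  set (K := (1 + Cmod g0 + Cmod f0 + M)%R).
  assert (hK : (0 < K)%R) by (unfold K; pose proof (Cmod_ge_0 g0); pose proof (Cmod_ge_0 f0); lra).
  assert (heK : (0 < e / (3 * K))%R) by (apply Rdiv_lt_0_compat; lra).
  destruct (H1 (e / (3 * K))%R) as [d1 [hd1 Hd1]]; auto.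
  destruct (H2 (e / (3 * K))%R) as [d2 [hd2 Hd2]]; auto.
  destruct (Cg (e / (3 * K))%R) as [d3 [hd3 Hd3]]; auto.
  exists (Rmin (Rmin d0 d1) (Rmin d2 d3)); split; [repeat apply Rmin_pos; auto|].
  intros q hq.
  apply Rmin_Rgt in hq; destruct hq as [hq hq']; apply Rmin_Rgt in hq, hq'.
  destruct hq as [q0 q1], hq' as [q2 q3].
  specialize (Hd0 q q0); specialize (Hd1 q q1); specialize (Hd2 q q2); specialize (Hd3 q q3).
  specialize (HL q). specialize (HL' q).
  replace (f q * g q - f0 * g0 - (L q * g0 + f0 * L' q)) with
    ((f q - f0 - L q) * g q + f0 * (g q - g0 - L' q) + L q * (g q - g0)) by ring.
  set (u := (e / (3 * K))%R) in *.
  assert (hu : (3 * K * u = e)%R) by (unfold u; field; lra).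
  eapply Rle_trans; [apply Cmod_triangle|].
  eapply Rle_trans; [apply Rplus_le_compat_r, Cmod_triangle|].
  rewrite !Cmod_mult.
  assert (hg : (Cmod (g q) <= Cmod g0 + 1)%R) by (pose proof (Cmod_rev (g q) g0); lra).
  assert (hr := r_pos q).
  assert (t1 : (Cmod (f q - f0 - L q) * Cmod (g q) <= (u * r q) * K)%R).
  { apply Rmult_le_compat; try apply Cmod_ge_0; auto. unfold K; pose proof (Cmod_ge_0 f0); lra. }
  assert (t2 : (Cmod f0 * Cmod (g q - g0 - L' q) <= K * (u * r q))%R).
  { apply Rmult_le_compat; try apply Cmod_ge_0; auto. unfold K; pose proof (Cmod_ge_0 g0); lra. }
  assert (t3 : (Cmod (L q) * Cmod (g q - g0) <= (K * r q) * u)%R).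
  { apply Rmult_le_compat; try apply Cmod_ge_0; auto. eapply Rle_trans; eauto. apply Rmult_le_compat_r; auto.
    unfold K; pose proof (Cmod_ge_0 g0);pose proof (Cmod_ge_0 f0); lra. }
  rewrite <- hu. lra.
- exists (M * Cmod g0 + Cmod f0 * M')%R; split.
  + pose proof (Cmod_ge_0 g0); pose proof (Cmod_ge_0 f0). apply Rplus_le_le_0_compat; apply Rmult_le_pos; auto.
  + intros q; eapply Rle_trans; [apply Cmod_triangle|]. rewrite !Cmod_mult.
    specialize (HL q); specialize (HL' q); pose proof (Cmod_ge_0 g0); pose proof (Cmod_ge_0 f0).
    apply (Rmult_le_compat_r (Cmod g0)) in HL; auto.
    apply (Rmult_le_compat_l (Cmod f0)) in HL'; auto. lra.
Qed.

(** Chain rule that asks of the inner map [m] only what the outer expansion can see: its size, and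
    the linear part along [m] up to [o(r)]. This serves outer functions on C and on C^3 alike. *)
Lemma expands_comp {U} (s : U -> R) (s_pos : forall u, (0 <= s u)%R) (m : T -> U) (F : U -> C) F0 L
   (G : T -> C) (C0 : R) :
  expands s F F0 L ->
  (forall eps : R, (0 < eps)%R -> exists d : R, (0 < d)%R /\
     forall q, (r q < d)%R -> (s (m q) <= C0 * r q)%R /\ (Cmod (L (m q) - G q) <= eps * r q)%R) ->
  (exists M : R, (0 <= M)%R /\ forall q, (Cmod (G q) <= M * r q)%R) ->
  expands r (fun q => F (m q)) F0 G.
Proof.
intros [H1 _] H2 H3; split; auto.
intros e he.
set (K := (1 + Rabs C0)%R). assert (hK : (0 < K)%R) by (unfold K; pose proof (Rabs_pos C0); lra).
destruct (H1 (e / (2 * K))%R) as [d [hd Hd]]; [apply Rdiv_lt_0_compat; lra|].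
destruct (H2 (e / 2)%R) as [d' [hd' Hd']]; [lra|].
exists (Rmin d' (d / K)); split; [apply Rmin_pos; auto; apply Rdiv_lt_0_compat; lra|].
intros q hq. apply Rmin_Rgt in hq; destruct hq as [q1 q2].
destruct (Hd' q q1) as [h1 h2].
assert (hr := r_pos q).
assert (h3 : (s (m q) <= K * r q)%R).
{ eapply Rle_trans; eauto. apply Rmult_le_compat_r; auto. unfold K; pose proof (Rle_abs C0); lra. }
assert (h4 : (s (m q) < d)%R).
{ eapply Rle_lt_trans; eauto. apply (Rmult_lt_compat_l K) in q2; auto.
  replace (K * (d / K))%R with d in q2 by (field; lra). auto. }
specialize (Hd _ h4).
replace (F (m q) - F0 - G q) with ((F (m q) - F0 - L (m q)) + (L (m q) - G q)) by ring.
eapply Rle_trans; [apply Cmod_triangle|].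
apply (Rmult_le_compat_l (e / (2 * K))%R) in h3; [|apply Rlt_le, Rdiv_lt_0_compat; lra].
replace (e / (2 * K) * (K * r q))%R with (e / 2 * r q)%R in h3 by (field; lra). lra.
Qed.
End Rules.

Definition cderiv (f : C -> C) (z l : C) : Prop :=
  expands (fun w => Cmod (w - z)) f (f z) (fun w => l * (w - z)).

Definition rderiv (f : R -> C) (t : R) (l : C) : Prop :=
  expands (fun s => Rabs (s - t)) f (f t) (fun s => l * RtoC (s - t)).

Definition dist3 (p q : C3) : R :=
  (Cmod (fst q - fst p) + Cmod (fst (snd q) - fst (snd p)) + Cmod (snd (snd q) - snd (snd p)))%R.

Definition partials (f : C3 -> C) (p : C3) (a b1 b2 : C) : Prop :=
  expands (dist3 p) f (f p) (fun q =>
    a * (fst q - fst p) + b1 * (fst (snd q) - fst (snd p)) + b2 * (snd (snd q) - snd (snd p))).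

Lemma dist3_pos p q : (0 <= dist3 p q)%R.
Proof. unfold dist3; pose proof (Cmod_ge_0 (fst q - fst p));
 pose proof (Cmod_ge_0 (fst (snd q) - fst (snd p))); pose proof (Cmod_ge_0 (snd (snd q) - snd (snd p))); lra. Qed.

Lemma expands_bound {T} (r : T -> R) (r_pos : forall q, (0 <= r q)%R) f f0 L : expands r f f0 L ->
  exists d K : R, (0 < d)%R /\ (0 <= K)%R /\ forall q, (r q < d)%R -> (Cmod (f q - f0) <= K * r q)%R.
Proof.
intros [H [M [HM HL]]]. destruct (H 1%R) as [d [hd Hd]]; [lra|].
exists d, (1 + M)%R; repeat split; auto; try lra.
intros q hq; specialize (Hd q hq); specialize (HL q). pose proof (Cmod_rev (f q - f0) (L q)); lra.
Qed.

Lemma expands_cderiv {T} (r : T -> R) (r_pos : forall q, (0 <= r q)%R) (F : C -> C) l f f0 L :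
  cderiv F f0 l -> expands r f f0 L -> expands r (fun q => F (f q)) (F f0) (fun q => l * L q).
Proof.
intros HF Hf. destruct (expands_bound r r_pos _ _ _ Hf) as [d0 [K [hd0 [hK HK]]]].
apply (expands_comp r r_pos _ (fun _ => Cmod_ge_0 _) f F (F f0) _ _ K HF).
- destruct Hf as [H _]. intros e he.
  assert (hl := Cmod_ge_0 l).
  destruct (H (e / (1 + Cmod l))%R) as [d [hd Hd]]; [apply Rdiv_lt_0_compat; lra|].
  exists (Rmin d0 d); split; [apply Rmin_pos; auto|]. intros q hq; apply Rmin_Rgt in hq; destruct hq as [q1 q2].
  split; auto. specialize (Hd q q2).
  replace (l * (f q - f0) - l * L q) with (l * (f q - f0 - L q)) by ring. rewrite Cmod_mult.
  apply Rle_trans with ((1 + Cmod l) * (e / (1 + Cmod l) * r q))%R.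
  + apply Rmult_le_compat; auto; try apply Cmod_ge_0; lra.
  + right; field; lra.
- destruct Hf as [_ [M [HM HL]]]. exists (Cmod l * M)%R; split.
  + apply Rmult_le_pos; auto; apply Cmod_ge_0.
  + intros q; rewrite Cmod_mult, Rmult_assoc. apply Rmult_le_compat_l; auto; apply Cmod_ge_0.
Qed.

(** The single chain rule for functions on C^3: it is used along real trajectories, along hyperbolas
    [y1 y2 = v], along complex lines in [y], and in the logarithm of [x]. *)
Lemma expands_partials {T} (r : T -> R) (r_pos : forall q, (0 <= r q)%R) (F : C3 -> C) (p : C3) a b1 b2 f L g1 L1 g2 L2 :
  partials F p a b1 b2 -> expands r f (fst p) L -> expands r g1 (fst (snd p)) L1 -> expands r g2 (snd (snd p)) L2 ->
  expands r (fun q => F (f q, (g1 q, g2 q))) (F p) (fun q => a * L q + b1 * L1 q + b2 * L2 q).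
Proof.
intros HF Hf Hg1 Hg2.
destruct (expands_bound r r_pos _ _ _ Hf) as [d0 [K [hd0 [hK HK]]]].
destruct (expands_bound r r_pos _ _ _ Hg1) as [d1 [K1 [hd1 [hK1 HK1]]]].
destruct (expands_bound r r_pos _ _ _ Hg2) as [d2 [K2 [hd2 [hK2 HK2]]]].
assert (Hl : expands r (fun q => a * (f q - fst p) + b1 * (g1 q - fst (snd p)) + b2 * (g2 q - snd (snd p))) 0
  (fun q => a * L q + b1 * L1 q + b2 * L2 q)).
{ assert (S : forall (c : C) h h0 L, expands r h h0 L -> expands r (fun q => c * (h q - h0)) 0 (fun q => c * L q)).
  { intros c h h0 L0 Hh.
    pose proof (expands_mult r r_pos _ _ _ _ _ _ (expands_const r r_pos c)
       (expands_plus r _ _ _ _ _ _ Hh (expands_const r r_pos (- h0)))) as X.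
    replace (c * (h0 + - h0)) with (RtoC 0) in X by ring.
    eapply expands_ext; [| |exact X]; intros q; simpl; unfold Cminus; ring. }
  replace (RtoC 0) with (0 + 0 + 0) by ring.
  apply expands_plus; auto. apply expands_plus; auto. }
apply (expands_comp r r_pos (dist3 p) (dist3_pos p) (fun q => (f q, (g1 q, g2 q))) F (F p) _ _ (K + K1 + K2) HF).
- destruct Hl as [H _]. intros e he. destruct (H e he) as [d [hd Hd]].
  exists (Rmin (Rmin d0 d1) (Rmin d2 d)); split; [repeat apply Rmin_pos; auto|].
  intros q hq. apply Rmin_Rgt in hq; destruct hq as [hq hq']; apply Rmin_Rgt in hq, hq'.
  destruct hq as [q0 q1], hq' as [q2 q3]. split.
  + unfold dist3; cbn [fst snd]. specialize (HK q q0); specialize (HK1 q q1); specialize (HK2 q q2). lra.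
  + specialize (Hd q q3). cbn [fst snd]. eapply Rle_trans; [|exact Hd]. right; f_equal; ring.
- apply Hl.
Qed.

(** * Complex exponential, derivatives and integrals *)

Definition cexp (z : C) : C := (exp (fst z) * cos (snd z), exp (fst z) * sin (snd z))%R.

Lemma cexp_plus (z w : C) : cexp (z + w) = cexp z * cexp w.
Proof.
destruct z as [a b], w as [c d]; unfold cexp, Cmult, Cplus; simpl.
rewrite exp_plus, cos_plus, sin_plus; f_equal; ring.
Qed.

Lemma cexp_0 : cexp 0 = 1.
Proof. unfold cexp; simpl; rewrite exp_0, cos_0, sin_0, !Rmult_1_l; reflexivity. Qed.

Lemma Cmod_cexp z : Cmod (cexp z) = exp (fst z).
Proof.
unfold cexp, Cmod; simpl.
replace (_ + _)%R with ((exp (fst z))^2 * ((sin (snd z))^2 + (cos (snd z))^2))%R by ring.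
rewrite <- !Rsqr_pow2, sin2_cos2, Rmult_1_r. apply sqrt_Rsqr, Rlt_le, exp_pos.
Qed.

Lemma cexp_neq0 z : cexp z <> 0.
Proof. intros H; apply (f_equal Cmod) in H; rewrite Cmod_cexp, Cmod_0 in H; pose proof (exp_pos (fst z)); lra. Qed.

Lemma cexp_inv z : cexp (- z) = / cexp z.
Proof.
pose proof (cexp_neq0 z).
replace (/ cexp z) with (/ cexp z * cexp (z + - z)).
- rewrite cexp_plus; field; auto.
- replace (z + - z) with (RtoC 0) by ring; rewrite cexp_0; ring.
Qed.

Lemma expands_real {T} (r : T -> R) (r_pos : forall q, (0 <= r q)%R) (g : R -> R) (x l : R) (u : T -> R) :
  derivable_pt_lim g x l -> (forall q, (Rabs (u q - x) <= r q)%R) ->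
  expands r (fun q => RtoC (g (u q))) (RtoC (g x)) (fun q => RtoC (l * (u q - x))).
Proof.
intros Hg Hu; split.
- intros e he; destruct (Hg e he) as [d Hd]; exists d; split; [apply cond_pos|].
  intros q hq. rewrite <- !RtoC_minus, Cmod_R.
  destruct (Req_dec (u q) x) as [h|h].
  + rewrite h. replace (g x - g x - l * (x - x))%R with 0%R by ring. rewrite Rabs_R0.
    apply Rmult_le_pos; auto; lra.
  + assert (hn : (u q - x <> 0)%R) by lra.
    specialize (Hd (u q - x)%R hn (Rle_lt_trans _ _ _ (Hu q) hq)).
    replace (x + (u q - x))%R with (u q) in Hd by ring.
    replace (g (u q) - g x - l * (u q - x))%R with (((g (u q) - g x) / (u q - x) - l) * (u q - x))%R by (field; auto).
    rewrite Rabs_mult. apply Rmult_le_compat; auto using Rabs_pos; lra.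
- exists (Rabs l); split; [apply Rabs_pos|]. intros q; rewrite Cmod_R, Rabs_mult.
  apply Rmult_le_compat_l; auto using Rabs_pos.
Qed.

Lemma Rabs_fst_le (z : C) : (Rabs (fst z) <= Cmod z)%R.
Proof. pose proof (Rmax_Cmod z). pose proof (Rmax_l (Rabs (fst z)) (Rabs (snd z))). lra. Qed.
Lemma Rabs_snd_le (z : C) : (Rabs (snd z) <= Cmod z)%R.
Proof. pose proof (Rmax_Cmod z). pose proof (Rmax_r (Rabs (fst z)) (Rabs (snd z))). lra. Qed.
Lemma Cmod_le_sum (z : C) : (Cmod z <= Rabs (fst z) + Rabs (snd z))%R.
Proof.
replace z with (RtoC (fst z) + Ci * RtoC (snd z)) at 1.
- eapply Rle_trans; [apply Cmod_triangle|]. rewrite Cmod_mult, !Cmod_R.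
  replace (Cmod Ci) with 1%R; [lra|]. unfold Cmod; simpl. replace (0*(0*1)+1*(1*1))%R with 1%R by ring. rewrite sqrt_1; auto.
- destruct z; unfold RtoC, Ci, Cmult, Cplus; simpl; f_equal; ring.
Qed.

(** The product rule applied to [exp x (cos y + i sin y)], each real factor being expanded as a
    function of the complex point; the resulting real-linear part turns out to be multiplication by
    [cexp z]. *)
Lemma cderiv_cexp z : cderiv cexp z (cexp z).
Proof.
unfold cderiv.
assert (P : forall q, (0 <= Cmod (q - z))%R) by (intros; apply Cmod_ge_0).
pose proof (expands_real _ P exp _ _ (fun w => fst w) (derivable_pt_lim_exp (fst z)) (fun q => Rabs_fst_le (q - z))) as H1.
pose proof (expands_real _ P cos _ _ (fun w => snd w) (derivable_pt_lim_cos (snd z)) (fun q => Rabs_snd_le (q - z))) as H2.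
pose proof (expands_real _ P sin _ _ (fun w => snd w) (derivable_pt_lim_sin (snd z)) (fun q => Rabs_snd_le (q - z))) as H3.
pose proof (expands_mult _ P _ _ _ _ _ _ H1 (expands_plus _ _ _ _ _ _ _ H2 (expands_mult _ P _ _ _ _ _ _ (expands_const _ P Ci) H3))) as H.
assert (E : forall w, cexp w = RtoC (exp (fst w)) * (RtoC (cos (snd w)) + Ci * RtoC (sin (snd w)))).
{ intros w; unfold cexp, RtoC, Ci, Cmult, Cplus; simpl; f_equal; ring. }
rewrite <- E in H.
eapply expands_ext; [| |exact H].
- intros q; simpl; rewrite E; auto.
- intros [a b]; destruct z as [c d]; unfold cexp, RtoC, Ci, Cmult, Cplus, Cminus, Copp; simpl; f_equal; ring.
Qed.

Lemma cderiv_id z : cderiv (fun w => w) z 1.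
Proof.
split.
- intros e he; exists 1%R; split; [lra|]; intros q _.
  replace (q - z - 1 * (q - z)) with (RtoC 0) by ring. rewrite Cmod_0. apply Rmult_le_pos; [lra|apply Cmod_ge_0].
- exists 1%R; split; [lra|]; intros q. rewrite Cmult_1_l; lra.
Qed.

Lemma cderiv_const c z : cderiv (fun _ => c) z 0.
Proof.
eapply expands_ext; [| |apply expands_const; intros; apply Cmod_ge_0]; auto. intros q; simpl; ring.
Qed.

Lemma cderiv_mult f g z l m : cderiv f z l -> cderiv g z m -> cderiv (fun w => f w * g w) z (l * g z + f z * m).
Proof.
intros Hf Hg. eapply expands_ext; [| |apply (expands_mult _ (fun _ => Cmod_ge_0 _) _ _ _ _ _ _ Hf Hg)]; auto.
intros; simpl; ring.
Qed.

Lemma cderiv_plus f g z l m : cderiv f z l -> cderiv g z m -> cderiv (fun w => f w + g w) z (l + m).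
Proof.
intros Hf Hg. eapply expands_ext; [| |apply (expands_plus _ _ _ _ _ _ _ Hf Hg)]; auto.
intros; simpl; ring.
Qed.

Lemma cderiv_comp f g z l m : cderiv f (g z) l -> cderiv g z m -> cderiv (fun w => f (g w)) z (l * m).
Proof.
intros Hf Hg. eapply expands_ext; [| |apply (expands_cderiv _ (fun _ => Cmod_ge_0 _) _ _ _ _ _ Hf Hg)]; auto.
intros; simpl; ring.
Qed.

Lemma cderiv_ext f g z l : (forall w, f w = g w) -> cderiv f z l -> cderiv g z l.
Proof. intros H; unfold cderiv; rewrite H; apply expands_ext; auto. Qed.

Lemma cderiv_ext_loc f g z l (d : R) : (0 < d)%R -> (forall w, (Cmod (w - z) < d)%R -> f w = g w) -> cderiv f z l -> cderiv g z l.
Proof.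
intros hd H; unfold cderiv. rewrite (H z); [|replace (z - z) with (RtoC 0) by ring; rewrite Cmod_0; auto].
apply (expands_ext_loc _ _ _ _ _ d); auto.
Qed.

Lemma cderiv_inv (z : C) : z <> 0 -> cderiv (fun w => / w) z (- / (z * z)).
Proof.
intros hz. assert (h0 := proj1 (Cmod_gt_0 z) hz).
split.
- intros e he. set (k := Cmod z) in *.
  assert (hk : (0 < k * k * k)%R) by (repeat apply Rmult_lt_0_compat; auto).
  (* The remainder is exactly [(q - z)^2 / (q z^2)]. The first bound gives [Cmod q >= k / 2], hence
     at most [2 s^2 / k^3] with [s = Cmod (q - z)]; the second turns this into [e s]. *)
  exists (Rmin (k / 2) (e * (k * k * k) / 2)); split.
  { apply Rmin_pos; [lra|]. apply Rdiv_lt_0_compat; [|lra]. apply Rmult_lt_0_compat; auto. }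
  intros q hq; apply Rmin_Rgt in hq; destruct hq as [q1 q2].
  assert (hq : (k / 2 <= Cmod q)%R).
  { pose proof (Cmod_rev z q) as X. rewrite Cmod_sub_comm in X. fold k in X. lra. }
  assert (q <> 0) by (apply Cmod_gt_0; lra).
  replace (/ q - / z - - / (z * z) * (q - z)) with ((q - z) * (q - z) / (q * (z * z))) by (field; auto).
  unfold Cdiv. rewrite !Cmod_mult, Cmod_inv, !Cmod_mult by (repeat apply Cmult_neq_0; auto). fold k.
  set (s := Cmod (q - z)) in *. assert (hs : (0 <= s)%R) by apply Cmod_ge_0.
  assert (i1 : (/ (Cmod q * (k * k)) <= / (k * k * k / 2))%R).
  { apply Rinv_le_contravar; [lra|]. assert (k / 2 * (k * k) <= Cmod q * (k * k))%R; [|lra].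
    apply Rmult_le_compat_r; [apply Rmult_le_pos; lra|auto]. }
  apply Rle_trans with (s * s * / (k * k * k / 2))%R.
  { apply Rmult_le_compat_l; auto. apply Rmult_le_pos; auto. }
  replace (s * s * / (k * k * k / 2))%R with (s * (2 * / (k * k * k)) * s)%R by (field; lra).
  apply Rmult_le_compat_r; auto.
  assert (i2 : (0 < 2 * / (k * k * k))%R) by (apply Rmult_lt_0_compat; [lra|apply Rinv_0_lt_compat; auto]).
  apply Rlt_le in q2. apply (Rmult_le_compat_r (2 * / (k * k * k))%R) in q2; [|lra].
  replace (e * (k * k * k) / 2 * (2 * / (k * k * k)))%R with e in q2 by (field; lra). lra.
- exists (Cmod (- / (z * z))); split; [apply Cmod_ge_0|]. intros; rewrite Cmod_mult; lra.
Qed.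

Lemma cderiv_pow n z : exists l, cderiv (fun w => w ^ n) z l.
Proof.
induction n as [|n [l IH]].
- exists 0. apply (cderiv_const 1).
- eexists. apply (cderiv_mult (fun w => w) (fun w => w ^ n)); [apply cderiv_id|exact IH].
Qed.

(** * Continuity, integrals and derivatives of complex functions of a real variable *)

Definition ccont (f : R -> C) (t : R) : Prop :=
  continuous (fun s => fst (f s)) t /\ continuous (fun s => snd (f s)) t.

Lemma ccont_eps f t : (forall eps : R, (0 < eps)%R -> exists d : R, (0 < d)%R /\
   forall s, (Rabs (s - t) < d)%R -> (Cmod (f s - f t) <= eps)%R) -> ccont f t.
Proof.
intros H.
assert (G : forall g : R -> R, (forall s, Rabs (g s - g t) <= Cmod (f s - f t))%R -> continuous g t).
{ intros g Hg. apply continuity_pt_filterlim. intros e he.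
  destruct (H (e / 2)%R) as [d [hd Hd]]; [lra|]. exists d; split; auto.
  intros s [_ hs]. unfold dist in *; simpl in *; unfold R_dist in *.
  specialize (Hg s); specialize (Hd s hs). lra. }
split; apply G; intros s; [apply (Rabs_fst_le (f s - f t))|apply (Rabs_snd_le (f s - f t))].
Qed.

Lemma ccont_mod f t : ccont f t -> forall eps : R, (0 < eps)%R -> exists d : R, (0 < d)%R /\
   forall s, (Rabs (s - t) < d)%R -> (Cmod (f s - f t) < eps)%R.
Proof.
intros [H1 H2] e he.
apply continuity_pt_filterlim in H1, H2.
destruct (H1 (e/2)%R) as [d1 [hd1 Hd1]]; [lra|]. destruct (H2 (e/2)%R) as [d2 [hd2 Hd2]]; [lra|].
exists (Rmin d1 d2); split; [apply Rmin_pos; auto|]. intros s hs; apply Rmin_Rgt in hs; destruct hs as [s1 s2].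
destruct (Req_dec s t) as [->|hn].
{ replace (f t - f t) with (RtoC 0) by ring. rewrite Cmod_0; auto. }
specialize (Hd1 s); specialize (Hd2 s). unfold dist in *; simpl in *; unfold R_dist, D_x, no_cond in *.
specialize (Hd1 (conj (conj I (not_eq_sym hn)) s1)). specialize (Hd2 (conj (conj I (not_eq_sym hn)) s2)).
eapply Rle_lt_trans; [apply Cmod_le_sum|]. simpl. unfold Rminus in *. lra.
Qed.

Lemma rderiv_cont f t l : rderiv f t l -> ccont f t.
Proof. intros H; apply ccont_eps. apply (expands_cont _ _ _ _ H). Qed.

Lemma ccont_const c t : ccont (fun _ => c) t.
Proof. split; apply continuous_const. Qed.

Lemma ccont_plus f g t : ccont f t -> ccont g t -> ccont (fun s => f s + g s) t.
Proof. intros [H1 H2] [H3 H4]; split; simpl; apply @continuous_plus; auto. Qed.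

Lemma ccont_mult f g t : ccont f t -> ccont g t -> ccont (fun s => f s * g s) t.
Proof.
intros [H1 H2] [H3 H4]; split; simpl.
- apply @continuous_minus; apply @continuous_mult; auto.
- apply @continuous_plus; apply @continuous_mult; auto.
Qed.

Lemma ccont_ext f g t : (forall s, f s = g s) -> ccont f t -> ccont g t.
Proof. intros H; replace g with f; auto. apply functional_extensionality; auto. Qed.

Lemma ccont_comp (F : C -> C) f t :
  (forall eps : R, (0 < eps)%R -> exists d : R, (0 < d)%R /\
     forall w, (Cmod (w - f t) < d)%R -> (Cmod (F w - F (f t)) <= eps)%R) ->
  ccont f t -> ccont (fun s => F (f s)) t.
Proof.
intros HF Hf; apply ccont_eps; intros e he. destruct (HF e he) as [d [hd Hd]].
destruct (ccont_mod _ _ Hf d hd) as [d' [hd' Hd']]. exists d'; split; auto.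
Qed.

Lemma cderiv_cont F z l : cderiv F z l -> forall eps : R, (0 < eps)%R -> exists d : R, (0 < d)%R /\
     forall w, (Cmod (w - z) < d)%R -> (Cmod (F w - F z) <= eps)%R.
Proof. intros H; apply (expands_cont _ _ _ _ H). Qed.

Definition cint (f : R -> C) (a b : R) : C :=
  (RInt (fun t => fst (f t)) a b, RInt (fun t => snd (f t)) a b).

Definition ex_cint (f : R -> C) (a b : R) : Prop :=
  ex_RInt (fun t => fst (f t)) a b /\ ex_RInt (fun t => snd (f t)) a b.

Lemma ex_cint_cont f a b : (forall t, (Rmin a b <= t <= Rmax a b)%R -> ccont f t) -> ex_cint f a b.
Proof. intros H; split; apply @ex_RInt_continuous; intros z hz; apply H; auto. Qed.

Lemma cint_ext f g a b : (forall t, (Rmin a b < t < Rmax a b)%R -> f t = g t) -> cint f a b = cint g a b.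
Proof. intros H; unfold cint; f_equal; apply RInt_ext; intros t ht; rewrite H; auto. Qed.

Lemma cint_plus f g a b : ex_cint f a b -> ex_cint g a b -> cint (fun t => f t + g t) a b = cint f a b + cint g a b.
Proof.
intros [H1 H2] [H3 H4]; unfold cint, Cplus; simpl.
f_equal; apply @RInt_plus; auto.
Qed.

Lemma cint_scal c f a b : ex_cint f a b -> cint (fun t => c * f t) a b = c * cint f a b.
Proof.
intros [H1 H2]; unfold cint, Cmult; simpl. f_equal.
- rewrite (@RInt_minus R_CompleteNormedModule (fun t => (fst c * fst (f t))%R) (fun t => (snd c * snd (f t))%R)).
  + rewrite (@RInt_scal R_CompleteNormedModule (fun t => fst (f t))), (@RInt_scal R_CompleteNormedModule (fun t => snd (f t))); auto.
  + apply (@ex_RInt_scal R_CompleteNormedModule (fun t => fst (f t))); auto.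
  + apply (@ex_RInt_scal R_CompleteNormedModule (fun t => snd (f t))); auto.
- rewrite (@RInt_plus R_CompleteNormedModule (fun t => (fst c * snd (f t))%R) (fun t => (snd c * fst (f t))%R)).
  + rewrite (@RInt_scal R_CompleteNormedModule (fun t => fst (f t))), (@RInt_scal R_CompleteNormedModule (fun t => snd (f t))); auto.
  + apply (@ex_RInt_scal R_CompleteNormedModule (fun t => snd (f t))); auto.
  + apply (@ex_RInt_scal R_CompleteNormedModule (fun t => fst (f t))); auto.
Qed.

Lemma cint_Chasles f a b c : ex_cint f a b -> ex_cint f b c -> cint f a b + cint f b c = cint f a c.
Proof. intros [H1 H2] [H3 H4]; unfold cint, Cplus; simpl; f_equal; apply @RInt_Chasles; auto. Qed.

Lemma cint_const c a b : cint (fun _ => c) a b = RtoC (b - a) * c.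
Proof. unfold cint; rewrite !RInt_const. destruct c; unfold RtoC, Cmult, scal; simpl; unfold mult; simpl; f_equal; ring. Qed.

Lemma cint_shift f a b v : ex_cint f (a + v) (b + v) -> cint (fun t => f (t + v)%R) a b = cint f (a + v) (b + v).
Proof.
intros [H1 H2]; unfold cint; f_equal.
- pose proof (RInt_comp_lin (fun t => fst (f t)) 1 v a b) as X. rewrite !Rmult_1_l in X.
  rewrite <- X; auto. apply RInt_ext; intros t _. unfold scal; simpl; unfold mult; simpl. rewrite !Rmult_1_l; auto.
- pose proof (RInt_comp_lin (fun t => snd (f t)) 1 v a b) as X. rewrite !Rmult_1_l in X.
  rewrite <- X; auto. apply RInt_ext; intros t _. unfold scal; simpl; unfold mult; simpl. rewrite !Rmult_1_l; auto.
Qed.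

(** The factor 2 comes from estimating real and imaginary parts separately. The constants [4 * PI]
    in the bounds on circles are this 2 times the length [2 * PI]. *)
Lemma cint_bound f a b M : (a <= b)%R -> ex_cint f a b -> (forall t, (a <= t <= b)%R -> (Cmod (f t) <= M)%R) ->
  (Cmod (cint f a b) <= 2 * M * (b - a))%R.
Proof.
intros hab [H1 H2] H. eapply Rle_trans; [apply Cmod_le_sum|]. simpl.
assert (forall g : R -> R, ex_RInt g a b -> (forall t, (a <= t <= b)%R -> (Rabs (g t) <= M)%R) -> (Rabs (RInt g a b) <= (b - a) * M)%R) as X.
{ intros g hg Hg. apply abs_RInt_le_const; auto. }
pose proof (X _ H1 (fun t ht => Rle_trans _ _ _ (Rabs_fst_le _) (H t ht))).
pose proof (X _ H2 (fun t ht => Rle_trans _ _ _ (Rabs_snd_le _) (H t ht))). lra.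
Qed.

Lemma rderiv_iff f t l : rderiv f t l <-> (is_derive (fun s => fst (f s)) t (fst l) /\ is_derive (fun s => snd (f s)) t (snd l)).
Proof.
split.
- intros [H _].
  assert (G : forall (g : R -> R) m, (forall s, Rabs (g s - g t - m * (s - t)) <= Cmod (f s - f t - l * RtoC (s - t)))%R -> is_derive g t m).
  { intros g m Hg. apply is_derive_Reals. intros e he. destruct (H (e/2)%R) as [d [hd Hd]]; [lra|].
    exists (mkposreal d hd). intros h hn hh; simpl in hh.
    specialize (Hd (t + h)%R); specialize (Hg (t + h)%R). replace (t + h - t)%R with h in * by ring.
    specialize (Hd hh). replace ((g (t + h) - g t) / h - m)%R with ((g (t + h) - g t - m * h) / h)%R by (field; auto).
    unfold Rdiv. rewrite Rabs_mult, Rabs_inv. assert (hp : (0 < Rabs h)%R) by (apply Rabs_pos_lt; auto).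
    apply Rle_lt_trans with (e / 2)%R; [|lra]. apply (Rmult_le_reg_r (Rabs h)); auto. rewrite Rmult_assoc, Rinv_l; lra. }
  split; apply G; intros s.
  + replace (fst (f s) - fst (f t) - fst l * (s - t))%R with (fst (f s - f t - l * RtoC (s - t))); [apply Rabs_fst_le|].
    destruct l, (f s), (f t); unfold RtoC, Cmult, Cminus, Cplus, Copp; simpl; ring.
  + replace (snd (f s) - snd (f t) - snd l * (s - t))%R with (snd (f s - f t - l * RtoC (s - t))); [apply Rabs_snd_le|].
    destruct l, (f s), (f t); unfold RtoC, Cmult, Cminus, Cplus, Copp; simpl; ring.
- intros [H1 H2]. apply is_derive_Reals in H1, H2.
  assert (P : forall q : R, (0 <= Rabs (q - t))%R) by (intros; apply Rabs_pos).
  pose proof (expands_real (fun s => Rabs (s - t)) P _ _ _ (fun s => s) H1 (fun q => Rle_refl _)) as K1.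
  pose proof (expands_real (fun s => Rabs (s - t)) P _ _ _ (fun s => s) H2 (fun q => Rle_refl _)) as K2.
  pose proof (expands_plus _ _ _ _ _ _ _ K1 (expands_mult _ P _ _ _ _ _ _ (expands_const _ P Ci) K2)) as H.
  assert (E : forall s, f s = RtoC (fst (f s)) + Ci * RtoC (snd (f s))).
  { intros s; destruct (f s); unfold RtoC, Ci, Cmult, Cplus; simpl; f_equal; ring. }
  unfold rderiv. rewrite (E t). eapply expands_ext; [| |exact H].
  + intros q; simpl; rewrite <- E; auto.
  + intros q; destruct l; unfold RtoC, Ci, Cmult, Cplus; simpl; f_equal; ring.
Qed.

Lemma rderiv_zero_const f a b : (a <= b)%R -> (forall t, (a <= t <= b)%R -> rderiv f t 0) -> f a = f b.
Proof.
intros hab H. destruct (Req_dec a b) as [->|hn]; auto.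
apply injective_projections.
- apply (@eq_is_derive R_NormedModule (fun s => fst (f s))); [|lra].
  intros t ht; apply (proj1 (proj1 (rderiv_iff _ _ _) (H t ht))).
- apply (@eq_is_derive R_NormedModule (fun s => snd (f s))); [|lra].
  intros t ht; apply (proj2 (proj1 (rderiv_iff _ _ _) (H t ht))).
Qed.

(** The open ray leaves room on the left: with [lo = -1] and [a = 0], the starting time 0 of the
    trajectories is interior and all derivatives there are two-sided. *)
Lemma rderiv_CInt f (lo a t : R) : (lo < a)%R -> (lo < t)%R -> (forall s, (lo < s)%R -> ccont f s) ->
  rderiv (fun s => cint f a s) t (f t).
Proof.
intros ha ht Hf. apply rderiv_iff; simpl.
assert (G : forall g : R -> R, (forall s, (lo < s)%R -> continuous g s) -> is_derive (fun s => RInt g a s) t (g t)).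
{ intros g Hg. apply (is_derive_RInt _ _ a); auto.
  exists (mkposreal (t - lo) ltac:(lra)). intros y hy.
  apply @RInt_correct, @ex_RInt_continuous. intros z hz. apply Hg.
  unfold ball in hy; simpl in hy; unfold AbsRing_ball, abs, minus, plus, opp in hy; simpl in hy.
  apply Rabs_def2 in hy. destruct hz as [hz _]. unfold Rmin in hz; destruct (Rle_dec a y); lra. }
split; apply G; intros s hs; apply (Hf s hs).
Qed.

Lemma rderiv_CD (F : C -> C) f t l m : cderiv F (f t) l -> rderiv f t m -> rderiv (fun s => F (f s)) t (l * m).
Proof.
intros HF Hf. eapply expands_ext; [| |apply (expands_cderiv _ (fun _ => Rabs_pos _) _ _ _ _ _ HF Hf)]; auto.
intros; simpl; ring.
Qed.
Lemma rderiv_mult f g t l m : rderiv f t l -> rderiv g t m -> rderiv (fun w => f w * g w) t (l * g t + f t * m).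
Proof.
intros Hf Hg. eapply expands_ext; [| |apply (expands_mult _ (fun _ => Rabs_pos _) _ _ _ _ _ _ Hf Hg)]; auto.
intros; simpl; ring.
Qed.
Lemma rderiv_plus f g t l m : rderiv f t l -> rderiv g t m -> rderiv (fun w => f w + g w) t (l + m).
Proof.
intros Hf Hg. eapply expands_ext; [| |apply (expands_plus _ _ _ _ _ _ _ Hf Hg)]; auto.
intros; simpl; ring.
Qed.
Lemma rderiv_const c t : rderiv (fun _ => c) t 0.
Proof.
eapply expands_ext; [| |apply expands_const; intros; apply Rabs_pos]; auto. intros q; simpl; ring.
Qed.
Lemma rderiv_id t : rderiv RtoC t 1.
Proof. apply rderiv_iff; simpl; split; [apply @is_derive_id|apply @is_derive_const]. Qed.
Lemma rderiv_eq f t l l' : l = l' -> rderiv f t l -> rderiv f t l'.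
Proof. intros ->; auto. Qed.

(** * Goursat's theorem *)

(** The supremum of the left ends lies in all the intervals. Besides Goursat's subdivision, this is
    the form of completeness behind [geometric_limit_R]. *)
Lemma nested_limit (u : nat -> R) (h : R) :
  (forall n, u n <= u (S n) /\ u (S n) + h / 2 ^ S n <= u n + h / 2 ^ n)%R -> (0 <= h)%R ->
  exists x, forall n, (u n <= x <= u n + h / 2 ^ n)%R.
Proof.
intros H hh.
assert (hp : forall n, (0 <= h / 2 ^ n)%R).
{ intros n. apply Rmult_le_pos; auto. apply Rlt_le, Rinv_0_lt_compat, pow_lt; lra. }
assert (mono : forall n k, (u n <= u (n + k)%nat /\ u (n + k)%nat + h / 2 ^ (n + k) <= u n + h / 2 ^ n)%R).
{ intros n k; induction k as [|k IH].
  - rewrite Nat.add_0_r; lra.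
  - rewrite Nat.add_succ_r. destruct (H (n + k)%nat); lra. }
assert (cmp : forall n m, (u n <= u m + h / 2 ^ m)%R).
{ intros n m. destruct (Nat.le_gt_cases n m) as [hle|hge].
  - replace m with (n + (m - n))%nat by lia. destruct (mono n (m - n)%nat). specialize (hp (n + (m - n))%nat). lra.
  - replace n with (m + (n - m))%nat by lia. destruct (mono m (n - m)%nat). specialize (hp (m + (n - m))%nat). lra. }
destruct (completeness (fun r => exists n, r = u n)) as [x [hx1 hx2]].
- exists (u 0%nat + h / 2 ^ 0)%R. intros r [n ->]; apply cmp.
- exists (u 0%nat), 0%nat; auto.
- exists x. intros n; split.
  + apply hx1; exists n; auto.
  + apply hx2. intros r [m ->]; apply cmp.
Qed.

Lemma half_pow (h : R) n : (h / 2 ^ n = h / 2 ^ S n + h / 2 ^ S n)%R.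
Proof. simpl. field. apply pow_nonzero; lra. Qed.

(** Subdivision as an induction principle: were [P] false on the whole rectangle, it would be false
    on one of the quarters, and so on along nested rectangles that shrink to a point, where the
    local hypothesis contradicts it. *)
Lemma bisection2 (h k : R) (P : R -> R -> nat -> Prop) (a0 c0 : R) : (0 <= h)%R -> (0 <= k)%R ->
  (forall a c n, P a c (S n) -> P (a + h / 2 ^ S n)%R c (S n) -> P a (c + k / 2 ^ S n)%R (S n) ->
     P (a + h / 2 ^ S n)%R (c + k / 2 ^ S n)%R (S n) -> P a c n) ->
  (forall x y, (a0 <= x <= a0 + h)%R -> (c0 <= y <= c0 + k)%R -> exists N, forall n a c, (N <= n)%nat ->
     (a <= x <= a + h / 2 ^ n)%R -> (c <= y <= c + k / 2 ^ n)%R -> P a c n) ->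
  P a0 c0 0%nat.
Proof.
intros hh hk Hs Hl. apply NNPP; intros H0.
(* The failure of [P] is kept inside the sigma type, so that a bad quarter can be chosen at each
   stage and the corners defined by recursion. *)
assert (step : forall n (p : {p : R * R | ~ P (fst p) (snd p) n}),
  {q : {q : R * R | ~ P (fst q) (snd q) (S n)} |
    (fst (proj1_sig q) = fst (proj1_sig p) \/ fst (proj1_sig q) = fst (proj1_sig p) + h / 2 ^ S n)%R /\
    (snd (proj1_sig q) = snd (proj1_sig p) \/ snd (proj1_sig q) = snd (proj1_sig p) + k / 2 ^ S n)%R}).
{ intros n [[a c] hp]; simpl in hp. apply constructive_indefinite_description.
  apply NNPP; intros hn. apply hp, Hs; apply NNPP; intros hq; apply hn.
  - exists (exist _ (a, c) hq); simpl; auto.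
  - exists (exist _ ((a + h / 2 ^ S n)%R, c) hq); simpl; auto.
  - exists (exist _ (a, (c + k / 2 ^ S n)%R) hq); simpl; auto.
  - exists (exist _ ((a + h / 2 ^ S n)%R, (c + k / 2 ^ S n)%R) hq); simpl; auto. }
pose (s := fix s n : {p : R * R | ~ P (fst p) (snd p) n} :=
  match n with O => exist _ (a0, c0) H0 | S m => proj1_sig (step m (s m)) end).
assert (hp : forall h0, (0 <= h0)%R -> forall n, (0 <= h0 / 2 ^ n)%R).
{ intros h0 hh0 n. apply Rmult_le_pos; auto. apply Rlt_le, Rinv_0_lt_compat, pow_lt; lra. }
destruct (nested_limit (fun n => fst (proj1_sig (s n))) h) as [x hx]; auto.
{ intros n. change (s (S n)) with (proj1_sig (step n (s n))). destruct (step n (s n)) as [q [h1 h1z]]; cbn [proj1_sig].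
  pose proof (half_pow h n). pose proof (hp h hh (S n)). destruct h1 as [->| ->]; lra. }
destruct (nested_limit (fun n => snd (proj1_sig (s n))) k) as [y hy]; auto.
{ intros n. change (s (S n)) with (proj1_sig (step n (s n))). destruct (step n (s n)) as [q [h1z h1]]; cbn [proj1_sig].
  pose proof (half_pow k n). pose proof (hp k hk (S n)). destruct h1 as [->| ->]; lra. }
destruct (Hl x y) as [N HN].
- specialize (hx 0%nat); simpl in hx; lra.
- specialize (hy 0%nat); simpl in hy; lra.
- apply (proj2_sig (s N)). apply HN; auto.
Qed.

(** The contour integral of [H dz] along the boundary, counterclockwise: [dz] is [ds] on horizontal
    sides and [i dt] on vertical ones. *)
Definition rect_int (H : C -> C) (a b c d : R) : C :=
  cint (fun s => H (s, c)) a b - cint (fun s => H (s, d)) a b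
  + Ci * (cint (fun t => H (b, t)) c d - cint (fun t => H (a, t)) c d).

Definition cderivable_rect (H : C -> C) (a b c d : R) : Prop :=
  forall x y, (a <= x <= b)%R -> (c <= y <= d)%R -> exists l, cderiv H (x, y) l.

Lemma ccont_hor F (x y : R) l : cderiv F (x, y) l -> ccont (fun s => F (s, y)) x.
Proof.
intros H. apply (ccont_comp F (fun s => (s, y))); [apply (cderiv_cont _ _ _ H)|].
split; simpl; [apply continuous_id|apply continuous_const].
Qed.
Lemma ccont_ver F (x y : R) l : cderiv F (x, y) l -> ccont (fun s => F (x, s)) y.
Proof.
intros H. apply (ccont_comp F (fun s => (x, s))); [apply (cderiv_cont _ _ _ H)|].
split; simpl; [apply continuous_const|apply continuous_id].
Qed.

Lemma ex_hor F a b c d y : (a <= b)%R -> cderivable_rect F a b c d -> (c <= y <= d)%R ->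
  forall a' b', (a <= a' <= b)%R -> (a <= b' <= b)%R -> ex_cint (fun s => F (s, y)) a' b'.
Proof.
intros hab H hy a' b' ha hb. apply ex_cint_cont. intros t ht.
assert (h : (a <= t <= b)%R) by (revert ht; unfold Rmin, Rmax; destruct (Rle_dec a' b'); lra).
destruct (H t y h hy) as [l Hl]; apply (ccont_hor _ _ _ _ Hl).
Qed.
Lemma ex_ver F a b c d x : (c <= d)%R -> cderivable_rect F a b c d -> (a <= x <= b)%R ->
  forall a' b', (c <= a' <= d)%R -> (c <= b' <= d)%R -> ex_cint (fun s => F (x, s)) a' b'.
Proof.
intros hab H hy a' b' ha hb. apply ex_cint_cont. intros t ht.
assert (h : (c <= t <= d)%R) by (revert ht; unfold Rmin, Rmax; destruct (Rle_dec a' b'); lra).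
destruct (H x t hy h) as [l Hl]; apply (ccont_ver _ _ _ _ Hl).
Qed.

Lemma rect_int_split F a b c d m n : (a <= m <= b)%R -> (c <= n <= d)%R -> cderivable_rect F a b c d ->
  rect_int F a b c d = rect_int F a m c n + rect_int F m b c n + rect_int F a m n d + rect_int F m b n d.
Proof.
intros hm hn H. unfold rect_int.
assert (Hh : forall y, (c <= y <= d)%R -> cint (fun s => F (s, y)) a b = cint (fun s => F (s, y)) a m + cint (fun s => F (s, y)) m b).
{ intros y hy; symmetry; apply cint_Chasles; apply (ex_hor F a b c d); auto; lra. }
assert (Hv : forall x, (a <= x <= b)%R -> cint (fun s => F (x, s)) c d = cint (fun s => F (x, s)) c n + cint (fun s => F (x, s)) n d).
{ intros y hy; symmetry; apply cint_Chasles; apply (ex_ver F a b c d); auto; lra. }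
rewrite !Hh, !Hv by lra. ring.
Qed.

Lemma RInt_id a b : RInt (fun t => t) a b = ((b * b - a * a) / 2)%R.
Proof.
apply is_RInt_unique.
replace ((b * b - a * a) / 2)%R with (minus (b * b / 2) (a * a / 2))%R by (unfold minus, plus, opp; simpl; field).
apply (is_RInt_derive (fun t => t * t / 2)%R (fun t => t)).
- intros x _. auto_derive; auto; field.
- intros x _. apply continuous_id.
Qed.

Lemma rect_int_affine A l a b c d : rect_int (fun w => A + l * w) a b c d = 0.
Proof.
unfold rect_int.
assert (X : forall f a b, (forall t, ccont f t) -> cint (fun t => A + l * f t) a b = RtoC (b - a) * A + l * cint f a b).
{ intros f a' b' Hf. rewrite cint_plus, cint_scal, cint_const; auto; apply ex_cint_cont; auto; intros.
  - apply ccont_const.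
  - apply ccont_mult; auto; apply ccont_const. }
assert (K : forall y t, ccont (fun s : R => (s, y)) t) by (intros; split; simpl; [apply continuous_id|apply continuous_const]).
assert (K' : forall x t, ccont (fun s : R => (x, s)) t) by (intros; split; simpl; [apply continuous_const|apply continuous_id]).
rewrite (X (fun s => (s, c))), (X (fun s => (s, d))), (X (fun s => (b, s))), (X (fun s => (a, s))) by auto.
unfold cint; simpl. rewrite !RInt_const, !RInt_id.
destruct A, l; unfold RtoC, Ci, Cmult, Cplus, Cminus, Copp, scal, mult; simpl; unfold mult; simpl; f_equal; field.
Qed.

Lemma rect_int_le F a b c d M : (a <= b)%R -> (c <= d)%R -> cderivable_rect F a b c d ->
  (forall x y, (a <= x <= b)%R -> (c <= y <= d)%R -> (Cmod (F (x, y)) <= M)%R) ->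
  (Cmod (rect_int F a b c d) <= 4 * M * ((b - a) + (d - c)))%R.
Proof.
intros hab hcd H HM. unfold rect_int.
eapply Rle_trans; [apply Cmod_triangle|]. rewrite Cmod_mult.
replace (Cmod Ci) with 1%R by (unfold Cmod; simpl; replace (0*(0*1)+1*(1*1))%R with 1%R by ring; rewrite sqrt_1; auto).
pose proof (Cmod_sub_le (cint (fun s => F (s, c)) a b) (cint (fun s => F (s, d)) a b)).
pose proof (Cmod_sub_le (cint (fun s => F (b, s)) c d) (cint (fun s => F (a, s)) c d)).
assert (forall y, (c <= y <= d)%R -> (Cmod (cint (fun s => F (s, y)) a b) <= 2 * M * (b - a))%R).
{ intros y hy; apply cint_bound; auto. apply (ex_hor F a b c d); auto; lra. }
assert (forall x, (a <= x <= b)%R -> (Cmod (cint (fun s => F (x, s)) c d) <= 2 * M * (d - c))%R).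
{ intros y hy; apply cint_bound; auto. apply (ex_ver F a b c d); auto; lra. }
pose proof (H2 c ltac:(lra)). pose proof (H2 d ltac:(lra)).
pose proof (H3 a ltac:(lra)). pose proof (H3 b ltac:(lra)). lra.
Qed.

Lemma rect_int_plus F G a b c d : (a <= b)%R -> (c <= d)%R -> cderivable_rect F a b c d -> cderivable_rect G a b c d ->
  rect_int (fun w => F w + G w) a b c d = rect_int F a b c d + rect_int G a b c d.
Proof.
intros hab hcd HF HG; unfold rect_int.
assert (hF := fun y hy => ex_hor F a b c d y hab HF hy a b ltac:(lra) ltac:(lra)).
assert (hG := fun y hy => ex_hor G a b c d y hab HG hy a b ltac:(lra) ltac:(lra)).
assert (vF := fun x hx => ex_ver F a b c d x hcd HF hx c d ltac:(lra) ltac:(lra)).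
assert (vG := fun x hx => ex_ver G a b c d x hcd HG hx c d ltac:(lra) ltac:(lra)).
rewrite (cint_plus _ _ _ _ (hF c ltac:(lra)) (hG c ltac:(lra))), (cint_plus _ _ _ _ (hF d ltac:(lra)) (hG d ltac:(lra))),
  (cint_plus _ _ _ _ (vF a ltac:(lra)) (vG a ltac:(lra))), (cint_plus _ _ _ _ (vF b ltac:(lra)) (vG b ltac:(lra))).
ring.
Qed.

Lemma pow2_ge n : (INR n <= 2 ^ n)%R.
Proof.
induction n; [simpl; lra|]. rewrite S_INR; simpl. assert (1 <= 2 ^ n)%R by (apply pow_R1_Rle; lra). lra.
Qed.

(** A bound by [e] times the area passes from quarters to the whole. On a small rectangle [F] is
    affine up to [o] of its diameter, affine functions integrate to 0, and perimeter times error is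
    then a small multiple of the area, because all the rectangles have the same shape. *)
Theorem goursat F a b c d : (a < b)%R -> (c < d)%R -> cderivable_rect F a b c d -> rect_int F a b c d = 0.
Proof.
intros hab hcd H. apply Cmod_0_eq. intros e0 he0.
set (h := (b - a)%R). set (k := (d - c)%R).
assert (hh : (0 < h)%R) by (unfold h; lra). assert (hk : (0 < k)%R) by (unfold k; lra).
set (e := (e0 / (h * k))%R). assert (he : (0 < e)%R).
{ apply Rdiv_lt_0_compat; auto. apply Rmult_lt_0_compat; auto. }
pose (P := fun a' c' n => (a <= a')%R -> (a' + h / 2 ^ n <= b)%R -> (c <= c')%R -> (c' + k / 2 ^ n <= d)%R ->
  (Cmod (rect_int F a' (a' + h / 2 ^ n)%R c' (c' + k / 2 ^ n)%R) <= e * (h / 2 ^ n * (k / 2 ^ n)))%R).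
assert (hp : forall h0, (0 < h0)%R -> forall n, (0 < h0 / 2 ^ n)%R).
{ intros h0 hh0 n. apply Rdiv_lt_0_compat; auto. apply pow_lt; lra. }
assert (G : P a c 0%nat).
{ apply (bisection2 h k P); try lra.
  - intros a' c' n P1 P2 P3 P4 i1 i2 i3 i4.
    pose proof (half_pow h n) as E1. pose proof (half_pow k n) as E2.
    pose proof (hp h hh (S n)). pose proof (hp k hk (S n)).
    unfold P in P1, P2, P3, P4. rewrite E1, E2 in *.
    set (h' := (h / 2 ^ S n)%R) in *. set (k' := (k / 2 ^ S n)%R) in *.
    rewrite (Rplus_assoc a' h' h') in P2, P4; rewrite (Rplus_assoc c' k' k') in P3, P4.
    rewrite (rect_int_split F _ _ _ _ (a' + h') (c' + k')); try lra.
    2:{ intros x y hx hy; apply H; lra. }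
    specialize (P1 ltac:(lra) ltac:(lra) ltac:(lra) ltac:(lra)).
    specialize (P2 ltac:(lra) ltac:(lra) ltac:(lra) ltac:(lra)).
    specialize (P3 ltac:(lra) ltac:(lra) ltac:(lra) ltac:(lra)).
    specialize (P4 ltac:(lra) ltac:(lra) ltac:(lra) ltac:(lra)).
    eapply Rle_trans; [apply Cmod_triangle|].
    eapply Rle_trans; [apply Rplus_le_compat_r, Cmod_triangle|].
    eapply Rle_trans; [apply Rplus_le_compat_r, Rplus_le_compat_r, Cmod_triangle|]. lra.
  - intros x y hx hy. destruct (H x y) as [l Hl]; [unfold h in *; lra|unfold k in *; lra|].
    (* Chosen so that the bound [4 * e1 * (h' + k')^2] of [rect_int_le] is exactly [e * h' * k'];
       the ratio does not depend on [n]. *)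
    set (e1 := (e * (h * k) / (4 * ((h + k) * (h + k))))%R).
    assert (he1 : (0 < e1)%R).
    { apply Rdiv_lt_0_compat.
      - apply Rmult_lt_0_compat; auto. apply Rmult_lt_0_compat; auto.
      - apply Rmult_lt_0_compat; [lra|]. apply Rmult_lt_0_compat; lra. }
    destruct (proj1 Hl e1 he1) as [dl [hdl Hdl]].
    destruct (archimed_cor1 (dl / (h + k))%R) as [N [HN HN0]]; [apply Rdiv_lt_0_compat; lra|].
    exists N. intros n a' c' hn ha hc i1 i2 i3 i4.
    pose proof (hp h hh n). pose proof (hp k hk n).
    set (h' := (h / 2 ^ n)%R) in *. set (k' := (k / 2 ^ n)%R) in *.
    assert (small : (h' + k' < dl)%R).
    { assert (0 < INR N)%R by (apply lt_0_INR; auto).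
      assert (INR N <= 2 ^ n)%R by (eapply Rle_trans; [apply le_INR, hn|apply pow2_ge]).
      unfold h', k'. replace (h / 2 ^ n + k / 2 ^ n)%R with ((h + k) * / 2 ^ n)%R by (unfold Rdiv; ring).
      apply Rle_lt_trans with ((h + k) * / INR N)%R.
      - apply Rmult_le_compat_l; [lra|]. apply Rinv_le_contravar; auto.
      - apply (Rmult_lt_compat_l (h + k)) in HN; [|lra]. replace ((h + k) * (dl / (h + k)))%R with dl in HN by (field; lra). auto. }
    pose (A := F (x, y) - l * (x, y)).
    (* [F] minus its tangent affine map at [(x, y)]: same contour integral, but of size
       [e1 * (h' + k')]. *)
    pose (Rm := fun w : C => F w + (- A + (- l) * w)).
    assert (Caff : forall A l, cderivable_rect (fun w => A + l * w) a' (a' + h') c' (c' + k')).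
    { intros A0 l0 u v _ _. eexists. apply cderiv_plus; [apply cderiv_const|apply cderiv_mult; [apply cderiv_const|apply cderiv_id]]. }
    assert (CF : cderivable_rect F a' (a' + h') c' (c' + k')) by (intros u v hu hv; apply H; lra).
    assert (CR : cderivable_rect Rm a' (a' + h') c' (c' + k')).
    { intros u v hu hv. destruct (CF u v hu hv) as [l1 Hl1]. destruct (Caff (- A) (- l) u v hu hv) as [l2 Hl2].
      eexists. apply (cderiv_plus _ _ _ _ _ Hl1 Hl2). }
    replace (rect_int F a' (a' + h') c' (c' + k')) with (rect_int Rm a' (a' + h') c' (c' + k')).
    2:{ unfold Rm. rewrite rect_int_plus, rect_int_affine; auto; try lra. ring. }
    assert (B : forall u v, (a' <= u <= a' + h')%R -> (c' <= v <= c' + k')%R -> (Cmod (Rm (u, v)) <= e1 * (h' + k'))%R).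
    { intros u v hu hv.
      assert (dd : (Cmod ((u, v) - (x, y)) <= h' + k')%R).
      { eapply Rle_trans; [apply Cmod_le_sum|]. simpl. apply Rplus_le_compat; apply Rabs_le; lra. }
      specialize (Hdl (u, v)). cbv beta in Hdl.
      unfold Rm, A. replace (F (u, v) + (- (F (x, y) - l * (x, y)) + - l * (u, v))) with (F (u, v) - F (x, y) - l * ((u, v) - (x, y))) by ring.
      eapply Rle_trans; [apply Hdl; lra|]. apply Rmult_le_compat_l; lra. }
    eapply Rle_trans; [apply (rect_int_le _ _ _ _ _ (e1 * (h' + k'))); auto; lra|].
    right. unfold e1, h', k'. field. repeat split; try lra. apply pow_nonzero; lra. }
unfold P in G. simpl in G. unfold h, k in G. rewrite !Rdiv_1_r in G.
replace (a + (b - a))%R with b in G by ring. replace (c + (d - c))%R with d in G by ring.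
eapply Rle_trans; [apply G; lra|]. right. unfold e, h, k. field. lra.
Qed.

(** * Laurent coefficients on circles *)

Definition cis (t : R) : C := cexp (0%R, t).

Lemma cis_plus a b : cis (a + b) = cis a * cis b.
Proof. unfold cis; rewrite <- cexp_plus; f_equal; unfold Cplus; simpl; f_equal; ring. Qed.

Lemma cis_0 : cis 0 = 1.
Proof. apply cexp_0. Qed.

Lemma cis_2PI : cis (2 * PI) = 1.
Proof. unfold cis, cexp; simpl. rewrite exp_0, cos_2PI, sin_2PI, !Rmult_1_l; auto. Qed.

Lemma cis_PI : cis PI = - 1.
Proof. unfold cis, cexp; simpl. rewrite exp_0, cos_PI, sin_PI, !Rmult_1_l. unfold RtoC, Copp; simpl; f_equal; ring. Qed.

Lemma Cmod_cis t : Cmod (cis t) = 1%R.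
Proof. unfold cis; rewrite Cmod_cexp; apply exp_0. Qed.

Lemma cis_neq0 t : cis t <> 0.
Proof. apply cexp_neq0. Qed.

Lemma cis_opp t : cis (- t) = / cis t.
Proof. unfold cis; rewrite <- cexp_inv; f_equal; unfold Copp; simpl; f_equal; ring. Qed.

Lemma cis_pow t k : cis t ^ k = cis (INR k * t).
Proof.
induction k as [|k IH]; [simpl; rewrite Rmult_0_l, cis_0; auto|].
rewrite S_INR; simpl. rewrite IH, <- cis_plus. f_equal; ring.
Qed.

Lemma ccont_cis w t : ccont (fun s => cis (w * s)) t.
Proof.
apply (ccont_comp cexp (fun s => (0%R, (w * s)%R))).
- apply (cderiv_cont _ _ _ (cderiv_cexp _)).
- split; simpl; [apply continuous_const|]. apply (@continuous_mult R_UniformSpace R_AbsRing (fun _ => w) (fun s => s)); [apply continuous_const|apply continuous_id].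
Qed.

Lemma ccircle_cont z t : ccont (fun s => z * cis s) t.
Proof.
apply ccont_mult; [apply ccont_const|]. eapply ccont_ext; [|apply (ccont_cis 1 t)].
intros s; simpl; rewrite Rmult_1_l; auto.
Qed.

Lemma cint_periodic f v : (forall t, ccont f t) -> (forall t, f (t + 2 * PI)%R = f t) ->
  cint (fun t => f (t + v)%R) 0 (2 * PI) = cint f 0 (2 * PI).
Proof.
intros Hc Hp.
assert (X : forall a b, ex_cint f a b) by (intros; apply ex_cint_cont; auto).
rewrite cint_shift by auto.
rewrite <- (cint_Chasles f (0 + v) 0 (2 * PI + v)), <- (cint_Chasles f 0 (2 * PI) (2 * PI + v)) by auto.
replace (cint f (2 * PI) (2 * PI + v)) with (cint f 0 v).
- assert (Y : cint f (0 + v) 0 + cint f 0 v = 0).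
  { rewrite Rplus_0_l, cint_Chasles by auto. unfold cint. rewrite !RInt_point. reflexivity. }
  transitivity (cint f 0 (2 * PI) + (cint f (0 + v) 0 + cint f 0 v)); [ring|rewrite Y; ring].
- transitivity (cint (fun t => f (t + 2 * PI)%R) 0 v).
  + apply cint_ext; intros; auto.
  + rewrite cint_shift by auto. f_equal; ring.
Qed.

(* Up to a factor [2 pi], [circle_int (fun z => F z * z ^ k) z0] is the Laurent coefficient of index [-k] of [F]. *)
Definition circle_int (F : C -> C) (z : C) : C := cint (fun t => F (z * cis t)) 0 (2 * PI).

Definition holomorphic_annulus (F : C -> C) (r1 r2 : R) : Prop :=
  forall z, (r1 < Cmod z < r2)%R -> exists l, cderiv F z l.

Lemma ccont_circle F z : (forall w, Cmod w = Cmod z -> exists l, cderiv F w l) ->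
  forall t, ccont (fun s => F (z * cis s)) t.
Proof.
intros H t. destruct (H (z * cis t)) as [l Hl]; [rewrite Cmod_mult, Cmod_cis; ring|].
apply (ccont_comp F (fun s => z * cis s)); [apply (cderiv_cont _ _ _ Hl)|apply ccircle_cont].
Qed.

Lemma polar (z : C) : z <> 0 -> exists s t : R, z = cexp (s, t).
Proof.
intros hz. apply Cmod_gt_0 in hz.
set (a := (fst z / Cmod z)%R). set (b := (snd z / Cmod z)%R).
assert (hab : (a² + b² = 1)%R).
{ unfold a, b. assert (E : (fst z * fst z + snd z * snd z = Cmod z * Cmod z)%R).
  { unfold Cmod. rewrite sqrt_sqrt; [ring|]. pose proof (pow2_ge_0 (fst z)); pose proof (pow2_ge_0 (snd z)); lra. }
  unfold Rsqr, Rdiv. replace (_ + _)%R with ((fst z * fst z + snd z * snd z) * (/ Cmod z * / Cmod z))%R by ring.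
  rewrite E. field; lra. }
assert (ha : (-1 <= a <= 1)%R).
{ pose proof (Rle_0_sqr b). unfold Rsqr in *. split; nra. }
assert (K : exists t, cos t = a /\ sin t = b).
{ destruct (Rle_lt_dec 0 b).
  - exists (acos a). rewrite cos_acos, sin_acos by auto. split; auto.
    replace (1 - a²)%R with (b²)%R by lra. apply sqrt_Rsqr; auto.
  - exists (- acos a)%R. rewrite cos_neg, sin_neg, cos_acos, sin_acos by auto. split; auto.
    replace (1 - a²)%R with ((-b)²)%R by (rewrite <- Rsqr_neg; lra). rewrite sqrt_Rsqr; lra. }
destruct K as [t [h1 h2]]. exists (ln (Cmod z)), t.
unfold cexp; simpl. rewrite exp_ln, h1, h2 by auto. unfold a, b. destruct z as [x y]; simpl. f_equal; field; lra.
Qed.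

Lemma circle_int_rot F z a : (forall w, Cmod w = Cmod z -> exists l, cderiv F w l) -> circle_int F (z * cis a) = circle_int F z.
Proof.
intros H. unfold circle_int.
rewrite <- (cint_periodic (fun t => F (z * cis t)) a).
- apply cint_ext; intros t _. f_equal. rewrite cis_plus; ring.
- apply ccont_circle; auto.
- intros t. rewrite cis_plus, cis_2PI, Cmult_1_r; auto.
Qed.

(** In the logarithmic coordinate the annulus becomes the rectangle [[s1, s2] x [0, 2 pi]]. Goursat
    applies to [F o cexp]: the horizontal sides cancel by periodicity and the vertical sides are the
    two circle integrals. *)
Lemma circle_int_radial F r1 r2 s1 s2 : holomorphic_annulus F r1 r2 -> (s1 < s2)%R -> (r1 < exp s1)%R -> (exp s2 < r2)%R ->
  circle_int F (cexp (s1, 0%R)) = circle_int F (cexp (s2, 0%R)).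
Proof.
intros H hs h1 h2.
assert (HP := PI_RGT_0).
assert (G := goursat (fun w => F (cexp w)) s1 s2 0 (2 * PI) hs ltac:(lra)).
assert (Hr : cderivable_rect (fun w => F (cexp w)) s1 s2 0 (2 * PI)).
{ intros x y hx _. destruct (H (cexp (x, y))) as [l Hl].
  - rewrite Cmod_cexp; simpl. split.
    + destruct hx as [[h|h] _]; [apply exp_increasing in h; lra|subst; auto].
    + destruct hx as [_ [h|h]]; [apply exp_increasing in h; lra|subst; auto].
  - eexists. apply (cderiv_comp F cexp _ _ _ Hl (cderiv_cexp _)). }
specialize (G Hr). unfold rect_int in G.
assert (E : forall s t, cexp (s, t) = cexp (s, 0%R) * cis t).
{ intros; unfold cis; rewrite <- cexp_plus; f_equal; unfold Cplus; simpl; f_equal; ring. }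
replace (cint (fun s => F (cexp (s, 2 * PI)%R)) s1 s2) with (cint (fun s => F (cexp (s, 0%R))) s1 s2) in G.
2:{ apply cint_ext; intros s _. rewrite (E s (2 * PI)%R), cis_2PI, Cmult_1_r; auto. }
unfold circle_int. rewrite (cint_ext (fun t => F (cexp (s1, 0%R) * cis t)) (fun t => F (cexp (s1, t)))) by (intros; rewrite <- E; auto).
rewrite (cint_ext (fun t => F (cexp (s2, 0%R) * cis t)) (fun t => F (cexp (s2, t)))) by (intros; rewrite <- E; auto).
set (A := cint (fun t => F (cexp (s1, t))) 0 (2 * PI)) in *.
set (B := cint (fun t => F (cexp (s2, t))) 0 (2 * PI)) in *.
assert (G' : Ci * (B - A) = 0) by (rewrite <- G; ring).
assert (hi : Ci <> 0) by (intros h; apply (f_equal snd) in h; simpl in h; lra).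
assert (Z : B - A = / Ci * (Ci * (B - A))) by (field; auto).
rewrite G', Cmult_0_r in Z. replace B with (A + (B - A)) by ring. rewrite Z; ring.
Qed.

Lemma circle_int_indep F r1 r2 z w : holomorphic_annulus F r1 r2 -> (0 <= r1)%R -> (r1 < Cmod z < r2)%R -> (r1 < Cmod w < r2)%R ->
  circle_int F z = circle_int F w.
Proof.
intros H h0 hz hw.
assert (K : forall z, (r1 < Cmod z < r2)%R -> exists s, circle_int F z = circle_int F (cexp (s, 0%R)) /\ (r1 < exp s < r2)%R).
{ intros u hu. destruct (polar u) as [s [t E]]; [apply Cmod_gt_0; lra|]. exists s. subst u.
  rewrite Cmod_cexp in hu; simpl in hu. split; auto.
  replace (cexp (s, t)) with (cexp (s, 0%R) * cis t).
  - apply circle_int_rot. intros w0 hw0. apply H. rewrite hw0, Cmod_cexp; auto.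
  - unfold cis; rewrite <- cexp_plus; f_equal; unfold Cplus; simpl; f_equal; ring. }
destruct (K z hz) as [s1 [-> h1]], (K w hw) as [s2 [-> h2]].
destruct (Rtotal_order s1 s2) as [h|[->|h]]; auto.
- apply (circle_int_radial F r1 r2); auto; lra.
- symmetry; apply (circle_int_radial F r1 r2); auto; lra.
Qed.

(** Shifting [t] by [PI / k] reverses the sign of [cis (w k t)] and leaves the integral over a
    period unchanged. Averaging the two expressions shows a difference of [G] at distance [PI / k]:
    small for large [k], and zero when [G] is constant. *)
Lemma cint_cis_0 (w : R) (k : nat) (G : R -> C) : (1 <= k)%nat -> (w = 1 \/ w = -1)%R ->
  (forall t, ccont G t) -> (forall t, G (t + 2 * PI)%R = G t) ->
  2 * cint (fun t => G t * cis (w * (INR k * t))) 0 (2 * PI) =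
  cint (fun t => (G t - G (t + PI / INR k)%R) * cis (w * (INR k * t))) 0 (2 * PI).
Proof.
intros hk hw HG HP.
assert (hk' : (0 < INR k)%R) by (apply lt_0_INR; lia).
assert (Hc : forall t, ccont (fun t => cis (w * (INR k * t))) t).
{ intros t; eapply ccont_ext; [|apply (ccont_cis (w * INR k))]. intros s; simpl; f_equal; ring. }
assert (Hc2 : forall t, ccont (fun t => G t * cis (w * (INR k * t))) t) by (intros; apply ccont_mult; auto).
assert (HG2 : forall t, ccont (fun t => G (t + PI / INR k)%R) t).
{ intros t; apply ccont_eps; intros e he. destruct (ccont_mod _ _ (HG (t + PI / INR k)%R) e he) as [d [hd Hd]].
  exists d; split; auto. intros s hs; apply Rlt_le, Hd. replace (s + PI / INR k - (t + PI / INR k))%R with (s - t)%R by ring; auto. }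
assert (P1 : forall x, cis (w * (x + PI)) = - cis (w * x)).
{ intros x. rewrite Rmult_plus_distr_l, cis_plus. destruct hw; subst w.
  - rewrite (Rmult_1_l PI), cis_PI; ring.
  - replace (-1 * PI)%R with (- PI)%R by ring. rewrite cis_opp, cis_PI. field. }
assert (P2 : forall j x, cis (w * (x + INR j * (2 * PI))) = cis (w * x)).
{ intros j; induction j as [|j IH]; intros x.
  - simpl. f_equal; ring.
  - rewrite S_INR. replace (x + (INR j + 1) * (2 * PI))%R with (x + INR j * (2 * PI) + PI + PI)%R by ring.
    rewrite !P1, IH; ring. }
assert (E : cint (fun t => G t * cis (w * (INR k * t))) 0 (2 * PI) = cint (fun t => - 1 * (G (t + PI / INR k)%R * cis (w * (INR k * t)))) 0 (2 * PI)).
{ rewrite <- (cint_periodic _ (PI / INR k) Hc2).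
  - apply cint_ext; intros t _. replace (INR k * (t + PI / INR k))%R with (INR k * t + PI)%R by (field; lra).
    rewrite P1; ring.
  - intros t. rewrite HP. rewrite Rmult_plus_distr_l, P2; auto. }
replace (2 * cint (fun t => G t * cis (w * (INR k * t))) 0 (2 * PI)) with
  (cint (fun t => G t * cis (w * (INR k * t))) 0 (2 * PI) + cint (fun t => G t * cis (w * (INR k * t))) 0 (2 * PI)) by ring.
rewrite E at 2. rewrite <- cint_plus.
- apply cint_ext; intros t _. ring.
- apply ex_cint_cont; auto.
- apply ex_cint_cont. intros; apply ccont_mult; [apply ccont_const|apply ccont_mult; auto].
Qed.

Lemma ccont_unif G a b : (forall t, ccont G t) -> forall e, (0 < e)%R -> exists d, (0 < d)%R /\
  forall x y, (a <= x <= b)%R -> (a <= y <= b)%R -> (Rabs (y - x) < d)%R -> (Cmod (G x - G y) <= e)%R.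
Proof.
intros HG e he.
assert (he2 : (0 < e / 2)%R) by lra.
destruct (unifcont_normed_1d (fun s => fst (G s)) a b (fun x _ => proj1 (HG x)) (mkposreal _ he2)) as [d1 H1].
destruct (unifcont_normed_1d (fun s => snd (G s)) a b (fun x _ => proj2 (HG x)) (mkposreal _ he2)) as [d2 H2].
exists (Rmin d1 d2); split; [apply Rmin_pos; apply cond_pos|].
intros x y hx hy h. apply Rmin_Rgt in h; destruct h as [h1 h2].
specialize (H1 x y hx hy h1). specialize (H2 x y hx hy h2).
unfold ball_norm, norm, minus, plus, opp in H1, H2; simpl in H1, H2. unfold abs in H1, H2; simpl in H1, H2.
rewrite Cmod_sub_comm. eapply Rle_trans; [apply Cmod_le_sum|]. simpl. lra.
Qed.

Lemma riemann_lebesgue (w : R) (G : R -> C) : (w = 1 \/ w = -1)%R ->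
  (forall t, ccont G t) -> (forall t, G (t + 2 * PI)%R = G t) ->
  forall e, (0 < e)%R -> exists N, forall k, (N <= k)%nat ->
  (Cmod (cint (fun t => (G t * cis (w * (INR k * t)))%C) 0 (2 * PI)) <= e)%R.
Proof.
intros hw HG HP e he. assert (pp := PI_RGT_0).
(* The interval reaches [3 * PI] because [t <= 2 * PI] is shifted by at most [PI]. With the factor 2
   of [cint_bound], the modulus [e / (2 * PI)] gives [2 * e] for twice the integral. *)
destruct (ccont_unif G 0 (3 * PI) HG (e / (2 * PI))%R) as [d [hd Hd]]; [apply Rdiv_lt_0_compat; lra|].
destruct (archimed_cor1 (d / PI)%R) as [N [hN hN0]]; [apply Rdiv_lt_0_compat; lra|].
exists (S N). intros k hk.
assert (hk' : (0 < INR k)%R) by (apply lt_0_INR; lia).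
assert (hd' : (PI / INR k < d)%R).
{ apply Rle_lt_trans with (PI * / INR N)%R.
  - apply Rmult_le_compat_l; [lra|]. apply Rinv_le_contravar; [apply lt_0_INR; auto|apply le_INR; lia].
  - apply (Rmult_lt_compat_l PI) in hN; auto. replace (PI * (d / PI))%R with d in hN by (field; lra). auto. }
assert (hpk : (0 < PI / INR k <= PI)%R).
{ split; [apply Rdiv_lt_0_compat; auto|]. rewrite <- (Rdiv_1_r PI) at 2. apply Rmult_le_compat_l; [lra|].
  apply Rinv_le_contravar; [lra|]. apply (le_INR 1); lia. }
pose proof (cint_cis_0 w k G ltac:(lia) hw HG HP) as E.
set (I := cint (fun t => G t * cis (w * (INR k * t))) 0 (2 * PI)) in *.
assert (B : (Cmod (2 * I) <= 2 * e)%R).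
{ rewrite E. replace (2 * e)%R with (2 * (e / (2 * PI)) * (2 * PI - 0))%R by (field; lra).
  apply cint_bound; [lra| |].
  - apply ex_cint_cont; intros t _. apply ccont_mult.
    + apply ccont_plus; auto. eapply ccont_ext; [|apply (ccont_mult (fun _ => -1) (fun t => G (t + PI / INR k)%R)); [apply ccont_const|]].
      * intros s; simpl; ring.
      * apply ccont_eps; intros e' he'. destruct (ccont_mod _ _ (HG (t + PI / INR k)%R) e' he') as [d' [hd1 Hd']].
        exists d'; split; auto. intros s hs; apply Rlt_le, Hd'. replace (s + PI / INR k - (t + PI / INR k))%R with (s - t)%R by ring; auto.
    + eapply ccont_ext; [|apply (ccont_cis (w * INR k))]. intros s; simpl; f_equal; ring.
  - intros t ht. rewrite Cmod_mult, Cmod_cis, Rmult_1_r. apply Hd; try lra.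
    replace (t + PI / INR k - t)%R with (PI / INR k)%R by ring. rewrite Rabs_pos_eq; lra. }
rewrite Cmod_mult, Cmod_R, Rabs_pos_eq in B; lra.
Qed.

(** Multiplication by [cis t - 1] turns the Fourier coefficients [al] of [G] into differences of
    neighbours. As the nonzero coefficients of [Phi] vanish, [al] is constant on the indices [>= 1]
    and on the indices [<= 0]; both constants are limits of Fourier coefficients, hence 0, and the
    mean of [Phi] reduces to [phi0]. *)
Lemma chernoff (Phi G : R -> C) (phi0 z0 : C) : z0 <> 0 ->
  (forall t, ccont G t) -> (forall t, G (t + 2 * PI)%R = G t) ->
  (forall t, Phi t = phi0 + z0 * (cis t - 1) * G t) ->
  (forall w k, (w = 1 \/ w = -1)%R -> (1 <= k)%nat -> cint (fun t => Phi t * cis (w * (INR k * t))) 0 (2 * PI) = 0) ->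
  cint Phi 0 (2 * PI) = RtoC (2 * PI) * phi0.
Proof.
intros hz HG HP HPhi H0.
assert (Hc : forall w t, ccont (fun t => cis (w * t)) t) by (intros; apply ccont_cis).
pose (al := fun w => cint (fun t => G t * cis (w * t)) 0 (2 * PI)).
assert (Hmul : forall w, cint (fun t => Phi t * cis (w * t)) 0 (2 * PI)
   = phi0 * cint (fun t => cis (w * t)) 0 (2 * PI) + z0 * (al (w + 1)%R - al w)).
{ intros w. rewrite (cint_ext _ (fun t => phi0 * cis (w * t) + (z0 * (G t * cis ((w + 1) * t)) + (- z0) * (G t * cis (w * t))))).
  - assert (X : forall v, ex_cint (fun t => G t * cis (v * t)) 0 (2 * PI)).
    { intros; apply ex_cint_cont; intros; apply ccont_mult; auto. }
    rewrite cint_plus, cint_plus, !cint_scal; auto.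
    + unfold al; ring.
    + apply ex_cint_cont; intros; auto.
    + apply ex_cint_cont; intros; apply ccont_mult; auto using ccont_const. apply ccont_mult; auto.
    + apply ex_cint_cont; intros; apply ccont_mult; auto using ccont_const. apply ccont_mult; auto.
    + apply ex_cint_cont; intros; apply ccont_mult; auto using ccont_const.
    + apply ex_cint_cont; intros; apply ccont_plus; apply ccont_mult; auto using ccont_const; apply ccont_mult; auto.
  - intros t _. rewrite HPhi. replace ((w + 1) * t)%R with (w * t + t)%R by ring. rewrite cis_plus. ring. }
assert (Hone : forall w k, (w = 1 \/ w = -1)%R -> (1 <= k)%nat -> cint (fun t => cis (w * INR k * t)) 0 (2 * PI) = 0).
{ intros w k hw hk. pose proof (cint_cis_0 w k (fun _ => 1) hk hw (fun t => ccont_const _ _) (fun t => eq_refl)) as E.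
  rewrite (cint_ext (fun t => (1 - 1) * _) (fun _ => 0)) in E by (intros; ring).
  rewrite cint_const, Cmult_0_r in E.
  rewrite (cint_ext (fun t => 1 * _) (fun t => cis (w * INR k * t))) in E by (intros; rewrite Cmult_1_l; f_equal; ring).
  set (I := cint _ _ _) in *. replace I with (/ 2 * (2 * I)) by field. rewrite E; ring. }
assert (Hrec : forall w k, (w = 1 \/ w = -1)%R -> (1 <= k)%nat -> al (w * INR k + 1)%R = al (w * INR k)%R).
{ intros w k hw hk. pose proof (Hmul (w * INR k)%R) as E. rewrite Hone in E by auto.
  rewrite (cint_ext _ (fun t => Phi t * cis (w * (INR k * t)))) in E by (intros; do 2 f_equal; ring).
  rewrite H0 in E by auto.
  set (A := al (w * INR k + 1)%R) in *. set (B := al (w * INR k)%R) in *.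
  assert (E' : z0 * (A - B) = 0) by (transitivity (phi0 * 0 + z0 * (A - B)); [ring|symmetry; exact E]).
  replace A with (B + / z0 * (z0 * (A - B))) by (field; auto). rewrite E'; ring. }
assert (Hlim : forall w a, (w = 1 \/ w = -1)%R -> (forall k, (1 <= k)%nat -> al (w * INR k)%R = a) -> a = 0).
{ intros w a hw Ha. apply Cmod_0_eq. intros e he.
  destruct (riemann_lebesgue w G hw HG HP e he) as [N HN].
  specialize (HN (S N) ltac:(lia)). rewrite <- (Ha (S N)) by lia. unfold al.
  rewrite (cint_ext _ (fun t => G t * cis (w * (INR (S N) * t)))) by (intros; do 2 f_equal; ring). auto. }
assert (A1 : al 1%R = 0).
{ apply (Hlim 1%R); auto. intros k hk. induction hk as [|k hk IH]; [simpl; f_equal; ring|].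
  rewrite <- IH, <- (Hrec 1%R k) by auto. f_equal. rewrite S_INR; ring. }
(* For [w = -1] the recursion reads [al (1 - k) = al (- k)], so this chain starts at 0. It is not
   linked to the chain of [al 1]: the step from 0 to 1 is the mean of [Phi], the quantity to be
   found. *)
assert (A0 : al 0%R = 0).
{ apply (Hlim (-1)%R); auto. intros k hk. induction hk as [|k hk IH].
  - rewrite <- (Hrec (-1)%R 1%nat) by auto. f_equal; simpl; ring.
  - rewrite <- IH, <- (Hrec (-1)%R (S k)) by (auto; lia). f_equal. rewrite S_INR; ring. }
pose proof (Hmul 0%R) as E.
rewrite (cint_ext _ Phi) in E by (intros; rewrite Rmult_0_l, cis_0; ring).
rewrite E, (cint_ext _ (fun _ => 1)) by (intros; rewrite Rmult_0_l, cis_0; auto).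
rewrite cint_const, Rplus_0_l, A0, A1, Rminus_0_r. ring.
Qed.

(* Chernoff's argument: [g = (F - F z0) / (z - z0)] is continuous on the circle, and the hypotheses make its Fourier
   coefficients of positive (resp. nonpositive) index all equal, hence zero by Riemann-Lebesgue. *)
Lemma circle_value F (z0 : C) : z0 <> 0 -> (forall z, Cmod z = Cmod z0 -> exists l, cderiv F z l) ->
  (forall k, (1 <= k)%nat -> circle_int (fun z => F z * z ^ k) z0 = 0) ->
  (forall k, (1 <= k)%nat -> circle_int (fun z => F z * (/ z) ^ k) z0 = 0) ->
  circle_int F z0 = RtoC (2 * PI) * F z0.
Proof.
intros hz HF Hp Hn.
destruct (HF z0 eq_refl) as [l0 Hl0].
pose (g := fun z => if excluded_middle_informative (z = z0) then l0 else (F z - F z0) * / (z - z0)).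
assert (Hg : forall z, F z = F z0 + (z - z0) * g z).
{ intros z; unfold g. destruct (excluded_middle_informative (z = z0)) as [->|h]; [ring|]. field.
  intros h'; apply h. replace z with (z0 + (z - z0)) by ring. rewrite h'; ring. }
assert (Cg : forall z, Cmod z = Cmod z0 -> forall eps : R, (0 < eps)%R -> exists d : R, (0 < d)%R /\
     forall w, (Cmod (w - z) < d)%R -> (Cmod (g w - g z) <= eps)%R).
{ intros z hzz. destruct (excluded_middle_informative (z = z0)) as [E|h].
  - subst z. intros e he. destruct (proj1 Hl0 e he) as [d [hd Hd]]. exists d; split; auto. intros w hw.
    unfold g at 2. destruct (excluded_middle_informative (z0 = z0)) as [_|n]; [|congruence].
    unfold g. destruct (excluded_middle_informative (w = z0)) as [h|h].
    + replace (l0 - l0) with (RtoC 0) by ring; rewrite Cmod_0; lra.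
    + specialize (Hd w hw). assert (h' : w - z0 <> 0) by (intros h'; apply h; replace w with (z0 + (w - z0)) by ring; rewrite h'; ring).
      replace ((F w - F z0) * / (w - z0) - l0) with ((F w - F z0 - l0 * (w - z0)) * / (w - z0)) by (field; auto).
      rewrite Cmod_mult, Cmod_inv by auto. apply Cmod_gt_0 in h'.
      apply (Rmult_le_reg_r (Cmod (w - z0))); auto. rewrite Rmult_assoc, Rinv_l; lra.
  - destruct (HF z hzz) as [l Hl].
    assert (h' : z - z0 <> 0) by (intros h'; apply h; replace z with (z0 + (z - z0)) by ring; rewrite h'; ring).
    assert (D : exists m, cderiv g z m).
    { eexists. apply (cderiv_ext_loc (fun z => (F z + - F z0) * / (z + - z0))) with (d := Cmod (z - z0)).
      - apply Cmod_gt_0; auto.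
      - intros w hw. unfold g. destruct (excluded_middle_informative (w = z0)) as [->|_]; auto.
        exfalso. rewrite Cmod_sub_comm in hw; lra.
      - apply cderiv_mult; [apply cderiv_plus; [exact Hl|apply cderiv_const]|].
        apply (cderiv_comp (fun z => / z) (fun z => z + - z0)); [apply cderiv_inv; exact h'|apply cderiv_plus; [apply cderiv_id|apply cderiv_const]]. }
    destruct D as [m Hm]. apply (cderiv_cont _ _ _ Hm). }
assert (E := chernoff (fun t => F (z0 * cis t)) (fun t => g (z0 * cis t)) (F z0) z0 hz).
apply E; clear E.
- intros t. apply (ccont_comp g (fun t => z0 * cis t)); [|apply ccircle_cont].
  apply Cg. rewrite Cmod_mult, Cmod_cis; ring.
- intros t. rewrite cis_plus, cis_2PI, Cmult_1_r; auto.
- intros t. rewrite Hg. f_equal. ring.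
- intros w k hw hk.
  assert (X : forall v, ex_cint (fun t => F (z0 * cis t) * cis (v * (INR k * t))) 0 (2 * PI)).
  { intros v; apply ex_cint_cont; intros t _. apply ccont_mult; [apply ccont_circle; auto|].
    eapply ccont_ext; [|apply (ccont_cis (v * INR k))]. intros s; simpl; f_equal; ring. }
  assert (hzk : z0 ^ k <> 0) by (apply Cpow_nz; auto).
  destruct hw as [->| ->].
  + specialize (Hp k hk). unfold circle_int in Hp.
    rewrite (cint_ext _ (fun t => z0 ^ k * (F (z0 * cis t) * cis (1 * (INR k * t))))) in Hp.
    * rewrite cint_scal in Hp by auto. set (I := cint _ _ _) in *.
      replace I with (/ z0 ^ k * (z0 ^ k * I)) by (field; auto). rewrite Hp; ring.
    * intros t _. rewrite Cpow_mult_l, cis_pow, Rmult_1_l. ring.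
  + specialize (Hn k hk). unfold circle_int in Hn.
    rewrite (cint_ext _ (fun t => (/ z0) ^ k * (F (z0 * cis t) * cis (-1 * (INR k * t))))) in Hn.
    * rewrite cint_scal in Hn by auto. set (I := cint _ _ _) in *.
      rewrite Cpow_inv in Hn by auto.
      replace I with (z0 ^ k * (/ z0 ^ k * I)) by (field; auto). rewrite Hn; ring.
    * intros t _. replace (/ (z0 * cis t)) with (/ z0 * / cis t) by (field; split; auto; apply cis_neq0). rewrite Cpow_mult_l, <- cis_opp, cis_pow.
      replace (INR k * - t)%R with (-1 * (INR k * t))%R by ring. ring.
Qed.

(** * Cauchy estimates and identity theorems *)

Lemma circle_int_bound F z M : (forall w, Cmod w = Cmod z -> exists l, cderiv F w l) ->
  (forall w, Cmod w = Cmod z -> (Cmod (F w) <= M)%R) -> (Cmod (circle_int F z) <= 4 * PI * M)%R.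
Proof.
intros H HM. assert (pp := PI_RGT_0).
replace (4 * PI * M)%R with (2 * M * (2 * PI - 0))%R by ring.
apply cint_bound; [lra| |].
- apply ex_cint_cont; intros; apply ccont_circle; auto.
- intros t _; apply HM. rewrite Cmod_mult, Cmod_cis; ring.
Qed.

Lemma cint_cis_neg : cint (fun t => cis (- t)) 0 (2 * PI) = 0.
Proof.
pose proof (cint_cis_0 (-1) 1 (fun _ => 1) (le_n _) (or_intror eq_refl) (fun t => ccont_const _ _) (fun t => eq_refl)) as E.
rewrite (cint_ext (fun t => (1 - 1) * _) (fun _ => 0)) in E by (intros; ring).
rewrite cint_const, Cmult_0_r in E.
rewrite (cint_ext (fun t => 1 * _) (fun t => cis (- t))) in E by (intros; rewrite Cmult_1_l; f_equal; simpl; ring).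
set (I := cint _ _ _) in *. replace I with (/ 2 * (2 * I)) by field. rewrite E; ring.
Qed.

Lemma cderiv_translate F c z l : cderiv F (c + z) l -> cderiv (fun w => F (c + w)) z l.
Proof.
intros H. replace l with (l * (0 + 1)) by ring.
apply (cderiv_comp F (fun w => c + w)); auto. apply cderiv_plus; [apply cderiv_const|apply cderiv_id].
Qed.

Lemma Cmod_pos_real (r : R) : (0 <= r)%R -> Cmod r = r.
Proof. intros; rewrite Cmod_R, Rabs_pos_eq; auto. Qed.

(** The circle integral of [F (c + z) / z] does not depend on the radius. On small circles it tends
    to [2 pi l], since the constant term of the expansion of [F] contributes the mean of
    [cis (- t)], which is 0; on the circle of radius [rho] it is at most [4 pi M / rho]. *)
Lemma cauchy_estimate F c l R0 M rho : (0 < rho < R0)%R ->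
  (forall z, (Cmod (z - c) < R0)%R -> (exists l, cderiv F z l) /\ (Cmod (F z) <= M)%R) ->
  cderiv F c l -> (Cmod l * rho <= 2 * M)%R.
Proof.
intros hr H Hl. assert (pp := PI_RGT_0).
pose (G := fun z => F (c + z) * / z).
assert (HG : holomorphic_annulus G 0 R0).
{ intros z hz. destruct (H (c + z)) as [[m Hm] _]; [replace (c + z - c) with z by ring; lra|].
  eexists. apply cderiv_mult; [apply cderiv_translate, Hm|]. apply cderiv_inv. apply Cmod_gt_0; lra. }
assert (hM : (0 <= M)%R).
{ eapply Rle_trans; [apply Cmod_ge_0|apply (H c)]. replace (c - c) with (RtoC 0) by ring; rewrite Cmod_0; lra. }
assert (B1 : (Cmod (circle_int G rho) <= 4 * PI * (M / rho))%R).
{ apply circle_int_bound.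
  - intros w hw. apply HG. rewrite hw, Cmod_pos_real; lra.
  - intros w hw. rewrite Cmod_pos_real in hw by lra. unfold G. rewrite Cmod_mult, Cmod_inv by (apply Cmod_gt_0; lra).
    rewrite hw. apply Rmult_le_compat_r; [apply Rlt_le, Rinv_0_lt_compat; lra|]. apply H.
    replace (c + w - c) with w by ring; lra. }
assert (B2 : (Cmod (RtoC (2 * PI) * l) <= 4 * PI * (M / rho))%R).
{ apply Rle_plus_epsilon. intros e he.
  destruct (proj1 Hl (e / (4 * PI))%R) as [d [hd Hd]]; [apply Rdiv_lt_0_compat; lra|].
  set (s := Rmin (rho / 2) (d / 2)).
  assert (hs : (0 < s)%R) by (apply Rmin_pos; lra).
  assert (hs1 : (s <= rho / 2)%R) by apply Rmin_l. assert (hs2 : (s <= d / 2)%R) by apply Rmin_r.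
  assert (E : circle_int G rho = circle_int G s).
  { apply (circle_int_indep G 0 R0); auto; try lra; rewrite Cmod_pos_real; lra. }
  assert (hs0 : RtoC s <> 0) by (apply Cmod_gt_0; rewrite Cmod_pos_real; lra).
  (* The quotient of the first-order remainder, at most [e / (4 * PI)] on the circle of radius
     [s]. *)
  pose (K := fun t => (F (c + s * cis t) - F c - l * (s * cis t)) * / (s * cis t)).
  assert (CK : forall t, ccont K t).
  { intros t. apply ccont_mult.
    - unfold Cminus. apply ccont_plus; [apply ccont_plus|].
      + apply (ccont_circle (fun z => F (c + z))). intros w hw. rewrite Cmod_pos_real in hw by lra.
        destruct (H (c + w)) as [[m Hm] _]; [replace (c + w - c) with w by ring; lra|].
        exists m; apply cderiv_translate, Hm.
      + apply ccont_const.
      + eapply ccont_ext; [|apply (ccont_mult (fun _ => - l) (fun t => s * cis t)); [apply ccont_const|apply ccircle_cont]].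
        intros; simpl; ring.
    - apply (ccont_circle (fun z => / z)). intros w hw. rewrite Cmod_pos_real in hw by lra.
      eexists; apply cderiv_inv, Cmod_gt_0; lra. }
  assert (cisc : forall t, ccont (fun t => cis (- t)) t).
  { intros t; eapply ccont_ext; [|apply (ccont_cis (-1))]. intros; simpl; f_equal; ring. }
  assert (E2 : circle_int G s = cint K 0 (2 * PI) + RtoC (2 * PI) * l).
  { unfold circle_int. rewrite (cint_ext _ (fun t => K t + ((F c * / s) * cis (- t) + l))).
    - assert (X1 : ex_cint K 0 (2 * PI)) by (apply ex_cint_cont; auto).
      assert (X2 : ex_cint (fun t => cis (- t)) 0 (2 * PI)) by (apply ex_cint_cont; auto).
      assert (X3 : ex_cint (fun t => (F c * / s) * cis (- t)) 0 (2 * PI)).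
      { apply ex_cint_cont; intros; apply ccont_mult; auto using ccont_const. }
      assert (X4 : ex_cint (fun _ => l) 0 (2 * PI)) by (apply ex_cint_cont; auto using ccont_const).
      assert (X5 : ex_cint (fun t => (F c * / s) * cis (- t) + l) 0 (2 * PI)).
      { apply ex_cint_cont; intros; apply ccont_plus; auto using ccont_const. apply ccont_mult; auto using ccont_const. }
      rewrite (cint_plus _ _ _ _ X1 X5), (cint_plus _ _ _ _ X3 X4), (cint_scal _ _ _ _ X2), cint_const, cint_cis_neg, Rminus_0_r.
      ring.
    - intros t _. unfold G, K. rewrite cis_opp. field. split; auto. apply cis_neq0. }
  assert (B3 : (Cmod (cint K 0 (2 * PI)) <= e)%R).
  { replace e with (2 * (e / (4 * PI)) * (2 * PI - 0))%R by (field; lra).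
    apply cint_bound; [lra|apply ex_cint_cont; auto|].
    intros t _. unfold K. assert (hm : Cmod (s * cis t) = s) by (rewrite Cmod_mult, Cmod_cis, Cmod_pos_real; lra).
    rewrite Cmod_mult, Cmod_inv by (apply Cmod_gt_0; lra). rewrite hm.
    specialize (Hd (c + s * cis t)). replace (c + s * cis t - c) with (s * cis t) in Hd by ring. rewrite hm in Hd.
    specialize (Hd ltac:(lra)). apply (Rmult_le_reg_r s); auto. rewrite Rmult_assoc, Rinv_l; lra. }
  replace (RtoC (2 * PI) * l) with (circle_int G rho - cint K 0 (2 * PI)) by (rewrite E, E2; ring).
  pose proof (Cmod_sub_le (circle_int G rho) (cint K 0 (2 * PI))). lra. }
rewrite Cmod_mult, Cmod_pos_real in B2 by lra.
apply (Rmult_le_reg_l (2 * PI)); [lra|].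
apply (Rmult_le_compat_r rho) in B2; [|lra].
replace (4 * PI * (M / rho) * rho)%R with (4 * PI * M)%R in B2 by (field; lra). lra.
Qed.

(** All circle integrals of [F] against powers, of either sign, can be moved into the disc where [F]
    vanishes. [circle_value] then recovers the value at any point from a mean that is 0. *)
Lemma disc_identity F c R0 d : (0 < d)%R ->
  (forall z, (Cmod (z - c) < R0)%R -> exists l, cderiv F z l) ->
  (forall z, (Cmod (z - c) < d)%R -> F z = 0) ->
  forall z, (Cmod (z - c) < R0)%R -> F z = 0.
Proof.
intros hd H H0 z hz. assert (pp := PI_RGT_0).
destruct (Rlt_le_dec (Cmod (z - c)) d) as [h|h]; auto.
pose (G := fun w => F (c + w)).
assert (HG : holomorphic_annulus G 0 R0).
{ intros w hw. destruct (H (c + w)) as [m Hm]; [replace (c + w - c) with w by ring; lra|].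
  exists m; apply cderiv_translate, Hm. }
assert (Jz : forall p : C -> C, (forall w : C, w <> 0 -> exists l, cderiv p w l) -> circle_int (fun w => G w * p w) (z - c) = 0).
{ intros p Hp. rewrite (circle_int_indep _ 0 R0 (z - c) (RtoC (d / 2))); try lra.
  - unfold circle_int. rewrite (cint_ext _ (fun _ => 0)).
    + rewrite cint_const; ring.
    + intros t _. unfold G. rewrite H0; [ring|].
      replace (c + RtoC (d / 2) * cis t - c) with (RtoC (d / 2) * cis t) by ring.
      rewrite Cmod_mult, Cmod_cis, Cmod_pos_real; lra.
  - intros w hw. destruct (HG w hw) as [l Hl]. destruct (Hp w) as [m Hm]; [apply Cmod_gt_0; lra|].
    eexists; apply cderiv_mult; eauto.
  - rewrite Cmod_pos_real; lra. }
assert (hz0 : z - c <> 0) by (apply Cmod_gt_0; lra).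
assert (E := circle_value G (z - c) hz0).
assert (J0 : circle_int G (z - c) = 0).
{ rewrite <- (Jz (fun _ => 1)); [|intros; eexists; apply cderiv_const].
  unfold circle_int; apply cint_ext; intros; simpl; ring. }
rewrite J0 in E. unfold G in E at 4. replace (c + (z - c)) with z in E by ring.
assert (h2 : RtoC (2 * PI) <> 0) by (apply Cmod_gt_0; rewrite Cmod_pos_real; lra).
replace (F z) with (/ RtoC (2 * PI) * (RtoC (2 * PI) * F z)) by (field; auto).
rewrite <- E; [ring| | |].
- intros w hw. apply HG. lra.
- intros k _. apply (Jz (fun w => w ^ k)). intros; apply cderiv_pow.
- intros k _. apply (Jz (fun w => (/ w) ^ k)). intros w hw. destruct (cderiv_pow k (/ w)) as [m Hm].
  eexists. apply (cderiv_comp (fun w => w ^ k) (fun w => / w) w m _ Hm (cderiv_inv w hw)).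
Qed.

(** A chain of discs of one common radius [e] runs along the segment from [z0] to [z]. By convexity
    the whole [e]-neighborhood of the segment lies in [D]: it consists of translates of the segment
    whose ends stay near [z0] and [z]. *)
Lemma convex_identity (D : C -> Prop) F (z0 : C) (d : R) :
  (forall z, D z -> exists e, (0 < e)%R /\ forall w, (Cmod (w - z) < e)%R -> D w) ->
  (forall z w (t : R), (0 <= t <= 1)%R -> D z -> D w -> D (z + RtoC t * (w - z))) ->
  (forall z, D z -> exists l, cderiv F z l) ->
  (0 < d)%R -> D z0 -> (forall z, (Cmod (z - z0) < d)%R -> F z = 0) ->
  forall z, D z -> F z = 0.
Proof.
intros Ho Hc HF hd hz0 H0 z hz.
destruct (Ho z0 hz0) as [e0 [he0 He0]]. destruct (Ho z hz) as [e1 [he1 He1]].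
set (e := Rmin e0 e1). assert (he : (0 < e)%R) by (apply Rmin_pos; auto).
assert (Hball : forall t, (0 <= t <= 1)%R -> forall w, (Cmod (w - (z0 + RtoC t * (z - z0))) < e)%R -> D w).
{ intros t ht w hw. set (v := w - (z0 + RtoC t * (z - z0))) in *.
  replace w with ((z0 + v) + RtoC t * ((z + v) - (z0 + v))) by (unfold v; ring).
  apply Hc; auto.
  - apply He0. replace (z0 + v - z0) with v by ring. eapply Rlt_le_trans; [exact hw|apply Rmin_l].
  - apply He1. replace (z + v - z) with v by ring. eapply Rlt_le_trans; [exact hw|apply Rmin_r]. }
set (L := Cmod (z - z0)). assert (hL : (0 <= L)%R) by apply Cmod_ge_0.
destruct (archimed_cor1 (e / (2 * (L + 1)))%R) as [N [hN hN0]]; [apply Rdiv_lt_0_compat; lra|].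
assert (hNp : (0 < INR N)%R) by (apply lt_0_INR; auto).
(* Consecutive centers are less than [e / 2] apart, so the disc of radius [e / 2] about the next
   center lies in the previous disc of radius [e]. *)
assert (step : (L / INR N < e / 2)%R).
{ apply (Rmult_lt_compat_l (L + 1)) in hN; [|lra].
  replace ((L + 1) * (e / (2 * (L + 1))))%R with (e / 2)%R in hN by (field; lra).
  eapply Rle_lt_trans; [|exact hN]. unfold Rdiv. apply Rmult_le_compat_r; [apply Rlt_le, Rinv_0_lt_compat; auto|lra]. }
assert (K : forall k, (k <= N)%nat -> forall w, (Cmod (w - (z0 + RtoC (INR k / INR N) * (z - z0))) < e)%R -> F w = 0).
{ induction k as [|k IH]; intros hk.
  - apply (disc_identity F _ _ d hd).
    + intros w hw. apply HF. apply (Hball (INR 0 / INR N)%R); auto. simpl. unfold Rdiv; rewrite Rmult_0_l; lra.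
    + intros w hw. apply H0. simpl in hw. unfold Rdiv in hw; rewrite Rmult_0_l in hw.
      replace (w - z0) with (w - (z0 + 0 * (z - z0))) by ring. auto.
  - assert (ht : (0 <= INR (S k) / INR N <= 1)%R).
    { split; [apply Rmult_le_pos; [apply pos_INR|apply Rlt_le, Rinv_0_lt_compat; auto]|].
      apply (Rmult_le_reg_r (INR N)); auto. unfold Rdiv; rewrite Rmult_assoc, Rinv_l, Rmult_1_r, Rmult_1_l; [apply le_INR; auto|lra]. }
    apply (disc_identity F _ _ (e / 2)); [lra| |].
    + intros w hw. apply HF, (Hball _ ht); auto.
    + intros w hw. apply IH; [lia|].
      replace (w - (z0 + RtoC (INR k / INR N) * (z - z0))) with
        ((w - (z0 + RtoC (INR (S k) / INR N) * (z - z0))) + RtoC (/ INR N) * (z - z0)).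
      * eapply Rle_lt_trans; [apply Cmod_triangle|]. rewrite Cmod_mult, Cmod_pos_real by (apply Rlt_le, Rinv_0_lt_compat; auto).
        fold L. unfold Rdiv in step at 1. lra.
      * replace (INR (S k) / INR N)%R with (INR k / INR N + / INR N)%R by (rewrite S_INR; field; lra).
        rewrite RtoC_plus. ring. }
apply (K N (le_n N)). replace (INR N / INR N)%R with 1%R by (field; lra).
replace (z - (z0 + 1 * (z - z0))) with (RtoC 0) by ring. rewrite Cmod_0; auto.
Qed.

(** * Trajectories of the normal form *)

Lemma derive_le (f df : R -> R) (a b k : R) : (a <= b)%R ->
  (forall t, (a <= t <= b)%R -> is_derive f t (df t)) -> (forall t, (a <= t <= b)%R -> (df t <= k)%R) ->
  (f b - f a <= k * (b - a))%R.
Proof.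
intros hab Hd Hk.
destruct (MVT_gen f a b df) as [c [hc E]].
- intros x hx. apply Hd. rewrite Rmin_left, Rmax_right in hx; lra.
- intros x hx. apply continuity_pt_filterlim. apply (ex_derive_continuous (V := R_NormedModule)).
  exists (df x). apply Hd. rewrite Rmin_left, Rmax_right in hx; lra.
- rewrite E. rewrite Rmin_left, Rmax_right in hc by auto. apply Rmult_le_compat_r; [lra|auto].
Qed.

Lemma re_cint_derive (g : R -> C) t : (forall s, (-1 < s)%R -> ccont g s) -> (-1 < t)%R ->
  is_derive (fun s => fst (cint g 0 s)) t (fst (g t)).
Proof.
intros Hg ht. apply (proj1 (rderiv_iff _ _ _) (rderiv_CInt g (-1) 0 t ltac:(lra) ht Hg)).
Qed.

Lemma cint_0 (g : R -> C) : cint g 0 0 = 0.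
Proof. unfold cint; rewrite !RInt_point; reflexivity. Qed.

Lemma exp_integral_growth (g : R -> C) (w : C) : (forall s, (-1 < s)%R -> ccont g s) -> (0 < fst w)%R ->
  (forall e, (0 < e)%R -> exists T, forall t, (T <= t)%R -> (Cmod (g t - w) <= e)%R) ->
  forall M, exists T, forall t, (T <= t)%R -> (M <= Cmod (cexp (cint g 0 t)))%R.
Proof.
intros Hg hw Hl M.
destruct (Hl (fst w / 2)%R ltac:(lra)) as [T0 HT0].
set (T := Rmax T0 0). assert (h1 : (T0 <= T)%R) by apply Rmax_l. assert (h2 : (0 <= T)%R) by apply Rmax_r.
set (L := fun t => fst (cint g 0 t)).
assert (G : forall t, (T <= t)%R -> (fst w / 2 * (t - T) <= L t - L T)%R).
{ intros t ht.
  pose proof (derive_le (fun s => - L s)%R (fun s => - fst (g s))%R T t (- (fst w / 2)) ht) as X.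
  cbv beta in X. enough (- L t - - L T <= - (fst w / 2) * (t - T))%R by lra. apply X.
  - intros s hs. apply (is_derive_opp (fun s => L s)). apply re_cint_derive; auto; lra.
  - intros s hs. specialize (HT0 s ltac:(lra)). pose proof (Rabs_fst_le (g s - w)) as Y. simpl in Y.
    pose proof (Rle_abs (- (fst (g s) + - fst w))) as Y2. rewrite Rabs_Ropp in Y2. lra. }
exists (Rmax T (T + (ln (Rmax M 1) - L T) / (fst w / 2)))%R. intros t ht.
assert (ht1 : (T <= t)%R) by (eapply Rle_trans; [apply Rmax_l|exact ht]).
assert (ht2 : (T + (ln (Rmax M 1) - L T) / (fst w / 2) <= t)%R) by (eapply Rle_trans; [apply Rmax_r|exact ht]).
specialize (G t ht1).
assert (K : (ln (Rmax M 1) <= L t)%R).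
{ assert ((ln (Rmax M 1) - L T) <= fst w / 2 * (t - T))%R; [|lra].
  apply (Rmult_le_reg_r (/ (fst w / 2))); [apply Rinv_0_lt_compat; lra|].
  replace (fst w / 2 * (t - T) * / (fst w / 2))%R with (t - T)%R by (field; lra). unfold Rdiv in *; lra. }
assert (mp : (0 < Rmax M 1)%R) by (eapply Rlt_le_trans; [|apply Rmax_r]; lra).
rewrite Cmod_cexp. fold (L t). apply Rle_trans with (Rmax M 1); [apply Rmax_l|].
rewrite <- (exp_ln (Rmax M 1)) by auto. destruct K as [K|K]; [apply exp_increasing in K; lra|rewrite K; lra].
Qed.

(* Along [Z = Z0 + (1 + i m) t] one has [x = k0 / Z] and [dx / dt = kap x^2] with [kap = - (1 + i m) / k0], and
   [bc = kap x]; [vfactor (a1 + a2)] solves the equation [v' = kap (a1 + a2) x v] of [v = y1 y2]. *)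
Section Curve.
Variables (k0 Z0 : C) (m R0 : R).
Hypothesis HR0 : (0 < R0)%R.
Hypothesis HZ0 : (R0 + 1 < fst Z0)%R.

Definition direction : C := (1%R, m).
Definition Zc (t : R) : C := Z0 + direction * RtoC t.
Definition xc (t : R) : C := k0 * / Zc t.
Definition bc (t : R) : C := - direction * / Zc t.
Definition vfactor (a : C) (t : R) : C := cexp (a * cint bc 0 t).

Lemma Zc_re t : fst (Zc t) = (fst Z0 + t)%R.
Proof. unfold Zc, direction, Cplus, Cmult; simpl; ring. Qed.

Lemma Zc_gt t : (-1 < t)%R -> (R0 < fst (Zc t))%R.
Proof. rewrite Zc_re; lra. Qed.

Lemma fst_le_Cmod (z : C) : (fst z <= Cmod z)%R.
Proof. eapply Rle_trans; [apply Rle_abs|apply Rabs_fst_le]. Qed.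

Lemma Zc_neq0 t : (-1 < t)%R -> Zc t <> 0.
Proof. intros h; apply Zc_gt in h. pose proof (fst_le_Cmod (Zc t)). apply Cmod_gt_0; lra. Qed.

Lemma rderiv_Zc t : rderiv Zc t direction.
Proof.
unfold Zc. eapply rderiv_eq; [|apply rderiv_plus; [apply rderiv_const|apply rderiv_mult; [apply rderiv_const|apply rderiv_id]]]. cbv beta; ring.
Qed.

Lemma rderiv_invZ t : (-1 < t)%R -> rderiv (fun s => / Zc s) t (- direction * / (Zc t * Zc t)).
Proof.
intros h. eapply rderiv_eq; [|apply (rderiv_CD (fun z => / z)); [apply cderiv_inv, Zc_neq0, h|apply rderiv_Zc]]. cbv beta; ring.
Qed.

Lemma rderiv_xc t : (-1 < t)%R -> k0 <> 0 -> rderiv xc t (- direction * / k0 * (xc t * xc t)).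
Proof.
intros h hk. unfold xc. eapply rderiv_eq; [|apply rderiv_mult; [apply rderiv_const|apply rderiv_invZ, h]].
cbv beta; field. split; auto. apply Zc_neq0; auto.
Qed.

Lemma ccont_bc t : (-1 < t)%R -> ccont bc t.
Proof. intros h. apply ccont_mult; [apply ccont_const|]. eapply rderiv_cont, rderiv_invZ; auto. Qed.

Lemma rderiv_vfc a t : (-1 < t)%R -> rderiv (vfactor a) t (a * bc t * vfactor a t).
Proof.
intros h. unfold vfactor. eapply rderiv_eq; [|apply (rderiv_CD cexp); [apply cderiv_cexp|
  apply rderiv_mult; [apply rderiv_const|apply (rderiv_CInt bc (-1)); [lra|exact h|exact ccont_bc]]]]. cbv beta; ring.
Qed.

Lemma vfactor_0 a : vfactor a 0 = 1.
Proof. unfold vfactor. rewrite cint_0, Cmult_0_r. apply cexp_0. Qed.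

Lemma Zc_lim e : (0 < e)%R -> exists T, (0 <= T)%R /\ forall t, (T <= t)%R -> (Cmod (/ Zc t) <= e)%R.
Proof.
intros he. exists (Rmax 0 (/ e)); split; [apply Rmax_l|]. intros t ht.
assert (h0 : (0 <= t)%R) by (eapply Rle_trans; [apply Rmax_l|exact ht]).
assert (h1 : (/ e <= t)%R) by (eapply Rle_trans; [apply Rmax_r|exact ht]).
rewrite Cmod_inv by (apply Zc_neq0; lra). pose proof (fst_le_Cmod (Zc t)) as X. rewrite Zc_re in X.
rewrite <- (Rinv_inv e). apply Rinv_le_contravar; [apply Rinv_0_lt_compat; auto|lra].
Qed.

Lemma xc_lim e : (0 < e)%R -> exists T, (0 <= T)%R /\ forall t, (T <= t)%R -> (Cmod (xc t) <= e)%R.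
Proof.
intros he. assert (h := Cmod_ge_0 k0).
destruct (Zc_lim (e / (1 + Cmod k0))%R) as [T [hT HT]]; [apply Rdiv_lt_0_compat; lra|].
exists T; split; auto. intros t ht. unfold xc; rewrite Cmod_mult. specialize (HT t ht).
apply Rle_trans with ((1 + Cmod k0) * (e / (1 + Cmod k0)))%R; [|right; field; lra].
apply Rmult_le_compat; auto using Cmod_ge_0; lra.
Qed.

Lemma bc_lim e : (0 < e)%R -> exists T, (0 <= T)%R /\ forall t, (T <= t)%R -> (Cmod (bc t) <= e)%R.
Proof.
intros he. assert (h := Cmod_ge_0 direction).
destruct (Zc_lim (e / (1 + Cmod direction))%R) as [T [hT HT]]; [apply Rdiv_lt_0_compat; lra|].
exists T; split; auto. intros t ht. unfold bc; rewrite Cmod_mult, Cmod_opp. specialize (HT t ht).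
apply Rle_trans with ((1 + Cmod direction) * (e / (1 + Cmod direction)))%R; [|right; field; lra].
apply Rmult_le_compat; auto using Cmod_ge_0; lra.
Qed.

(** Comparing [Zc t] with [direction * (1 + t)] gives [Re (a bc) = - Re a / (1 + t) + O(1 / (1 +
    t)^2)]; so [vfactor] decays at least like a power of [1 / (1 + t)]. The bound is needed from
    [t > -1] on, as everything else on the curve. *)
Lemma vfactor_decay a : (0 < fst a)%R ->
  (exists B, (1 <= B)%R /\ forall t, (-1 < t)%R -> (Cmod (vfactor a t) <= B)%R) /\
  (forall e, (0 < e)%R -> exists T, (0 <= T)%R /\ forall t, (T <= t)%R -> (Cmod (vfactor a t) <= e)%R).
Proof.
intros ha.
pose (L := fun t => fst (a * cint bc 0 t)). pose (h := fun t => fst (a * bc t)).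
assert (Ld : forall t, (-1 < t)%R -> is_derive L t (h t)).
{ intros t ht. refine (proj1 (proj1 (rderiv_iff (fun s => a * cint bc 0 s) t (a * bc t)) _)).
  eapply rderiv_eq; [|apply rderiv_mult; [apply rderiv_const|apply (rderiv_CInt bc (-1)); [lra|exact ht|exact ccont_bc]]]. cbv beta; ring. }
assert (Em : forall t, Cmod (vfactor a t) = exp (L t)) by (intros; apply Cmod_cexp).
set (K := (Cmod a * Cmod (direction - Z0))%R).
assert (hK : (0 <= K)%R) by (apply Rmult_le_pos; apply Cmod_ge_0).
assert (Hh : forall t, (0 <= t)%R -> (h t <= - (fst a / (1 + t)) + K / (1 + t)²)%R).
{ intros t ht. pose proof (Zc_neq0 t ltac:(lra)) as hz.
  assert (hp : RtoC (1 + t) <> 0) by (apply Cmod_gt_0; rewrite Cmod_pos_real; lra).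
  assert (E : a * bc t = - (a * / RtoC (1 + t)) + - (a * (direction - Z0) * / (Zc t * RtoC (1 + t)))).
  { unfold bc. replace direction with ((direction - Z0) * / RtoC (1 + t) + Zc t * / RtoC (1 + t)) at 1.
    - field. auto.
    - unfold Zc. rewrite RtoC_plus in *. field. auto. }
  unfold h. rewrite E.
  assert (E1 : fst (- (a * / RtoC (1 + t))) = (- (fst a / (1 + t)))%R).
  { rewrite <- RtoC_inv by lra. unfold RtoC, Cmult, Copp; simpl. field. lra. }
  assert (E2 : (fst (- (a * (direction - Z0) * / (Zc t * RtoC (1 + t))))%C <= K / (1 + t)²)%R).
  { eapply Rle_trans; [apply fst_le_Cmod|]. rewrite Cmod_opp, !Cmod_mult. fold K.
    apply Rmult_le_compat_l; auto. rewrite Cmod_inv by (apply Cmult_neq_0; auto).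
    apply Rinv_le_contravar; [apply Rlt_0_sqr; lra|]. rewrite Cmod_mult, (Cmod_pos_real (1 + t)) by lra.
    apply Rmult_le_compat_r; [lra|]. pose proof (fst_le_Cmod (Zc t)) as X. rewrite Zc_re in X. lra. }
  change (fst (- (a * / RtoC (1 + t)))%C + fst (- (a * (direction - Z0) * / (Zc t * RtoC (1 + t))))%C <= - (fst a / (1 + t)) + K / (1 + t)²)%R.
  lra. }
(* Half of the rate is given up to absorb the error term, which it dominates from [T = K / al]
   on. *)
set (al := (fst a / 2)%R). assert (hal : (0 < al)%R) by (unfold al; lra).
set (T := (K / al)%R). assert (hT : (0 <= T)%R) by (apply Rmult_le_pos; [auto|apply Rlt_le, Rinv_0_lt_compat; auto]).
assert (Hh2 : forall t, (T <= t)%R -> (h t + al / (1 + t) <= 0)%R).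
{ intros t ht. specialize (Hh t ltac:(lra)).
  assert (K / (1 + t)² <= al / (1 + t))%R.
  { unfold Rsqr. apply (Rmult_le_reg_r ((1 + t) * (1 + t))); [apply Rmult_lt_0_compat; lra|].
    replace (K / ((1 + t) * (1 + t)) * ((1 + t) * (1 + t)))%R with K by (field; lra).
    replace (al / (1 + t) * ((1 + t) * (1 + t)))%R with (al * (1 + t))%R by (field; lra).
    apply (Rmult_le_compat_l al) in ht; [|lra]. unfold T in ht. replace (al * (K / al))%R with K in ht by (field; lra). lra. }
  replace (fst a / (1 + t))%R with (2 * (al / (1 + t)))%R in Hh by (unfold al; field; lra). lra. }
assert (G : forall t, (T <= t)%R -> (L t <= L T + al * ln (1 + T) - al * ln (1 + t))%R).
{ intros t ht.
  pose proof (derive_le (fun s => L s + al * ln (1 + s))%R (fun s => h s + al / (1 + s))%R T t 0 ht) as X.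
  cbv beta in X. enough (L t + al * ln (1 + t) - (L T + al * ln (1 + T)) <= 0 * (t - T))%R by lra. apply X.
  - intros s hs. apply (is_derive_plus L (fun s => al * ln (1 + s))%R).
    + apply Ld; lra.
    + auto_derive; [lra|field; lra].
  - intros s hs. apply Hh2; lra. }
assert (Hb : forall t, (-1 < t)%R -> (Rabs (h t) <= Cmod a * Cmod direction / R0)%R).
{ intros t ht. eapply Rle_trans; [apply Rabs_fst_le|]. unfold bc. rewrite !Cmod_mult, Cmod_opp, Cmod_inv by (apply Zc_neq0; auto).
  unfold Rdiv. rewrite Rmult_assoc. apply Rmult_le_compat_l; [apply Cmod_ge_0|]. apply Rmult_le_compat_l; [apply Cmod_ge_0|].
  apply Rinv_le_contravar; auto. pose proof (Zc_gt t ht). pose proof (fst_le_Cmod (Zc t)). lra. }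
set (H := (Cmod a * Cmod direction / R0)%R) in *.
assert (hH : (0 <= H)%R) by (eapply Rle_trans; [apply Rabs_pos|apply (Hb 0%R); lra]).
assert (L0 : L 0%R = 0%R) by (unfold L; rewrite cint_0, Cmult_0_r; reflexivity).
assert (Hpos : forall t, (0 <= t)%R -> (L t <= H * t)%R).
{ intros t ht. pose proof (derive_le L h 0 t H ht) as X. rewrite L0 in X. enough (L t - 0 <= H * (t - 0))%R by lra.
  apply X; intros; [apply Ld; lra|]. eapply Rle_trans; [apply Rle_abs|apply Hb; lra]. }
assert (Hneg : forall t, (-1 < t <= 0)%R -> (L t <= H)%R).
{ intros t ht. pose proof (derive_le (fun s => - L s)%R (fun s => - h s)%R t 0 H (proj2 ht)) as X. cbv beta in X. rewrite L0 in X.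
  assert (- 0 - - L t <= H * (0 - t))%R.
  { apply X.
    - intros s hs. apply (is_derive_opp L). apply Ld; lra.
    - intros s hs. eapply Rle_trans; [apply Rle_abs|]. rewrite Rabs_Ropp. apply Hb; lra. }
  assert (H * (0 - t) <= H * 1)%R by (apply Rmult_le_compat_l; lra). lra. }
split.
(* One bound for three ranges: at most [H] for [t <= 0], at most [H * T] up to [T], nonincreasing
   control by the logarithm afterwards. *)
- exists (exp (H * (T + 1))%R). split.
  + apply Rle_trans with (exp 0); [rewrite exp_0; lra|]. destruct (Req_dec (H * (T + 1))%R 0%R) as [->|hn]; [lra|]. apply Rlt_le, exp_increasing.
    assert (0 <= H * (T + 1))%R by (apply Rmult_le_pos; lra). lra.
  + intros t ht. rewrite Em.
    assert (LL : (L t <= H * (T + 1))%R).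
    { assert (0 <= H * T)%R by (apply Rmult_le_pos; auto).
      destruct (Rle_lt_dec t 0); [specialize (Hneg t ltac:(lra)); lra|].
      destruct (Rle_lt_dec t T).
      - specialize (Hpos t ltac:(lra)). assert (H * t <= H * T)%R by (apply Rmult_le_compat_l; auto). lra.
      - specialize (G t ltac:(lra)). specialize (Hpos T hT).
        assert (ln (1 + T) <= ln (1 + t))%R by (apply Rlt_le, ln_increasing; lra).
        assert (al * ln (1 + T) <= al * ln (1 + t))%R by (apply Rmult_le_compat_l; lra). lra. }
    destruct LL as [LL| ->]; [apply Rlt_le, exp_increasing; auto|lra].
- intros e he.
  set (W := ((L T + al * ln (1 + T) - ln e) / al)%R).
  exists (Rmax T (exp W)). split; [eapply Rle_trans; [exact hT|apply Rmax_l]|].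
  intros t ht. assert (t1 : (T <= t)%R) by (eapply Rle_trans; [apply Rmax_l|exact ht]).
  assert (t2 : (exp W <= t)%R) by (eapply Rle_trans; [apply Rmax_r|exact ht]).
  rewrite Em. specialize (G t t1).
  assert (W <= ln (1 + t))%R.
  { rewrite <- (ln_exp W). apply Rlt_le, ln_increasing; [apply exp_pos|lra]. }
  assert (al * W <= al * ln (1 + t))%R by (apply Rmult_le_compat_l; lra).
  assert (al * W = L T + al * ln (1 + T) - ln e)%R by (unfold W; field; lra).
  assert (LL : (L t <= ln e)%R) by lra.
  rewrite <- (exp_ln e) by auto. destruct LL as [LL| ->]; [apply Rlt_le, exp_increasing; auto|lra].
Qed.
End Curve.

(** * First integrals of the normal form *)

Lemma cderiv_hyperbola f (x z v A B D : C) : z <> 0 -> partials f (x, (z, v * / z)) A B D ->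
  exists l, cderiv (fun w => f (x, (w, v * / w))) z l.
Proof.
intros hz H.
pose proof (expands_const (fun w => Cmod (w - z)) (fun _ => Cmod_ge_0 _) x) as H1.
pose proof (cderiv_mult (fun _ => v) (fun w => / w) z _ _ (cderiv_const _ _) (cderiv_inv z hz)) as H3.
pose proof (expands_partials _ (fun _ => Cmod_ge_0 _) f _ _ _ _ _ _ _ _ _ _ H H1 (cderiv_id z) H3) as X.
exists (B + D * (0 * / z + v * - / (z * z))). eapply expands_ext; [| |exact X]; [reflexivity|].
intros p; cbv beta; ring.
Qed.

(** Unconditional because [/ 0] is 0 in [C]. Hence the maps [z -> (/ z) ^ k] are multiplicative on
    the whole of [C], as the transport of Laurent coefficients asks. *)
Lemma Cinv_mul (z w : C) : / (z * w) = / z * / w.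
Proof.
assert (Z : / 0 = 0) by (unfold Cinv, RtoC; simpl; f_equal; unfold Rdiv; ring).
destruct (Ceq_dec z 0) as [->|hz]; [rewrite Cmult_0_l, Z; ring|].
destruct (Ceq_dec w 0) as [->|hw]; [rewrite Cmult_0_r, Z; ring|].
field; auto.
Qed.

Section Core.
Variables (lam k0 a1 a2 : C) (q : R) (cf : C -> C) (sg Lc R0 dl : R).
Hypothesis Hk0 : k0 <> 0.
Hypothesis Hq : q <> 0%R.
Hypothesis Hlam : lam = (0%R, q) * k0.
Hypothesis Ha : (0 < fst (a1 + a2)%C)%R.
Hypothesis Hcf0 : cf 0 = 0.
Hypothesis HLc : (0 <= Lc)%R.
Hypothesis Hcf : forall v w, (Cmod v < sg)%R -> (Cmod w < sg)%R -> (Cmod (cf v - cf w)%C <= Lc * Cmod (v - w)%C)%R.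
Hypothesis HR0 : (0 < R0)%R.
Hypothesis Hdl : (0 < dl)%R.
Hypothesis Hsg : (dl * dl <= sg)%R.

(** First integrals are taken off the axes [y1 = 0] and [y2 = 0], since the functions of interest
    are quotients by [y1 y2] or [y1]. *)
Definition invariant (f : C3 -> C) : Prop := forall Z y1 y2 : C, (R0 < fst Z)%R ->
  (0 < Cmod y1 < dl)%R -> (0 < Cmod y2 < dl)%R ->
  exists A B D, partials f (k0 * / Z, (y1, y2)) A B D /\
    A * ((k0 * / Z) * (k0 * / Z)) + B * ((- lam + a1 * (k0 * / Z) - cf (y1 * y2)) * y1)
      + D * ((lam + a2 * (k0 * / Z) + cf (y1 * y2)) * y2) = 0.

(** * Growth of [y1] along a path, for any product [v] tending to 0: [y1 y2] itself, or [psi1 psi2]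
    on the axis *)

Section Traj.
Variables (Z0 : C) (m : R) (v : R -> C).
Hypothesis HZ0 : (R0 + 1 < fst Z0)%R.
Let Zt := Zc Z0 m.
Let x := xc k0 Z0 m.
Let b := bc Z0 m.
Let kap := - direction m * / k0.

Hypothesis Hvd : forall t, (-1 < t)%R -> exists l, rderiv v t l.
Hypothesis Hv : forall t, (-1 < t)%R -> (Cmod (v t) < sg)%R.

(* [Ec] solves the first component [y1' = kap (- lam + a1 x - cf v) y1] of the rescaled normal form. *)
Definition ec (t : R) : C := kap * (- lam) + a1 * b t + - kap * cf (v t).
Definition Ec (t : R) : C := cexp (cint ec 0 t).

Lemma ccont_cf t : (-1 < t)%R -> ccont (fun s => cf (v s)) t.
Proof.
intros ht. destruct (Hvd t ht) as [l Hl].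
apply (ccont_comp cf v); [|eapply rderiv_cont; exact Hl].
intros e he. pose proof (Hv t ht).
exists (Rmin (sg - Cmod (v t)) (e / (1 + Lc))); split.
{ apply Rmin_pos; [lra|apply Rdiv_lt_0_compat; lra]. }
intros w hw. apply Rmin_Rgt in hw; destruct hw as [w1 w2].
eapply Rle_trans; [apply Hcf; [pose proof (Cmod_rev w (v t)); lra|lra]|].
apply Rle_trans with ((1 + Lc) * (e / (1 + Lc)))%R; [|right; field; lra].
apply Rmult_le_compat; try apply Cmod_ge_0; lra.
Qed.

Lemma ccont_ec t : (-1 < t)%R -> ccont ec t.
Proof.
intros ht. unfold ec. apply ccont_plus; [apply ccont_plus; [apply ccont_const|]|].
- apply ccont_mult; [apply ccont_const|]. apply (ccont_bc Z0 m R0); auto.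
- apply ccont_mult; [apply ccont_const|apply ccont_cf; auto].
Qed.

Lemma rderiv_Ec t : (-1 < t)%R -> rderiv Ec t (ec t * Ec t).
Proof.
intros ht. unfold Ec. eapply rderiv_eq; [|apply (rderiv_CD cexp); [apply cderiv_cexp|apply (rderiv_CInt ec (-1)); [lra|exact ht|exact ccont_ec]]].
ring.
Qed.

Lemma Ec_neq0 t : Ec t <> 0.
Proof. apply cexp_neq0. Qed.

Lemma Ec_0 : Ec 0 = 1.
Proof. unfold Ec. rewrite cint_0. apply cexp_0. Qed.

(** The exponential rate of [y1]. It vanishes for [m = 0] and takes both signs for [m = 1] and
    [m = -1]: this is the purpose of the tilt. *)
Lemma kap_lam : fst (kap * (- lam)) = (- (m * q))%R.
Proof.
unfold kap. rewrite Hlam. replace (- direction m * / k0 * - ((0%R, q) * k0)) with (direction m * (0%R, q)) by (field; auto).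
unfold direction, Cmult; simpl; ring.
Qed.

Hypothesis Hv0 : forall e, (0 < e)%R -> exists T, (0 <= T)%R /\ forall t, (T <= t)%R -> (Cmod (v t) <= e)%R.

Lemma cfv_lim e : (0 < e)%R -> exists T, (0 <= T)%R /\ forall t, (T <= t)%R -> (Cmod (cf (v t)) <= e)%R.
Proof.
intros he. destruct (Hv0 (e / (1 + Lc))%R) as [T [hT HT]]; [apply Rdiv_lt_0_compat; lra|].
exists T; split; auto. intros t ht. specialize (HT t ht).
replace (cf (v t)) with (cf (v t) - cf 0) by (rewrite Hcf0; ring).
assert (0 < dl * dl)%R by (apply Rmult_lt_0_compat; auto).
eapply Rle_trans; [apply Hcf|].
- pose proof (Hv t ltac:(lra)); lra.
- rewrite Cmod_0; lra.
- replace (v t - 0) with (v t) by ring.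
  apply Rle_trans with ((1 + Lc) * (e / (1 + Lc)))%R; [|right; field; lra].
  apply Rmult_le_compat; try apply Cmod_ge_0; lra.
Qed.

(* The linear phase beats the logarithmic corrections. *)
Lemma traj_growth (s d : C) : (0 < fst (s * (kap * (- lam)))%C)%R ->
  forall M, exists T, forall t, (T <= t)%R -> (M <= Cmod (cexp (cint (fun t => (s * ec t + d * b t)%C) 0 t)))%R.
Proof.
intros hs. apply exp_integral_growth with (w := s * (kap * - lam)); auto.
- intros t ht. apply ccont_plus; apply ccont_mult; try apply ccont_const; [apply ccont_ec; auto|apply (ccont_bc Z0 m R0); auto].
- intros e he.
  set (W1 := (1 + Cmod (s * a1 + d))%R). set (W2 := (1 + Cmod (s * kap))%R).
  pose proof (Cmod_ge_0 (s * a1 + d)). pose proof (Cmod_ge_0 (s * kap)).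
  destruct (bc_lim Z0 m R0 HR0 HZ0 (e / (2 * W1))%R) as [T1 [hT1 HT1]]; [apply Rdiv_lt_0_compat; unfold W1; lra|].
  destruct (cfv_lim (e / (2 * W2))%R) as [T2 [hT2 HT2]]; [apply Rdiv_lt_0_compat; unfold W2; lra|].
  exists (Rmax T1 T2). intros t ht.
  specialize (HT1 t (Rle_trans _ _ _ (Rmax_l _ _) ht)). specialize (HT2 t (Rle_trans _ _ _ (Rmax_r _ _) ht)).
  replace (s * ec t + d * b t - s * (kap * - lam)) with ((s * a1 + d) * b t - (s * kap) * cf (v t)) by (unfold ec; ring).
  eapply Rle_trans; [apply Cmod_sub_le|]. rewrite (Cmod_mult (s * a1 + d)), (Cmod_mult (s * kap)).
  assert (Cmod (s * a1 + d) * Cmod (b t) <= W1 * (e / (2 * W1)))%R.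
  { apply Rmult_le_compat; try apply Cmod_ge_0; auto. unfold W1; lra. }
  assert (Cmod (s * kap) * Cmod (cf (v t)) <= W2 * (e / (2 * W2)))%R.
  { apply Rmult_le_compat; try apply Cmod_ge_0; auto. unfold W2; lra. }
  replace (W1 * (e / (2 * W1)))%R with (e / 2)%R in * by (field; unfold W1; lra).
  replace (W2 * (e / (2 * W2)))%R with (e / 2)%R in * by (field; unfold W2; lra). lra.
Qed.
End Traj.

Lemma curve_const f (g : R -> C3) s t :
  (forall u, (Rmin s t <= u <= Rmax s t)%R -> rderiv (fun w => f (g w)) u 0) -> f (g s) = f (g t).
Proof.
intros H. destruct (Rle_lt_dec s t) as [h|h].
- apply (rderiv_zero_const (fun w => f (g w))); auto. intros u hu; apply H. rewrite Rmin_left, Rmax_right; auto.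
- symmetry. apply (rderiv_zero_const (fun w => f (g w))); [lra|]. intros u hu; apply H. rewrite Rmin_right, Rmax_left; lra.
Qed.

(** * Laurent coefficients of a first integral on the hyperbolas [y1 y2 = v] *)

Section Inv.
Variables (f : C3 -> C) (Mf : R) (Z0 v0 : C).
Hypothesis Hf : invariant f.
Hypothesis HMf : forall Z y1 y2 : C, (R0 < fst Z)%R -> (0 < Cmod y1 < dl)%R -> (0 < Cmod y2 < dl)%R ->
  (Cmod (f ((k0 * / Z)%C, (y1, y2))) <= Mf / Cmod (y1 * y2))%R.
Hypothesis HZ0 : (R0 + 1 < fst Z0)%R.
Hypothesis Hv0 : v0 <> 0.

Definition vt (m t : R) : C := v0 * vfactor Z0 m (a1 + a2) t.
Definition Et (m t : R) : C := Ec Z0 m (vt m) t.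
Definition xt (m t : R) : C := xc k0 Z0 m t.

Lemma vt_neq0 m t : vt m t <> 0.
Proof. apply Cmult_neq_0; auto. apply cexp_neq0. Qed.

Lemma rderiv_vt m t : (-1 < t)%R -> rderiv (vt m) t ((a1 + a2) * bc Z0 m t * vt m t).
Proof.
intros ht. unfold vt. eapply rderiv_eq; [|apply rderiv_mult; [apply rderiv_const|apply (rderiv_vfc Z0 m R0); auto]]. cbv beta; ring.
Qed.

Lemma vt_0 m : vt m 0 = v0.
Proof. unfold vt; rewrite vfactor_0; ring. Qed.

Section M.
Variable m : R.
Hypothesis Hvt : forall t, (-1 < t)%R -> (Cmod (vt m t) < dl * dl / 2)%R.

Lemma vt_small_sg t : (-1 < t)%R -> (Cmod (vt m t) < sg)%R.
Proof. intros h; specialize (Hvt t h). assert (0 < dl * dl)%R by (apply Rmult_lt_0_compat; auto). lra. Qed.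

Lemma vt_derivable t : (-1 < t)%R -> exists l, rderiv (vt m) t l.
Proof. intros h; eexists; apply rderiv_vt; auto. Qed.

Lemma rderiv_Et t : (-1 < t)%R -> rderiv (Et m) t (ec Z0 m (vt m) t * Et m t).
Proof. intros ht. exact (rderiv_Ec Z0 m (vt m) HZ0 vt_derivable vt_small_sg t ht). Qed.

Lemma Et_neq0 t : Et m t <> 0.
Proof. apply cexp_neq0. Qed.

Lemma Et_0 : Et m 0 = 1.
Proof. exact (Ec_0 Z0 m (vt m)). Qed.

(** The curve [(xt, z Et, vt / (z Et))] is a trajectory of the normal form up to the factor [kap],
    so [f] is constant on it as long as it stays in the polydisc. *)
Lemma traj_const (z : C) s t : z <> 0 ->
  (forall u, (Rmin s t <= u <= Rmax s t)%R -> (-1 < u)%R /\ (Cmod (z * Et m u) < dl)%R /\ (Cmod (vt m u * / (z * Et m u)) < dl)%R) ->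
  f (xt m s, (z * Et m s, vt m s * / (z * Et m s))) = f (xt m t, (z * Et m t, vt m t * / (z * Et m t))).
Proof.
intros hz H.
apply (curve_const f (fun u => (xt m u, (z * Et m u, vt m u * / (z * Et m u))))).
intros u hu. destruct (H u hu) as [h1 [h2 h3]].
assert (hE := Et_neq0 u). assert (hvu := vt_neq0 m u).
assert (hzE : z * Et m u <> 0) by (apply Cmult_neq_0; auto).
assert (hZ : Zc Z0 m u <> 0) by (apply (Zc_neq0 Z0 m R0); auto).
destruct (Hf (Zc Z0 m u) (z * Et m u) (vt m u * / (z * Et m u))) as [A [B [D [HD HE]]]].
- apply (Zc_gt Z0 m R0); auto.
- split; auto. apply Cmod_gt_0; auto.
- split; auto. apply Cmod_gt_0. apply Cmult_neq_0; auto.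
  intros E. apply (f_equal (fun w => w * (z * Et m u))) in E. rewrite Cinv_l in E by auto.
  rewrite Cmult_0_l in E. apply (f_equal fst) in E; simpl in E; lra.
- replace (z * Et m u * (vt m u * / (z * Et m u))) with (vt m u) in HE by (field; split; auto).
  pose proof (rderiv_xc k0 Z0 m R0 HR0 HZ0 u h1 Hk0) as D1.
  pose proof (rderiv_mult _ _ _ _ _ (rderiv_const z u) (rderiv_Et u h1)) as D2.
  pose proof (rderiv_mult _ _ _ _ _ (rderiv_vt m u h1) (rderiv_CD (fun w => / w) _ _ _ _ (cderiv_inv _ hzE) D2)) as partials'.
  pose proof (expands_partials _ (fun _ => Rabs_pos _) f (xc k0 Z0 m u, (z * Et m u, vt m u * / (z * Et m u))) _ _ _ _ _ _ _ _ _ HD D1 D2 partials') as X.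
  eapply expands_ext; [| |exact X]; [reflexivity|].
  intros s'. cbv beta.
  set (S' := RtoC (s' - u)).
  (* The derivative of [f] along the curve is [kap] times the expression that [invariant] makes
     zero. *)
  transitivity ((- direction m * / k0) * S' * (A * (k0 * / Zc Z0 m u * (k0 * / Zc Z0 m u)) +
     B * ((- lam + a1 * (k0 * / Zc Z0 m u) - cf (vt m u)) * (z * Et m u)) +
     D * ((lam + a2 * (k0 * / Zc Z0 m u) + cf (vt m u)) * (vt m u * / (z * Et m u))))); [|rewrite HE; ring].
  unfold ec, xc, bc. field. repeat split; auto.
Qed.

Section P.
Variables (p : C -> C) (Mp : R).
Hypothesis pm : forall z w, p (z * w) = p z * p w.
Hypothesis p1 : p 1 = 1.
Hypothesis pd : forall z : C, z <> 0 -> exists l, cderiv p z l.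
Hypothesis pM : forall z, Cmod z = (dl / 2)%R -> (Cmod (p z) <= Mp)%R.

Definition hyperbola_fun (t : R) (z : C) : C := f (xt m t, (z, vt m t * / z)).
(** For [p = z^k], with [k] of any sign, this is [2 pi] times the Laurent coefficient of index [-k]
    in [y1] at time [t]. Only the multiplicativity of [p] governs its transport. *)
Definition laurent (t : R) : C := circle_int (fun z => hyperbola_fun t z * p z) (RtoC (dl / 2)).

(** The annulus [Cmod v / dl < Cmod y1 < dl] is what the two conditions [Cmod y1 < dl] and
    [Cmod y2 < dl] become on [y1 y2 = v]. *)
Lemma hyperbola_dom t z : (-1 < t)%R -> (Cmod (vt m t) / dl < Cmod z < dl)%R ->
  z <> 0 /\ (0 < Cmod z < dl)%R /\ (0 < Cmod (vt m t * / z) < dl)%R.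
Proof.
intros ht hz.
assert (h0 := proj1 (Cmod_gt_0 _) (vt_neq0 m t)).
assert (hq : (0 < Cmod (vt m t) / dl)%R) by (apply Rdiv_lt_0_compat; auto).
assert (hz0 : z <> 0) by (apply Cmod_gt_0; lra).
repeat split; auto; try lra; rewrite Cmod_mult, Cmod_inv by auto.
- apply Rdiv_lt_0_compat; lra.
- apply (Rmult_lt_reg_r (Cmod z)); [lra|]. rewrite Rmult_assoc, Rinv_l, Rmult_1_r by lra.
  destruct hz as [hz _]. apply (Rmult_lt_compat_r dl) in hz; auto.
  replace (Cmod (vt m t) / dl * dl)%R with (Cmod (vt m t)) in hz by (field; lra). lra.
Qed.

Lemma holomorphic_hyperbola t : (-1 < t)%R -> holomorphic_annulus (hyperbola_fun t) (Cmod (vt m t) / dl) dl.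
Proof.
intros ht z hz. destruct (hyperbola_dom t z ht hz) as [hz0 [h1 h2]].
destruct (Hf (Zc Z0 m t) z (vt m t * / z)) as [A [B [D [HD _]]]]; auto.
- apply (Zc_gt Z0 m R0); auto.
- apply (cderiv_hyperbola f _ _ _ _ _ _ hz0 HD).
Qed.

Lemma holomorphic_hyperbola_mult t : (-1 < t)%R -> holomorphic_annulus (fun z => hyperbola_fun t z * p z) (Cmod (vt m t) / dl) dl.
Proof.
intros ht z hz. destruct (holomorphic_hyperbola t ht z hz) as [l1 H1]. destruct (hyperbola_dom t z ht hz) as [hz0 _].
destruct (pd z hz0) as [l2 H2]. eexists. apply cderiv_mult; eauto.
Qed.

Lemma half_in t : (-1 < t)%R -> (0 <= Cmod (vt m t) / dl)%R /\ (Cmod (vt m t) / dl < Cmod (RtoC (dl / 2)) < dl)%R.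
Proof.
intros ht. rewrite Cmod_pos_real by lra. specialize (Hvt t ht). repeat split.
- apply Rmult_le_pos; [apply Cmod_ge_0|apply Rlt_le, Rinv_0_lt_compat; auto].
- apply (Rmult_lt_reg_r dl); auto. replace (Cmod (vt m t) / dl * dl)%R with (Cmod (vt m t)) by (field; lra). lra.
- lra.
Qed.

(** For [t] close to [t0] the circle of radius [dl / 2] is carried by the flow to a circle still
    inside the annulus of time [t]. On the carried circle [f] takes the same values, and moving it
    back to radius [dl / 2] does not change the integral; the only change is the factor [p] of the
    dilation. *)
Lemma laurent_local t0 : (0 <= t0)%R -> exists eta, (0 < eta)%R /\ forall t, (Rabs (t - t0) < eta)%R ->
  laurent t = p (Et m t * / Et m t0) * laurent t0.
Proof.
intros ht0.
set (z := RtoC (dl / 2) * / Et m t0).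
assert (hd2 : RtoC (dl / 2) <> 0) by (apply Cmod_gt_0; rewrite Cmod_pos_real; lra).
assert (hz : z <> 0).
{ intros E. apply (f_equal (fun w => w * Et m t0)) in E. unfold z in E.
  rewrite <- Cmult_assoc, Cinv_l, Cmult_1_r, Cmult_0_l in E by apply Et_neq0. auto. }
assert (hzE0 : z * Et m t0 = RtoC (dl / 2)) by (unfold z; field; apply Et_neq0).
assert (cA : ccont (fun t => z * Et m t) t0) by (apply ccont_mult; [apply ccont_const|eapply rderiv_cont, rderiv_Et; lra]).
assert (cB : ccont (fun t => vt m t * / (z * Et m t)) t0).
{ apply ccont_mult; [eapply rderiv_cont, rderiv_vt; lra|].
  apply (ccont_comp (fun w => / w) (fun t => z * Et m t)); auto.
  eapply cderiv_cont. apply cderiv_inv. rewrite hzE0; auto. }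
destruct (half_in t0 ltac:(lra)) as [hn hh].
assert (b0 : (Cmod (vt m t0 * / (z * Et m t0)) < dl)%R).
{ rewrite hzE0. apply (hyperbola_dom t0 _ ltac:(lra) hh). }
destruct (ccont_mod _ _ cA (dl / 2)%R ltac:(lra)) as [e1 [he1 He1]].
destruct (ccont_mod _ _ cB (dl - Cmod (vt m t0 * / (z * Et m t0)))%R ltac:(lra)) as [e2 [he2 He2]].
set (eta := Rmin (1 / 2) (Rmin e1 e2)).
exists eta; split; [repeat apply Rmin_pos; auto; lra|]. intros t ht.
(* Only moduli are involved, so the same [eta] serves all the points [z * cis u] of the circle. *)
assert (good : forall u, (Rabs (u - t0) < eta)%R -> (-1 < u)%R /\ (Cmod (z * Et m u) < dl)%R /\ (Cmod (vt m u * / (z * Et m u)) < dl)%R).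
{ intros u hu. apply Rmin_Rgt in hu; destruct hu as [u1 hu]. apply Rmin_Rgt in hu; destruct hu as [u2 u3].
  repeat split.
  - apply Rgt_lt, Rabs_def2 in u1; lra.
  - specialize (He1 u u2). pose proof (Cmod_rev (z * Et m u) (z * Et m t0)) as Y. rewrite hzE0 in Y at 1. rewrite Cmod_pos_real in Y by lra. lra.
  - specialize (He2 u u3). pose proof (Cmod_rev (vt m u * / (z * Et m u)) (vt m t0 * / (z * Et m t0))). lra. }
destruct (good t ht) as [ht1 [ht2 ht3]].
assert (hzE : z * Et m t <> 0) by (apply Cmult_neq_0; auto; apply Et_neq0).
assert (htz : (Cmod (vt m t) / dl < Cmod (z * Et m t) < dl)%R).
{ split; auto. rewrite Cmod_mult, Cmod_inv in ht3 by auto. assert (hp := proj1 (Cmod_gt_0 _) hzE).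
  apply (Rmult_lt_compat_r (Cmod (z * Et m t))) in ht3; auto. rewrite Rmult_assoc, Rinv_l, Rmult_1_r in ht3 by lra.
  apply (Rmult_lt_reg_r dl); auto. replace (Cmod (vt m t) / dl * dl)%R with (Cmod (vt m t)) by (field; lra). lra. }
destruct (half_in t ht1) as [hn' hh'].
unfold laurent at 1. rewrite (circle_int_indep _ _ _ _ (z * Et m t) (holomorphic_hyperbola_mult t ht1) hn' hh' htz).
unfold laurent, circle_int.
assert (X : ex_cint (fun u => hyperbola_fun t0 (RtoC (dl / 2) * cis u) * p (RtoC (dl / 2) * cis u)) 0 (2 * PI)).
{ apply ex_cint_cont; intros. apply (ccont_circle (fun z => hyperbola_fun t0 z * p z)). intros w hw. apply holomorphic_hyperbola_mult; [lra|rewrite hw; auto]. }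
rewrite <- (cint_scal _ _ _ _ X). apply cint_ext. intros u _.
replace (z * Et m t * cis u) with ((Et m t * / Et m t0) * (RtoC (dl / 2) * cis u)) at 2 by (unfold z; ring).
rewrite pm. enough (hyperbola_fun t (z * Et m t * cis u) = hyperbola_fun t0 (RtoC (dl / 2) * cis u)) as -> by ring.
unfold hyperbola_fun. rewrite <- hzE0.
replace (z * Et m t * cis u) with (z * cis u * Et m t) by ring. replace (z * Et m t0 * cis u) with (z * cis u * Et m t0) by ring.
apply traj_const; [apply Cmult_neq_0; auto; apply cis_neq0|].
intros w hw. destruct (good w) as [g1 [g2 g3]].
{ unfold Rmin, Rmax in hw. apply Rabs_def2 in ht. apply Rabs_def1; destruct (Rle_dec t t0); lra. }
replace (z * cis u * Et m w) with (cis u * (z * Et m w)) by ring.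
assert (hw0 : z * Et m w <> 0) by (apply Cmult_neq_0; auto; apply Et_neq0).
repeat split; auto.
- rewrite Cmod_mult, Cmod_cis; lra.
- replace (vt m w * / (cis u * (z * Et m w))) with (/ cis u * (vt m w * / (z * Et m w))) by (field; repeat split; auto using Et_neq0, cis_neq0).
  rewrite Cmod_mult, Cmod_inv, Cmod_cis by apply cis_neq0. rewrite Rinv_1; lra.
Qed.

Lemma p_inv (z : C) : z <> 0 -> p z * p (/ z) = 1.
Proof. intros hz. rewrite <- pm, Cinv_r by auto. apply p1. Qed.

(** By the local statement [laurent t * p (/ Et t)] is locally constant in [t], hence constant: the
    relation holds for all times although the individual trajectories do not stay in the
    polydisc. *)
Lemma laurent_transport t : (0 <= t)%R -> laurent t = p (Et m t) * laurent 0.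
Proof.
intros ht.
assert (K : laurent 0 * p (/ Et m 0) = laurent t * p (/ Et m t)).
{ apply (rderiv_zero_const (fun s => laurent s * p (/ Et m s)) 0 t ht). intros s hs.
  destruct (laurent_local s ltac:(lra)) as [eta [he He]].
  apply (expands_ext_loc _ (fun _ => laurent s * p (/ Et m s)) _ _ _ eta he).
  - intros u hu. rewrite (He u hu), pm.
    pose proof (p_inv (Et m u) (Et_neq0 u)) as Y.
    transitivity (laurent s * p (/ Et m s) * (p (Et m u) * p (/ Et m u))); [rewrite Y; ring|ring].
  - eapply expands_ext; [| |apply expands_const; intros; apply Rabs_pos]; auto. intros; simpl; ring. }
rewrite Et_0 in K. replace (/ 1) with (RtoC 1) in K by field. rewrite p1 in K.
replace (laurent t) with (p (Et m t) * (laurent t * p (/ Et m t))).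
- rewrite <- K; ring.
- pose proof (p_inv (Et m t) (Et_neq0 t)) as Y. transitivity (laurent t * (p (Et m t) * p (/ Et m t))); [ring|rewrite Y; ring].
Qed.

(** The bound [f = O(1/v)] makes the coefficient at time [t] at most a constant over
    [Cmod (vfactor t)], while transport makes it [p (Et t)] times the initial one. If the product of
    the two moduli is unbounded as assumed, the initial coefficient is 0. *)
Lemma laurent_vanish : (forall M, exists T, forall t, (T <= t)%R -> (M <= Cmod (vfactor Z0 m (a1 + a2) t) * Cmod (p (Et m t)))%R) -> laurent 0 = 0.
Proof.
intros HG. apply Cmod_0_eq. intros e he. assert (pp := PI_RGT_0).
assert (hv0 := proj1 (Cmod_gt_0 _) Hv0).
set (W := (4 * PI * (Rabs Mf * Rabs Mp / Cmod v0))%R).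
assert (hW : (0 <= W)%R).
{ unfold W. apply Rmult_le_pos; [lra|]. apply Rmult_le_pos; [|apply Rlt_le, Rinv_0_lt_compat; auto].
  apply Rmult_le_pos; apply Rabs_pos. }
destruct (HG ((W + 1) / e)%R) as [T HT].
set (t := Rmax T 0). specialize (HT t (Rmax_l _ _)). assert (ht : (0 <= t)%R) by apply Rmax_r.
set (V := Cmod (vfactor Z0 m (a1 + a2) t)) in *.
assert (hV : (0 < V)%R) by (apply Cmod_gt_0, cexp_neq0).
assert (B : (Cmod (laurent t) <= 4 * PI * (Rabs Mf / (Cmod v0 * V) * Rabs Mp))%R).
{ destruct (half_in t ltac:(lra)) as [hn hh].
  unfold laurent. apply (circle_int_bound (fun z => hyperbola_fun t z * p z) (RtoC (dl / 2)) (Rabs Mf / (Cmod v0 * V) * Rabs Mp)).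
  - intros w hw. apply holomorphic_hyperbola_mult; [lra|rewrite hw; auto].
  - intros w hw. rewrite <- hw in hh. destruct (hyperbola_dom t w ltac:(lra) hh) as [hw0 [h1 h2]].
    rewrite Cmod_mult. apply Rmult_le_compat; try apply Cmod_ge_0.
    + unfold hyperbola_fun, xt, xc. eapply Rle_trans; [apply HMf; auto; apply (Zc_gt Z0 m R0); auto; lra|].
      replace (w * (vt m t * / w)) with (vt m t) by (field; auto). unfold vt. rewrite Cmod_mult. fold V.
      apply Rmult_le_compat_r; [|apply Rle_abs]. apply Rlt_le, Rinv_0_lt_compat, Rmult_lt_0_compat; auto.
    + eapply Rle_trans; [apply pM; rewrite hw; apply Cmod_pos_real; lra|apply Rle_abs]. }
rewrite (laurent_transport t ht), Cmod_mult in B.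
assert (B2 : (V * Cmod (p (Et m t)) * Cmod (laurent 0) <= W)%R).
{ apply (Rmult_le_compat_l V) in B; [|lra]. unfold W.
  replace (V * (4 * PI * (Rabs Mf / (Cmod v0 * V) * Rabs Mp)))%R with (4 * PI * (Rabs Mf * Rabs Mp / Cmod v0))%R in B by (field; lra). lra. }
assert (B3 : ((W + 1) / e * Cmod (laurent 0) <= W)%R).
{ eapply Rle_trans; [|exact B2]. apply Rmult_le_compat_r; auto using Cmod_ge_0. }
apply (Rmult_le_compat_l e) in B3; [|lra]. replace (e * ((W + 1) / e * Cmod (laurent 0)))%R with ((W + 1) * Cmod (laurent 0))%R in B3 by (field; lra).
apply (Rmult_le_reg_l (W + 1)); [lra|]. lra.
Qed.
End P.

Lemma vt_lim e : (0 < e)%R -> exists T, (0 <= T)%R /\ forall t, (T <= t)%R -> (Cmod (vt m t) <= e)%R.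
Proof.
intros he. assert (h := Cmod_ge_0 v0).
destruct (proj2 (vfactor_decay Z0 m R0 HR0 HZ0 (a1 + a2) Ha) (e / (1 + Cmod v0))%R) as [T [hT HT]]; [apply Rdiv_lt_0_compat; lra|].
exists T; split; auto. intros t ht. unfold vt; rewrite Cmod_mult. specialize (HT t ht).
apply Rle_trans with ((1 + Cmod v0) * (e / (1 + Cmod v0)))%R; [|right; field; lra].
apply Rmult_le_compat; auto using Cmod_ge_0; lra.
Qed.

Lemma growth_split (s d : C) t : (0 <= t)%R ->
  cexp (cint (fun u => (s * ec Z0 m (vt m) u + d * bc Z0 m u)%C) 0 t) = cexp (s * cint (ec Z0 m (vt m)) 0 t) * vfactor Z0 m d t.
Proof.
intros ht. unfold vfactor. rewrite <- cexp_plus. f_equal.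
assert (X1 : ex_cint (ec Z0 m (vt m)) 0 t).
{ apply ex_cint_cont; intros u hu. rewrite Rmin_left in hu by auto. apply (ccont_ec Z0 m (vt m) HZ0 vt_derivable vt_small_sg). lra. }
assert (X2 : ex_cint (bc Z0 m) 0 t).
{ apply ex_cint_cont; intros u hu. rewrite Rmin_left in hu by auto. apply (ccont_bc Z0 m R0); auto. lra. }
assert (Y1 : ex_cint (fun u => s * ec Z0 m (vt m) u) 0 t).
{ apply ex_cint_cont; intros u hu. rewrite Rmin_left in hu by auto. apply ccont_mult; [apply ccont_const|]. apply (ccont_ec Z0 m (vt m) HZ0 vt_derivable vt_small_sg). lra. }
assert (Y2 : ex_cint (fun u => d * bc Z0 m u) 0 t).
{ apply ex_cint_cont; intros u hu. rewrite Rmin_left in hu by auto. apply ccont_mult; [apply ccont_const|]. apply (ccont_bc Z0 m R0); auto. lra. }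
rewrite (cint_plus _ _ _ _ Y1 Y2), (cint_scal _ _ _ _ X1), (cint_scal _ _ _ _ X2). ring.
Qed.

(** The exponent [d = a1 + a2] in [traj_growth] shows that [vfactor * G] grows; the exponent [d = 0]
    shows that [Cmod G >= 1] eventually, so the power [k >= 1] can only help. *)
Lemma power_growth (s : C) (G : R -> C) k : (1 <= k)%nat ->
  (0 < fst (s * (- direction m * / k0 * (- lam)))%C)%R ->
  (forall t, (0 <= t)%R -> G t = cexp (s * cint (ec Z0 m (vt m)) 0 t)) ->
  forall M, exists T, forall t, (T <= t)%R -> (M <= Cmod (vfactor Z0 m (a1 + a2) t) * Cmod (G t ^ k))%R.
Proof.
intros hk hs HG M.
destruct (traj_growth Z0 m (vt m) HZ0 vt_derivable vt_small_sg vt_lim s 0 hs 1%R) as [T1 HT1].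
destruct (traj_growth Z0 m (vt m) HZ0 vt_derivable vt_small_sg vt_lim s (a1 + a2) hs M) as [T2 HT2].
exists (Rmax 0 (Rmax T1 T2)). intros t ht.
assert (h0 : (0 <= t)%R) by (eapply Rle_trans; [apply Rmax_l|exact ht]).
assert (h : (Rmax T1 T2 <= t)%R) by (eapply Rle_trans; [apply Rmax_r|exact ht]).
specialize (HT1 t (Rle_trans _ _ _ (Rmax_l _ _) h)). specialize (HT2 t (Rle_trans _ _ _ (Rmax_r _ _) h)).
rewrite growth_split in HT1, HT2 by auto. rewrite <- HG, Cmod_mult in HT1, HT2 by auto.
unfold vfactor at 1 in HT1. rewrite Cmult_0_l, cexp_0, Cmod_1, Rmult_1_r in HT1.
eapply Rle_trans; [exact HT2|]. rewrite Rmult_comm. apply Rmult_le_compat_l; [apply Cmod_ge_0|].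
rewrite Cmod_pow. destruct k as [|k]; [lia|]. simpl. rewrite <- (Rmult_1_r (Cmod (G t))) at 1.
apply Rmult_le_compat_l; [apply Cmod_ge_0|]. apply pow_R1_Rle; auto.
Qed.

(** The tilt with [m q < 0] makes [Et] grow, which kills the coefficients of negative index,
    extracted by positive powers of [z]. The next lemma treats the opposite tilt. *)
Lemma vanish_pos k : (1 <= k)%nat -> (0 < - (m * q))%R -> laurent (fun z => z ^ k) 0 = 0.
Proof.
intros hk hm. apply (laurent_vanish (fun z => z ^ k) ((dl / 2) ^ k)).
- intros; apply Cpow_mult_l.
- apply Cpow_1_l.
- intros; apply cderiv_pow.
- intros z hz; rewrite Cmod_pow, hz; lra.
- apply (power_growth 1 (Et m) k hk).
  + rewrite Cmult_1_l. rewrite (kap_lam m). auto.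
  + intros t _. rewrite Cmult_1_l; auto.
Qed.

Lemma vanish_neg k : (1 <= k)%nat -> (0 < m * q)%R -> laurent (fun z => (/ z) ^ k) 0 = 0.
Proof.
intros hk hm. apply (laurent_vanish (fun z => (/ z) ^ k) ((/ (dl / 2)) ^ k)).
- intros z w. rewrite Cinv_mul, Cpow_mult_l; auto.
- replace (/ 1) with (RtoC 1) by field. apply Cpow_1_l.
- intros z hz. destruct (cderiv_pow k (/ z)) as [l Hl].
  eexists. apply (cderiv_comp (fun w => w ^ k) (fun w => / w) z l _ Hl (cderiv_inv z hz)).
- intros z hz; rewrite Cmod_pow, Cmod_inv, hz; [lra|apply Cmod_gt_0; lra].
- apply (power_growth (- 1) (fun t => / Et m t) k hk).
  + replace (- 1 * (- direction m * / k0 * - lam)) with (- (- direction m * / k0 * - lam)) by ring.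
    change (0 < - fst (- direction m * / k0 * - lam)%C)%R. rewrite (kap_lam m). lra.
  + intros t _. unfold Et, Ec. rewrite <- cexp_inv. f_equal; ring.
Qed.

(** With all other Laurent coefficients zero at every time, [circle_value] identifies [2 pi f] at a
    point with the constant coefficient, and that one is transported unchanged ([p = 1]) back to
    time 0. *)
Lemma circle_transport t (z : C) : (0 <= t)%R -> (Cmod (vt m t) / dl < Cmod z < dl)%R ->
  (forall k, (1 <= k)%nat -> laurent (fun z => z ^ k) 0 = 0) -> (forall k, (1 <= k)%nat -> laurent (fun z => (/ z) ^ k) 0 = 0) ->
  RtoC (2 * PI) * f (xt m t, (z, vt m t * / z)) = circle_int (fun z => f (k0 * / Z0, (z, v0 * / z))) (RtoC (dl / 2)).
Proof.
intros ht hz HP HN.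
destruct (hyperbola_dom t z ltac:(lra) hz) as [hz0 _].
destruct (half_in t ltac:(lra)) as [hn hh].
assert (K : forall p : C -> C, (forall z w, p (z * w) = p z * p w) -> p 1 = 1 ->
   (forall z : C, z <> 0 -> exists l, cderiv p z l) -> circle_int (fun z => hyperbola_fun t z * p z) z = p (Et m t) * laurent p 0).
{ intros p pm p1 pd. rewrite <- (laurent_transport p pm p1 pd t ht). unfold laurent.
  apply (circle_int_indep _ (Cmod (vt m t) / dl) dl); auto. apply holomorphic_hyperbola_mult; auto; lra. }
pose proof (circle_value (hyperbola_fun t) z hz0) as E. unfold hyperbola_fun at 5 in E. rewrite <- E.
- transitivity (circle_int (fun z => hyperbola_fun t z * 1) z); [unfold circle_int; apply cint_ext; intros; ring|].
  rewrite (K (fun _ => 1)); [|intros; ring|auto|intros; eexists; apply cderiv_const].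
  unfold laurent, circle_int. rewrite Cmult_1_l. apply cint_ext. intros u _. unfold hyperbola_fun, xt, xc, Zc. rewrite vt_0.
  replace (Z0 + direction m * 0) with Z0 by ring. ring.
- intros w hw. apply (holomorphic_hyperbola t ltac:(lra)). rewrite hw; auto.
- intros k hk. rewrite (K (fun z => z ^ k)), HP by auto using Cpow_mult_l, Cpow_1_l, cderiv_pow. ring.
- intros k hk. rewrite (K (fun z => (/ z) ^ k)), HN; auto; [ring| | |].
  + intros u w. rewrite Cinv_mul, Cpow_mult_l; auto.
  + replace (/ 1) with (RtoC 1) by field. apply Cpow_1_l.
  + intros w hw. destruct (cderiv_pow k (/ w)) as [l Hl].
    eexists. apply (cderiv_comp (fun w => w ^ k) (fun w => / w) w l _ Hl (cderiv_inv w hw)).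
Qed.
End M.

(** Both tilted paths start at the same [x] and the same [v0]: a coefficient killed along one of
    them is also zero for the other. *)
Lemma laurent_start m m' p : laurent m p 0 = laurent m' p 0.
Proof.
unfold laurent, circle_int. apply cint_ext; intros u _. unfold hyperbola_fun, xt, xc, Zc. rewrite !vt_0. rewrite !Cmult_0_r. reflexivity.
Qed.

Lemma first_integral_value t (z : C) :
  (forall m, (m = 1 \/ m = -1)%R -> forall t, (-1 < t)%R -> (Cmod (vt m t) < dl * dl / 2)%R) ->
  (0 <= t)%R -> (Cmod (vt 1 t) / dl < Cmod z < dl)%R ->
  RtoC (2 * PI) * f (xt 1 t, (z, vt 1 t * / z)) = circle_int (fun z => f (k0 * / Z0, (z, v0 * / z))) (RtoC (dl / 2)).
Proof.
intros H ht hz. apply circle_transport; auto.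
- intros k hk. destruct (Rlt_le_dec q 0) as [h|h].
  + apply vanish_pos; auto. lra.
  + rewrite (laurent_start 1 (-1)). apply vanish_pos; auto. assert (q <> 0%R) by auto. lra.
- intros k hk. destruct (Rlt_le_dec q 0) as [h|h].
  + rewrite (laurent_start 1 (-1)). apply vanish_neg; auto. lra.
  + apply vanish_neg; auto. assert (q <> 0%R) by auto. lra.
Qed.
End Inv.

Lemma first_integral_const f Mf (Z0 : C) : invariant f ->
  (forall Z y1 y2 : C, (R0 < fst Z)%R -> (0 < Cmod y1 < dl)%R -> (0 < Cmod y2 < dl)%R ->
    (Cmod (f ((k0 * / Z)%C, (y1, y2))) <= Mf / Cmod (y1 * y2))%R) ->
  (R0 + 1 < fst Z0)%R ->
  exists eta, (0 < eta <= dl * dl / 2)%R /\ forall (v0 : C) (t : R) (z0 z : C), v0 <> 0 -> (Cmod v0 < eta)%R -> (0 <= t)%R ->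
    (Cmod v0 / dl < Cmod z0 < dl)%R -> (Cmod (v0 * vfactor Z0 1 (a1 + a2)%C t) / dl < Cmod z < dl)%R ->
    f (xc k0 Z0 1 t, (z, (v0 * vfactor Z0 1 (a1 + a2) t) * / z)) = f (k0 * / Z0, (z0, v0 * / z0)).
Proof.
intros Hf HMf HZ0.
destruct (proj1 (vfactor_decay Z0 1 R0 HR0 HZ0 (a1 + a2) Ha)) as [B1 [hB1 HB1]].
destruct (proj1 (vfactor_decay Z0 (-1) R0 HR0 HZ0 (a1 + a2) Ha)) as [B2 [hB2 HB2]].
set (B := Rmax B1 B2). assert (b1 : (B1 <= B)%R) by apply Rmax_l. assert (b2 : (B2 <= B)%R) by apply Rmax_r.
assert (hdd : (0 < dl * dl)%R) by (apply Rmult_lt_0_compat; auto).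
(* [B >= 1] bounds [vfactor] along both tilts, so that [v] stays below [dl * dl / 2] and the circle
   of radius [dl / 2] stays inside the annulus. *)
exists (dl * dl / 2 / B)%R. split; [split|].
- apply Rdiv_lt_0_compat; lra.
- apply (Rmult_le_reg_r B); [lra|]. unfold Rdiv at 1. rewrite Rmult_assoc, Rinv_l, Rmult_1_r by lra.
  rewrite <- (Rmult_1_r (dl * dl / 2)) at 1. apply Rmult_le_compat_l; lra.
- intros v0 t z0 z hv0 hv ht hz0 hz.
  assert (Hvt : forall m, (m = 1 \/ m = -1)%R -> forall t, (-1 < t)%R -> (Cmod (vt Z0 v0 m t) < dl * dl / 2)%R).
  { intros m hm u hu. unfold vt. rewrite Cmod_mult.
    assert (X : (Cmod (vfactor Z0 m (a1 + a2) u) <= B)%R).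
    { destruct hm as [->| ->]; [specialize (HB1 u hu)|specialize (HB2 u hu)]; lra. }
    apply Rle_lt_trans with (Cmod v0 * B)%R; [apply Rmult_le_compat_l; auto using Cmod_ge_0|].
    apply (Rmult_lt_compat_r B) in hv; [|lra]. replace (dl * dl / 2 / B * B)%R with (dl * dl / 2)%R in hv by (field; lra). auto. }
  pose proof (first_integral_value f Mf Z0 v0 Hf HMf HZ0 hv0 t z Hvt ht hz) as E1.
  pose proof (first_integral_value f Mf Z0 v0 Hf HMf HZ0 hv0 0 z0 Hvt (Rle_refl _)) as E2.
  assert (E0 : vt Z0 v0 1 0 = v0) by apply vt_0.
  rewrite E0 in E2. specialize (E2 hz0). unfold xt in E1, E2. unfold xc at 1 in E2. unfold Zc in E2.
  replace (Z0 + direction 1 * 0) with Z0 in E2 by ring.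
  assert (pp := PI_RGT_0).
  assert (h2 : RtoC (2 * PI) <> 0) by (apply Cmod_gt_0; rewrite Cmod_pos_real; lra).
  assert (E : RtoC (2 * PI) * f (xc k0 Z0 1 t, (z, vt Z0 v0 1 t * / z)) = RtoC (2 * PI) * f (k0 * / Z0, (z0, v0 * / z0))) by (rewrite E1, E2; auto).
  apply (f_equal (fun w => / RtoC (2 * PI) * w)) in E. rewrite !Cmult_assoc, Cinv_l, !Cmult_1_l in E by auto. exact E.
Qed.

(** On the invariant axis [y = 0], [psi1] solves the linear equation of [y1] with [v = psi1 psi2] in
    the nonlinear term. So [psi1] at time [t] is its initial value times [Ec]; along the tilt where
    [Ec] grows exponentially, boundedness forces that value to be 0. Tangency also provides
    [v -> 0], which the growth needs. *)
Lemma axis_zero (psi1 psi2 : C3 -> C) K (Z0 : C) :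
  (forall Z, (R0 < fst Z)%R -> exists A B D A2 B2 D2, partials psi1 (k0 * / Z, (RtoC 0, RtoC 0)) A B D /\
      partials psi2 (k0 * / Z, (RtoC 0, RtoC 0)) A2 B2 D2 /\
      A * ((k0 * / Z) * (k0 * / Z)) =
        (- lam + a1 * (k0 * / Z) - cf (psi1 (k0 * / Z, (RtoC 0, RtoC 0)) * psi2 (k0 * / Z, (RtoC 0, RtoC 0)))) * psi1 (k0 * / Z, (RtoC 0, RtoC 0))) ->
  (forall Z, (R0 < fst Z)%R -> (Cmod (psi1 (k0 * / Z, (RtoC 0, RtoC 0))%C * psi2 (k0 * / Z, (RtoC 0, RtoC 0))%C) < sg)%R) ->
  (forall Z, (R0 < fst Z)%R -> (Cmod (psi1 (k0 * / Z, (RtoC 0, RtoC 0))%C) <= K * (Cmod (k0 * / Z))²)%R /\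
     (Cmod (psi2 (k0 * / Z, (RtoC 0, RtoC 0))%C) <= K * (Cmod (k0 * / Z))²)%R) ->
  (R0 + 1 < fst Z0)%R -> psi1 (k0 * / Z0, (RtoC 0, RtoC 0)) = 0.
Proof.
intros Hpsi Hw HK HZ0.
(* The tilt for which the rate [- (m * q)] of [kap_lam] is positive. *)
set (m := if Rlt_dec q 0 then 1%R else (-1)%R).
assert (hm : (0 < - (m * q))%R).
{ unfold m. assert (q <> 0%R) by auto. destruct (Rlt_dec q 0); lra. }
pose (P := fun t => (xc k0 Z0 m t, (RtoC 0, RtoC 0)) : C3).
pose (v := fun t => psi1 (P t) * psi2 (P t)).
assert (D12 : forall t, (-1 < t)%R -> exists l2, rderiv (fun t => psi2 (P t)) t l2 /\
   rderiv (fun t => psi1 (P t)) t (ec Z0 m v t * psi1 (P t))).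
{ intros t ht. assert (hZ : Zc Z0 m t <> 0) by (apply (Zc_neq0 Z0 m R0); auto).
  destruct (Hpsi (Zc Z0 m t)) as [A [B [D [A2 [B2 [D2 [H1 [H2 H3]]]]]]]]; [apply (Zc_gt Z0 m R0); auto|].
  pose proof (rderiv_xc k0 Z0 m R0 HR0 HZ0 t ht Hk0) as Dx.
  eexists; split.
  - eapply expands_ext; [| |exact (expands_partials _ (fun _ => Rabs_pos _) psi2 (xc k0 Z0 m t, (RtoC 0, RtoC 0)) _ _ _ _ _ _ _ _ _ H2 Dx (rderiv_const 0 t) (rderiv_const 0 t))]; [reflexivity|].
    intros s. cbv beta. instantiate (1 := A2 * (- direction m * / k0 * (xc k0 Z0 m t * xc k0 Z0 m t))). ring.
  - eapply expands_ext; [| |exact (expands_partials _ (fun _ => Rabs_pos _) psi1 (xc k0 Z0 m t, (RtoC 0, RtoC 0)) _ _ _ _ _ _ _ _ _ H1 Dx (rderiv_const 0 t) (rderiv_const 0 t))]; [reflexivity|].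
    intros s. cbv beta. set (S' := RtoC (s - t)).
    transitivity (- direction m * / k0 * S' * (A * (k0 * / Zc Z0 m t * (k0 * / Zc Z0 m t)))); [unfold xc; ring|].
    rewrite H3. unfold ec, v, P, bc, xc. field. auto. }
assert (Hvd : forall t, (-1 < t)%R -> exists l, rderiv v t l).
{ intros t ht. destruct (D12 t ht) as [l2 [X2 X1]]. eexists. apply (rderiv_mult _ _ _ _ _ X1 X2). }
assert (Hv : forall t, (-1 < t)%R -> (Cmod (v t) < sg)%R).
{ intros t ht. apply (Hw (Zc Z0 m t)). apply (Zc_gt Z0 m R0); auto. }
assert (HKp : (0 <= K)%R).
{ destruct (HK Z0 ltac:(lra)) as [X _]. assert (0 <= K * (Cmod (k0 * / Z0))²)%R by (eapply Rle_trans; [apply Cmod_ge_0|exact X]).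
  assert (0 < (Cmod (k0 * / Z0))²)%R.
  { apply Rlt_0_sqr, Rgt_not_eq, Cmod_gt_0. apply Cmult_neq_0; auto.
    assert (Z0 <> 0) by (intros E; rewrite E in HZ0; simpl in HZ0; lra).
    intros E. apply (f_equal (fun w => w * Z0)) in E. rewrite Cinv_l, Cmult_0_l in E by auto. apply (f_equal fst) in E; simpl in E; lra. }
  destruct (Rle_lt_dec 0 K); auto. assert (K * (Cmod (k0 * / Z0))² < 0)%R; [|lra].
  rewrite <- (Rmult_0_l (Cmod (k0 * / Z0))²). apply Rmult_lt_compat_r; auto. }
assert (Small : forall e, (0 < e <= 1)%R -> exists T, (0 <= T)%R /\ forall t, (T <= t)%R ->
   (Cmod (psi1 (P t)) <= K * (e * e))%R /\ (Cmod (psi2 (P t)) <= K * (e * e))%R).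
{ intros e he. destruct (xc_lim k0 Z0 m R0 HR0 HZ0 e ltac:(lra)) as [T [hT HT]]. exists T; split; auto.
  intros t ht. specialize (HT t ht). destruct (HK (Zc Z0 m t)) as [X1 X2]; [apply (Zc_gt Z0 m R0); auto; lra|].
  assert (Y : ((Cmod (xc k0 Z0 m t))² <= e * e)%R) by (apply Rmult_le_compat; auto using Cmod_ge_0).
  apply (Rmult_le_compat_l K) in Y; auto. unfold xc in Y. split; eapply Rle_trans; eauto. }
assert (Hlim : forall e, (0 < e)%R -> exists T, (0 <= T)%R /\ forall t, (T <= t)%R -> (Cmod (v t) <= e)%R).
{ intros e he. set (d := Rmin 1 (e / (1 + K * K))).
  assert (hd : (0 < d <= 1)%R) by (split; [apply Rmin_pos; [lra|apply Rdiv_lt_0_compat; nra]|apply Rmin_l]).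
  assert (hd2 : (d <= e / (1 + K * K))%R) by apply Rmin_r.
  destruct (Small d hd) as [T [hT HT]]. exists T; split; auto. intros t ht. destruct (HT t ht) as [X1 X2].
  unfold v. rewrite Cmod_mult.
  apply Rle_trans with ((K * (d * d)) * (K * (d * d)))%R; [apply Rmult_le_compat; auto using Cmod_ge_0|].
  assert (d * d <= d)%R by nra. assert (0 <= d * d)%R by nra. assert ((d * d) * (d * d) <= d)%R by nra.
  apply (Rmult_le_compat_l (1 + K * K)) in hd2; [|nra].
  replace ((1 + K * K) * (e / (1 + K * K)))%R with e in hd2 by (field; nra). nra. }
destruct (Small 1%R ltac:(lra)) as [T1 [hT1 HT1]].
assert (E0 : P 0%R = (k0 * / Z0, (RtoC 0, RtoC 0))).
{ unfold P, xc, Zc. replace (Z0 + direction m * 0) with Z0 by ring. reflexivity. }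
rewrite <- E0.
assert (KC : forall t, (0 <= t)%R -> psi1 (P 0%R) = psi1 (P t) * / Ec Z0 m v t).
{ intros t ht.
  assert (X : psi1 (P 0%R) * / Ec Z0 m v 0 = psi1 (P t) * / Ec Z0 m v t).
  { apply (rderiv_zero_const (fun s => psi1 (P s) * / Ec Z0 m v s)); auto. intros s hs.
    destruct (D12 s ltac:(lra)) as [_ [_ X1]].
    pose proof (Ec_neq0 Z0 m v s).
    eapply rderiv_eq; [|apply (rderiv_mult _ _ _ _ _ X1 (rderiv_CD (fun w => / w) _ _ _ _ (cderiv_inv _ (Ec_neq0 Z0 m v s)) (rderiv_Ec Z0 m v HZ0 Hvd Hv s ltac:(lra))))].
    cbv beta. field. auto. }
  rewrite <- X, Ec_0. field. }
apply Cmod_0_eq. intros e he.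
pose proof (traj_growth Z0 m v HZ0 Hvd Hv Hlim 1 0) as G.
rewrite Cmult_1_l, (kap_lam m) in G. destruct (G hm (K / e)%R) as [T2 HT2].
set (t := Rmax T1 T2). assert (t1 : (T1 <= t)%R) by apply Rmax_l. assert (t2 : (T2 <= t)%R) by apply Rmax_r.
specialize (HT2 t t2). destruct (HT1 t t1) as [X1 _].
rewrite (KC t ltac:(lra)). rewrite Cmod_mult, Cmod_inv by apply Ec_neq0.
replace (cexp (cint (fun t => 1 * ec Z0 m v t + 0 * bc Z0 m t) 0 t)) with (Ec Z0 m v t) in HT2
  by (unfold Ec; f_equal; apply cint_ext; intros; ring).
assert (hE : (0 < Cmod (Ec Z0 m v t))%R) by (apply Cmod_gt_0, Ec_neq0).
apply (Rmult_le_reg_r (Cmod (Ec Z0 m v t))); auto. rewrite Rmult_assoc, Rinv_l, Rmult_1_r by lra.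
apply (Rmult_le_compat_l e) in HT2; [|lra]. replace (e * (K / e))%R with K in HT2 by (field; lra). lra.
Qed.
End Core.

(** * Isotropies tangent to the identity *)

Lemma partials_mult f g p A B D A' B' D' : partials f p A B D -> partials g p A' B' D' ->
  partials (fun w => f w * g w) p (A * g p + f p * A') (B * g p + f p * B') (D * g p + f p * D').
Proof.
intros Hf Hg. eapply expands_ext; [| |apply (expands_mult _ (dist3_pos p) _ _ _ _ _ _ Hf Hg)]; auto.
intros; simpl; ring.
Qed.

Lemma partials_proj1 (p : C3) : partials (fun w => fst (snd w)) p 0 1 0.
Proof.
split.
- intros e he; exists 1%R; split; [lra|]; intros w _.
  match goal with |- (Cmod ?u <= _)%R => replace u with (RtoC 0) by ring end.
  rewrite Cmod_0. apply Rmult_le_pos; [lra|apply dist3_pos].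
- exists 1%R; split; [lra|]; intros w.
  match goal with |- (Cmod ?u <= _)%R => replace u with (fst (snd w) - fst (snd p)) by ring end.
  unfold dist3. pose proof (Cmod_ge_0 (fst w - fst p)). pose proof (Cmod_ge_0 (snd (snd w) - snd (snd p))). lra.
Qed.

Lemma partials_proj2 (p : C3) : partials (fun w => snd (snd w)) p 0 0 1.
Proof.
split.
- intros e he; exists 1%R; split; [lra|]; intros w _.
  match goal with |- (Cmod ?u <= _)%R => replace u with (RtoC 0) by ring end.
  rewrite Cmod_0. apply Rmult_le_pos; [lra|apply dist3_pos].
- exists 1%R; split; [lra|]; intros w.
  match goal with |- (Cmod ?u <= _)%R => replace u with (snd (snd w) - snd (snd p)) by ring end.
  unfold dist3. pose proof (Cmod_ge_0 (fst w - fst p)). pose proof (Cmod_ge_0 (fst (snd w) - fst (snd p))). lra.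
Qed.

Lemma partials_inv (f : C3 -> C) p A B D : f p <> 0 -> partials f p A B D ->
  partials (fun w => / f w) p (- / (f p * f p) * A) (- / (f p * f p) * B) (- / (f p * f p) * D).
Proof.
intros hf Hf. eapply expands_ext; [| |apply (expands_cderiv _ (dist3_pos p) (fun z => / z) _ _ _ _ (cderiv_inv _ hf) Hf)]; auto.
intros; simpl; ring.
Qed.

Lemma cderiv_yline f (x u1 u2 w1 w2 s A B D : C) : partials f (x, (u1 + s * w1, u2 + s * w2)) A B D ->
  cderiv (fun s => f (x, (u1 + s * w1, u2 + s * w2))) s (B * w1 + D * w2).
Proof.
intros H.
pose proof (expands_const (fun w => Cmod (w - s)) (fun _ => Cmod_ge_0 _) x) as H1.
assert (H2 : forall u w, cderiv (fun s => u + s * w) s (0 + (1 * w + s * 0))).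
{ intros u w. apply cderiv_plus; [apply cderiv_const|]. apply (cderiv_mult (fun s => s) (fun _ => w)); [apply cderiv_id|apply cderiv_const]. }
pose proof (expands_partials _ (fun _ => Cmod_ge_0 _) f _ _ _ _ _ _ _ _ _ _ H H1 (H2 u1 w1) (H2 u2 w2)) as X.
eapply expands_ext; [| |exact X]; [reflexivity|]. intros p; cbv beta; ring.
Qed.

(* [x = k0 / Z]; the last two equations say that [psi] preserves the normal form field. *)
Definition isotropy (lam k0 a1 a2 : C) (cf : C -> C) (sg R0 dl K : R) (psi1 psi2 : C3 -> C) : Prop :=
  forall Z y1 y2 : C, (R0 < fst Z)%R -> (Cmod y1 < dl)%R -> (Cmod y2 < dl)%R ->
  let x := k0 * / Z in let p := (x, (y1, y2)) : C3 in let c := cf (y1 * y2) in let c' := cf (psi1 p * psi2 p) in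
  (Cmod (psi1 p * psi2 p) < sg)%R /\
  (Cmod (psi1 p - y1) <= K * (Cmod x + Cmod y1 + Cmod y2)²)%R /\
  (Cmod (psi2 p - y2) <= K * (Cmod x + Cmod y1 + Cmod y2)²)%R /\
  exists A B D A' B' D', partials psi1 p A B D /\ partials psi2 p A' B' D' /\
  A * (x * x) + B * ((- lam + a1 * x - c) * y1) + D * ((lam + a2 * x + c) * y2) = (- lam + a1 * x - c') * psi1 p /\
  A' * (x * x) + B' * ((- lam + a1 * x - c) * y1) + D' * ((lam + a2 * x + c) * y2) = (lam + a2 * x + c') * psi2 p.

Section Iso.
Variables (lam k0 a1 a2 : C) (q : R) (cf : C -> C) (sg Lc dl K : R).
Hypothesis Hk0 : k0 <> 0.
Hypothesis Hq : q <> 0%R.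
Hypothesis Hlam : lam = (0%R, q) * k0.
Hypothesis Ha : (0 < fst (a1 + a2)%C)%R.
Hypothesis Hcf0 : cf 0 = 0.
Hypothesis HLc : (0 <= Lc)%R.
Hypothesis Hcf : forall v w, (Cmod v < sg)%R -> (Cmod w < sg)%R -> (Cmod (cf v - cf w)%C <= Lc * Cmod (v - w)%C)%R.
Hypothesis Hdl : (0 < dl)%R.
Hypothesis Hsg : (dl * dl <= sg)%R.
Hypothesis HK : (0 <= K)%R.
Variables psi1 psi2 : C3 -> C.

Definition psi_max (R0 : R) : R := (dl + K * (Cmod k0 / R0 + 2 * dl)²)%R.

Lemma re_pos_neq0 (Z : C) R0 : (0 < R0)%R -> (R0 < fst Z)%R -> Z <> 0.
Proof. intros h1 h2 E; rewrite E in h2; simpl in h2; lra. Qed.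

Lemma x_bound (Z : C) R0 : (0 < R0)%R -> (R0 < fst Z)%R -> (Cmod (k0 * / Z) <= Cmod k0 / R0)%R.
Proof.
intros h1 h2. rewrite Cmod_mult, Cmod_inv by (apply (re_pos_neq0 Z R0); auto).
apply Rmult_le_compat_l; [apply Cmod_ge_0|]. apply Rinv_le_contravar; auto. pose proof (fst_le_Cmod Z); lra.
Qed.

Lemma psi_bound R0 : (0 < R0)%R -> isotropy lam k0 a1 a2 cf sg R0 dl K psi1 psi2 ->
  forall Z y1 y2 : C, (R0 < fst Z)%R -> (Cmod y1 < dl)%R -> (Cmod y2 < dl)%R ->
  (Cmod (psi1 ((k0 * / Z)%C, (y1, y2))) <= psi_max R0)%R /\ (Cmod (psi2 ((k0 * / Z)%C, (y1, y2))) <= psi_max R0)%R.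
Proof.
intros hR H Z y1 y2 hZ h1 h2. destruct (H Z y1 y2 hZ h1 h2) as [_ [E1 [E2 _]]]. cbv zeta in E1, E2.
pose proof (x_bound Z R0 hR hZ). pose proof (Cmod_ge_0 (k0 * / Z)). pose proof (Cmod_ge_0 y1). pose proof (Cmod_ge_0 y2).
assert (X : (K * (Cmod (k0 * / Z) + Cmod y1 + Cmod y2)² <= K * (Cmod k0 / R0 + 2 * dl)²)%R).
{ apply Rmult_le_compat_l; auto. apply Rsqr_incr_1; lra. }
pose proof (Cmod_rev (psi1 (k0 * / Z, (y1, y2))) y1). pose proof (Cmod_rev (psi2 (k0 * / Z, (y1, y2))) y2).
unfold psi_max. split; lra.
Qed.

Lemma axis_psi1_zero R0 : (0 < R0)%R -> isotropy lam k0 a1 a2 cf sg R0 dl K psi1 psi2 ->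
  forall Z0, (R0 + 1 < fst Z0)%R -> psi1 (k0 * / Z0, (RtoC 0, RtoC 0)) = 0.
Proof.
intros hR H Z0 hZ0. assert (h0 : (Cmod 0 < dl)%R) by (rewrite Cmod_0; auto).
apply (axis_zero lam k0 a1 q cf sg Lc R0 dl Hk0 Hq Hlam Hcf0 HLc Hcf hR Hdl Hsg psi1 psi2 K); auto.
- intros Z hZ. destruct (H Z 0 0 hZ h0 h0) as [_ [_ [_ [A [B [D [A2 [B2 [D2 [H1 [H2 [H3 _]]]]]]]]]]]]. cbv zeta in H1, H2, H3.
  exists A, B, D, A2, B2, D2. repeat split; try apply H1; try apply H2. rewrite <- H3; ring.
- intros Z hZ. apply (H Z 0 0 hZ h0 h0).
- intros Z hZ. destruct (H Z 0 0 hZ h0 h0) as [_ [E1 [E2 _]]]. cbv zeta in E1, E2.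
  rewrite Cmod_0, !Rplus_0_r in E1, E2.
  replace (psi1 (k0 * / Z, (RtoC 0, RtoC 0)) - 0) with (psi1 (k0 * / Z, (RtoC 0, RtoC 0))) in E1 by ring.
  replace (psi2 (k0 * / Z, (RtoC 0, RtoC 0)) - 0) with (psi2 (k0 * / Z, (RtoC 0, RtoC 0))) in E2 by ring. auto.
Qed.

Definition vratio (p : C3) : C := psi1 p * psi2 p * (/ fst (snd p) * / snd (snd p)).

(** Both [psi1 psi2] and [y1 y2] are multiplied by [(a1 + a2) x] under the field, the terms in [lam]
    and [c] being opposite in the two components; so their quotient is a first integral. *)
Lemma vratio_invariant R0 : isotropy lam k0 a1 a2 cf sg R0 dl K psi1 psi2 -> invariant lam k0 a1 a2 cf R0 dl vratio.
Proof.
intros H Z y1 y2 hZ h1 h2.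
assert (n1 : y1 <> 0) by (apply Cmod_gt_0; lra). assert (n2 : y2 <> 0) by (apply Cmod_gt_0; lra).
destruct (H Z y1 y2 hZ (proj2 h1) (proj2 h2)) as [_ [_ [_ [A [B [D [A2 [B2 [D2 [H1 [H2 [H3 H4]]]]]]]]]]]]. cbv zeta in H1, H2, H3, H4.
set (x := k0 * / Z) in *. set (p := (x, (y1, y2)) : C3) in *.
do 3 eexists. split.
- apply partials_mult; [apply partials_mult; [exact H1|exact H2]|].
  apply partials_mult; [apply (partials_inv (fun w => fst (snd w)) p); [exact n1|apply partials_proj1]|
                  apply (partials_inv (fun w => snd (snd w)) p); [exact n2|apply partials_proj2]].
- cbn [fst snd p]. fold p. set (c := cf (y1 * y2)) in *. set (c' := cf (psi1 p * psi2 p)) in *.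
  set (P1 := psi1 p) in *. set (P2 := psi2 p) in *.
  transitivity (/ y1 * / y2 * (P2 * (A * (x * x) + B * ((- lam + a1 * x - c) * y1) + D * ((lam + a2 * x + c) * y2))
    + P1 * (A2 * (x * x) + B2 * ((- lam + a1 * x - c) * y1) + D2 * ((lam + a2 * x + c) * y2))
    - P1 * P2 * (a1 + a2) * x)).
  + field. auto.
  + rewrite H3, H4. field; auto.
Qed.

Lemma vratio_bound R0 : (0 < R0)%R -> isotropy lam k0 a1 a2 cf sg R0 dl K psi1 psi2 ->
  forall Z y1 y2 : C, (R0 < fst Z)%R -> (0 < Cmod y1 < dl)%R -> (0 < Cmod y2 < dl)%R ->
  (Cmod (vratio ((k0 * / Z)%C, (y1, y2))) <= (psi_max R0 * psi_max R0) / Cmod (y1 * y2))%R.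
Proof.
intros hR H Z y1 y2 hZ h1 h2.
assert (n1 : y1 <> 0) by (apply Cmod_gt_0; lra). assert (n2 : y2 <> 0) by (apply Cmod_gt_0; lra).
destruct (psi_bound R0 hR H Z y1 y2 hZ (proj2 h1) (proj2 h2)) as [B1 B2].
unfold vratio. cbn [fst snd]. rewrite <- Cinv_mul, !Cmod_mult, Cmod_inv, Cmod_mult by (apply Cmult_neq_0; auto).
apply Rmult_le_compat_r.
- apply Rlt_le, Rinv_0_lt_compat, Rmult_lt_0_compat; lra.
- apply Rmult_le_compat; auto using Cmod_ge_0.
Qed.

(** With [y1] and [y2] both of modulus [rho] and [x] no larger, tangency gives errors at most
    [e = 9 K rho^2]. Their relative effect on the product is [(e^2 + 2 e rho) / rho^2], whence the
    constants 81 and 18. *)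
Lemma vratio_near_one R0 : (0 < R0)%R -> isotropy lam k0 a1 a2 cf sg R0 dl K psi1 psi2 ->
  forall (Z z v : C) rho, (R0 < fst Z)%R -> (0 < rho <= 1)%R -> (rho < dl)%R -> (Cmod (k0 * / Z) <= rho)%R ->
  Cmod z = rho -> Cmod v = (rho * rho)%R ->
  (Cmod (vratio ((k0 * / Z)%C, (z, (v * / z)%C)) - 1) <= (18 * K + 81 * K * K) * rho)%R.
Proof.
intros hR H Z z v rho hZ hrho hrd hx hz hv.
assert (n1 : z <> 0) by (apply Cmod_gt_0; lra).
assert (hvz : Cmod (v * / z) = rho) by (rewrite Cmod_mult, Cmod_inv, hz, hv by auto; field; lra).
assert (n2 : v * / z <> 0) by (apply Cmod_gt_0; lra).
destruct (H Z z (v * / z) hZ) as [_ [E1 [E2 _]]]; try lra. cbv zeta in E1, E2.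
rewrite hz, hvz in E1, E2.
assert (X : (K * (Cmod (k0 * / Z) + rho + rho)² <= 9 * K * (rho * rho))%R).
{ replace (9 * K * (rho * rho))%R with (K * (3 * rho)²)%R by (unfold Rsqr; ring).
  apply Rmult_le_compat_l; auto. pose proof (Cmod_ge_0 (k0 * / Z)). apply Rsqr_incr_1; lra. }
unfold vratio. cbn [fst snd]. set (y2 := v * / z) in *. set (P1 := psi1 _) in *. set (P2 := psi2 _) in *.
replace (P1 * P2 * (/ z * / y2) - 1) with (((P1 - z) * (P2 - y2) + (P1 - z) * y2 + z * (P2 - y2)) * (/ z * / y2)) by (field; auto).
rewrite Cmod_mult, Cmod_mult, !Cmod_inv, hz, hvz by auto.
set (e := (9 * K * (rho * rho))%R) in *.
assert (B : (Cmod ((P1 - z) * (P2 - y2) + (P1 - z) * y2 + z * (P2 - y2)) <= e * e + e * rho + rho * e)%R).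
{ eapply Rle_trans; [apply Cmod_triangle|]. rewrite Cmod_mult, hz. apply Rplus_le_compat.
  - eapply Rle_trans; [apply Cmod_triangle|]. rewrite !Cmod_mult, hvz. apply Rplus_le_compat.
    + apply Rmult_le_compat; auto using Cmod_ge_0; lra.
    + apply Rmult_le_compat_r; lra.
  - apply Rmult_le_compat_l; lra. }
apply Rle_trans with ((e * e + e * rho + rho * e) * (/ rho * / rho))%R.
- apply Rmult_le_compat_r; auto. apply Rlt_le, Rmult_lt_0_compat; apply Rinv_0_lt_compat; lra.
- unfold e. replace (_ * (/ rho * / rho))%R with (81 * (K * K) * (rho * rho) + 18 * K * rho)%R by (field; lra).
  assert (K * K * (rho * rho) <= K * K * rho)%R; [|lra]. apply Rmult_le_compat_l; [apply Rmult_le_pos; auto|nra].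
Qed.

(* The Laurent coefficients in [v = y1 y2] of [w / v]: the positive ones are killed by the decay of [v]
   along trajectories, the zeroth one is 1 by tangency, and the negative ones vanish since [w] does on [y = 0]. *)
Lemma vratio_one_near R0 : (0 < R0)%R -> isotropy lam k0 a1 a2 cf sg R0 dl K psi1 psi2 ->
  forall Z0 : C, (R0 + 1 < fst Z0)%R -> exists eta, (0 < eta)%R /\ forall v z : C, v <> 0 -> (Cmod v < eta)%R ->
    (Cmod v / dl < Cmod z < dl)%R -> vratio (k0 * / Z0, (z, v * / z)) = 1.
Proof.
intros hR H Z0 hZ0. assert (pp := PI_RGT_0).
set (M1 := psi_max R0).
pose proof (vratio_invariant R0 H) as Hinv. pose proof (vratio_bound R0 hR H) as Hbd. fold M1 in Hbd.
destruct (first_integral_const lam k0 a1 a2 q cf sg Lc R0 dl Hk0 Hq Hlam Ha Hcf0 HLc Hcf hR Hdl Hsg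
   vratio _ Z0 Hinv Hbd hZ0) as [eta [heta FI]].
exists eta; split; [lra|].
assert (hdd : (0 < dl * dl)%R) by (apply Rmult_lt_0_compat; auto).
set (a := a1 + a2) in *.
set (vf := vfactor Z0 1 a) in *.
assert (hvf : forall t, vf t <> 0) by (intros; apply cexp_neq0).
destruct (vfactor_decay Z0 1 R0 hR hZ0 a Ha) as [_ Hdec]. fold vf in Hdec.
pose (g := fun v => vratio (k0 * / Z0, (RtoC (dl / 2), v * / RtoC (dl / 2)))).
pose (h := fun t (rho : R) v => vratio (xc k0 Z0 1 t, (RtoC rho, v * / RtoC rho))).
assert (Ch : forall t rho, (0 <= t)%R -> (0 < rho < dl)%R -> holomorphic_annulus (h t rho) 0 (dl * rho)).
{ intros t rho ht hr w hw.
  destruct (Hinv (Zc Z0 1 t) (RtoC rho) (w * / RtoC rho)) as [A [B [D [HD _]]]].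
  - apply (Zc_gt Z0 1 R0); auto; lra.
  - rewrite Cmod_pos_real; lra.
  - assert (RtoC rho <> 0) by (apply Cmod_gt_0; rewrite Cmod_pos_real; lra).
    rewrite Cmod_mult, Cmod_inv, Cmod_pos_real by (auto; lra). split.
    + apply Rmult_lt_0_compat; [lra|apply Rinv_0_lt_compat; lra].
    + apply (Rmult_lt_reg_r rho); [lra|]. rewrite Rmult_assoc, Rinv_l by lra. lra.
  - exists (B * 0 + D * / RtoC rho). unfold h.
    apply (cderiv_ext (fun s => vratio (xc k0 Z0 1 t, (RtoC rho + s * 0, 0 + s * / RtoC rho)))).
    + intros s. do 3 f_equal; ring.
    + apply cderiv_yline with (A := A). unfold xc.
      replace (RtoC rho + w * 0) with (RtoC rho) by ring. replace (0 + w * / RtoC rho) with (w * / RtoC rho) by ring. exact HD. }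
assert (Cg : holomorphic_annulus g 0 eta).
{ intros w hw. destruct (Ch 0%R (dl / 2)%R (Rle_refl _) ltac:(lra) w) as [l Hl].
  { split; [lra|]. replace (dl * (dl / 2))%R with (dl * dl / 2)%R by field. lra. }
  exists l. revert Hl. unfold h, xc, Zc. replace (Z0 + direction 1 * 0) with Z0 by ring. auto. }
assert (gz : forall v z : C, v <> 0 -> (Cmod v < eta)%R -> (Cmod v / dl < Cmod z < dl)%R -> g v = vratio (k0 * / Z0, (z, v * / z))).
{ intros v z hv hve hz. pose proof (FI v 0%R (RtoC (dl / 2)) z hv hve (Rle_refl _)) as E1.
  unfold vf in E1. rewrite vfactor_0 in E1. unfold xc, Zc in E1.
  replace (Z0 + direction 1 * 0) with Z0 in E1 by ring. rewrite Cmult_1_r in E1. unfold g. symmetry. apply E1; auto.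
  rewrite Cmod_pos_real by lra. split; [|lra]. apply (Rmult_lt_reg_r dl); auto. unfold Rdiv at 1. rewrite Rmult_assoc, Rinv_l by lra. lra. }
assert (gh : forall (v : C) t rho, v <> 0 -> (Cmod v < eta)%R -> (0 <= t)%R -> (0 < rho < dl)%R -> (Cmod (v * vf t) < dl * rho)%R ->
   g v = h t rho (v * vf t)).
{ intros v t rho hv hve ht hr hvr. unfold h, g. symmetry. apply FI; auto.
  - rewrite Cmod_pos_real by lra. split; [|lra]. apply (Rmult_lt_reg_r dl); auto. unfold Rdiv at 1. rewrite Rmult_assoc, Rinv_l by lra. lra.
  - rewrite (Cmod_pos_real rho) by lra. split; [|lra].
    apply (Rmult_lt_reg_r dl); auto. unfold Rdiv at 1. rewrite Rmult_assoc, Rinv_l by lra. lra. }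
set (s := (eta / 2)%R). assert (hs : (0 < s < eta)%R) by (unfold s; lra).
assert (hsC : Cmod (RtoC s) = s) by (apply Cmod_pos_real; lra).
(* As [g v = h t rho (v * vf t)], a circle in [v] at time 0 is dilated by [vf t]; it is then moved
   to radius [rho * rho], where [Cmod y1 = Cmod y2 = rho]. *)
assert (TR : forall p : C -> C, (forall z w, p (z * w) = p z * p w) -> p 1 = 1 -> (forall z : C, z <> 0 -> exists l, cderiv p z l) ->
   forall t rho, (0 <= t)%R -> (0 < rho < dl)%R -> (s * Cmod (vf t) < dl * rho)%R ->
   circle_int (fun v => g v * p v) s = p (/ vf t) * circle_int (fun v => h t rho v * p v) (RtoC (rho * rho))).
{ intros p pm p1 pd t rho ht hr hsr.
  assert (HH : holomorphic_annulus (fun v => h t rho v * p v) 0 (dl * rho)).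
  { intros w hw. destruct (Ch t rho ht hr w hw) as [l1 H1]. destruct (pd w) as [l2 H2]; [apply Cmod_gt_0; lra|].
    eexists; apply cderiv_mult; eauto. }
  assert (hsv : Cmod (RtoC s * vf t) = (s * Cmod (vf t))%R) by (rewrite Cmod_mult, hsC; auto).
  assert (hpos : (0 < Cmod (vf t))%R) by (apply Cmod_gt_0; auto).
  assert (hsp : (0 < s * Cmod (vf t))%R) by (apply Rmult_lt_0_compat; lra).
  rewrite (circle_int_indep _ 0 (dl * rho) (RtoC (rho * rho)) (RtoC s * vf t) HH (Rle_refl _)).
  - unfold circle_int.
    assert (X : ex_cint (fun u => h t rho (RtoC s * vf t * cis u) * p (RtoC s * vf t * cis u)) 0 (2 * PI)).
    { apply ex_cint_cont; intros. apply (ccont_circle (fun v => h t rho v * p v)). intros w hw. apply HH. rewrite hw, hsv. lra. }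
    rewrite <- (cint_scal _ _ _ _ X). apply cint_ext. intros u _.
    rewrite (gh (RtoC s * cis u) t rho); auto.
    + replace (RtoC s * vf t * cis u) with (RtoC s * cis u * vf t) by ring.
      replace (p (RtoC s * cis u)) with (p (/ vf t) * p (RtoC s * cis u * vf t)); [ring|].
      rewrite <- pm. f_equal. field. auto.
    + apply Cmult_neq_0; [apply Cmod_gt_0; lra|apply cis_neq0].
    + rewrite Cmod_mult, Cmod_cis, hsC; lra.
    + replace (RtoC s * cis u * vf t) with (RtoC s * vf t * cis u) by ring. rewrite Cmod_mult, Cmod_cis, hsv; lra.
  - rewrite Cmod_pos_real by (apply Rmult_le_pos; lra). split; [apply Rmult_lt_0_compat; lra|apply Rmult_lt_compat_r; lra].
  - rewrite hsv; lra. }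
assert (hM1 : (0 <= M1)%R).
{ unfold M1, psi_max. apply Rplus_le_le_0_compat; [lra|]. apply Rmult_le_pos; auto. apply Rle_0_sqr. }
assert (hbound : forall t rho v, (0 <= t)%R -> (0 < rho < dl)%R -> (0 < Cmod v < dl * rho)%R -> (Cmod (h t rho v) <= M1 * M1 / Cmod v)%R).
{ intros t rho v ht hr hv. assert (hrn : RtoC rho <> 0) by (apply Cmod_gt_0; rewrite Cmod_pos_real; lra).
  unfold h, xc. eapply Rle_trans; [apply Hbd|].
  - apply (Zc_gt Z0 1 R0); auto; lra.
  - rewrite Cmod_pos_real; lra.
  - rewrite Cmod_mult, Cmod_inv, Cmod_pos_real by (auto; lra). split.
    + apply Rmult_lt_0_compat; [lra|apply Rinv_0_lt_compat; lra].
    + apply (Rmult_lt_reg_r rho); [lra|]. rewrite Rmult_assoc, Rinv_l by lra. lra.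
  - right. f_equal. f_equal. field. auto. }
(* Negative powers of [v] extract the coefficients of positive index. Transport multiplies them by a
   power of [vf t], which tends to 0, while the integral at time [t] stays bounded by [W]. *)
assert (Pneg : forall k, (1 <= k)%nat -> circle_int (fun v => g v * (/ v) ^ k) s = 0).
{ intros k hk. apply Cmod_0_eq. intros e he.
  set (rho := (dl / 2)%R). assert (hr : (0 < rho < dl)%R) by (unfold rho; lra).
  assert (hrr : (0 < rho * rho)%R) by (apply Rmult_lt_0_compat; lra).
  set (W := (4 * PI * (M1 * M1 / (rho * rho) * (/ (rho * rho)) ^ k))%R).
  assert (hW : (0 <= W)%R).
  { unfold W. apply Rmult_le_pos; [lra|]. apply Rmult_le_pos; [apply Rmult_le_pos; [apply Rmult_le_pos; auto|]|apply pow_le]; apply Rlt_le, Rinv_0_lt_compat; auto. }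
  set (d := Rmin 1 (Rmin (e / (1 + W)) (rho * dl / (2 * s)))).
  assert (hd : (0 < d)%R).
  { repeat apply Rmin_pos; [lra|apply Rdiv_lt_0_compat; lra|apply Rdiv_lt_0_compat; [apply Rmult_lt_0_compat|]; lra]. }
  assert (hd1 : (d <= 1)%R) by apply Rmin_l.
  assert (hd2 : (d <= e / (1 + W))%R) by (eapply Rle_trans; [apply Rmin_r|apply Rmin_l]).
  assert (hd3 : (d <= rho * dl / (2 * s))%R) by (eapply Rle_trans; [apply Rmin_r|apply Rmin_r]).
  destruct (Hdec d hd) as [t [ht Ht]]. specialize (Ht t (Rle_refl _)).
  rewrite (TR (fun v => (/ v) ^ k)) with (t := t) (rho := rho); auto.
  - rewrite Cmod_mult, Cmod_pow. replace (/ / vf t) with (vf t) by (field; auto).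
    apply Rle_trans with (d * W)%R.
    + apply Rmult_le_compat; [apply pow_le, Cmod_ge_0|apply Cmod_ge_0| |].
      * destruct k as [|k]; [lia|]. simpl. rewrite <- (Rmult_1_r d). apply Rmult_le_compat; auto using Cmod_ge_0.
        { apply pow_le, Cmod_ge_0. }
        rewrite <- (pow1 k). apply pow_incr. split; [apply Cmod_ge_0|lra].
      * unfold W. apply circle_int_bound.
        { intros w hw. rewrite Cmod_pos_real in hw by lra. destruct (Ch t rho ht hr w) as [l1 H1].
          { rewrite hw. split; auto. apply Rmult_lt_compat_r; lra. }
          assert (hw0 : w <> 0) by (apply Cmod_gt_0; lra).
          destruct (cderiv_pow k (/ w)) as [l2 H2].
          eexists. apply cderiv_mult; [exact H1|]. apply (cderiv_comp (fun w => w ^ k) (fun w => / w) w l2 _ H2 (cderiv_inv w hw0)). }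
        { intros w hw. rewrite Cmod_pos_real in hw by lra. assert (hw0 : w <> 0) by (apply Cmod_gt_0; lra).
          rewrite Cmod_mult, Cmod_pow, Cmod_inv, hw by auto. apply Rmult_le_compat_r; [apply pow_le, Rlt_le, Rinv_0_lt_compat; auto|].
          rewrite <- hw. apply hbound; auto. rewrite hw; split; auto. apply Rmult_lt_compat_r; lra. }
    + apply (Rmult_le_compat_r (1 + W)) in hd2; [|lra]. replace (e / (1 + W) * (1 + W))%R with e in hd2 by (field; lra). lra.
  - intros z w. rewrite Cinv_mul, Cpow_mult_l; auto.
  - replace (/ 1) with (RtoC 1) by field. apply Cpow_1_l.
  - intros z hz. destruct (cderiv_pow k (/ z)) as [l Hl].
    eexists. apply (cderiv_comp (fun w => w ^ k) (fun w => / w) z l _ Hl (cderiv_inv z hz)).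
  - apply Rle_lt_trans with (s * (rho * dl / (2 * s)))%R; [apply Rmult_le_compat_l; lra|].
    replace (s * (rho * dl / (2 * s)))%R with (rho * dl / 2)%R by (field; lra).
    assert (0 < rho * dl)%R by (apply Rmult_lt_0_compat; lra). lra. }
(* Here time is fixed and the circle shrinks to radius [r * r], with [Cmod y1 = Cmod y2 = r]. Near
   the axis [psi1] is at most [ee] and [psi2] at most [M1]; the factor [v^k], [k >= 1], pays for the
   division by [v]. *)
assert (Ppos : forall k, (1 <= k)%nat -> circle_int (fun v => g v * v ^ k) s = 0).
{ intros k hk. apply Cmod_0_eq. intros e he.
  assert (HgK : holomorphic_annulus (fun v => g v * v ^ k) 0 eta).
  { intros w hw. destruct (Cg w hw) as [l1 H1]. destruct (cderiv_pow k w) as [l2 H2]. eexists; apply cderiv_mult; eauto. }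
  destruct (H Z0 0 0 ltac:(lra) ltac:(rewrite Cmod_0; auto) ltac:(rewrite Cmod_0; auto)) as [_ [_ [_ [A [B [D [_ [_ [_ [HD _]]]]]]]]]].
  cbv zeta in HD.
  set (ee := (e / (4 * PI * (1 + M1)))%R). assert (hee : (0 < ee)%R).
  { apply Rdiv_lt_0_compat; auto. apply Rmult_lt_0_compat; lra. }
  destruct (expands_cont _ _ _ _ HD ee hee) as [d [hd Hd]].
  rewrite (axis_psi1_zero R0 hR H Z0 hZ0) in Hd.
  set (r := Rmin (Rmin (d / 3) (dl / 2)) (Rmin 1 (s / 2))).
  assert (hr : (0 < r)%R) by (repeat apply Rmin_pos; lra).
  assert (r1 : (r <= d / 3)%R) by (eapply Rle_trans; [apply Rmin_l|apply Rmin_l]).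
  assert (r2 : (r <= dl / 2)%R) by (eapply Rle_trans; [apply Rmin_l|apply Rmin_r]).
  assert (r3 : (r <= 1)%R) by (eapply Rle_trans; [apply Rmin_r|apply Rmin_l]).
  assert (r4 : (r <= s / 2)%R) by (eapply Rle_trans; [apply Rmin_r|apply Rmin_r]).
  assert (hrr : (0 < r * r <= r)%R) by nra.
  assert (hrrC : Cmod (RtoC (r * r)) = (r * r)%R) by (apply Cmod_pos_real; lra).
  rewrite (circle_int_indep _ 0 eta (RtoC s) (RtoC (r * r)) HgK (Rle_refl _)); [|rewrite hsC; lra|rewrite hrrC; lra].
  apply Rle_trans with (4 * PI * (ee * M1))%R.
  - apply circle_int_bound.
    + intros w hw. apply HgK. rewrite hw, hrrC; lra.
    + intros w hw. rewrite hrrC in hw. assert (hw0 : w <> 0) by (apply Cmod_gt_0; lra).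
      assert (hrC : Cmod (RtoC r) = r) by (apply Cmod_pos_real; lra).
      assert (hrn : RtoC r <> 0) by (apply Cmod_gt_0; lra).
      assert (hwr : Cmod (w * / RtoC r) = r) by (rewrite Cmod_mult, Cmod_inv, hw, hrC by auto; field; lra).
      rewrite (gz w (RtoC r)); auto; try lra.
      2:{ rewrite hw, hrC. split; [|lra]. apply (Rmult_lt_reg_r dl); auto. unfold Rdiv. rewrite Rmult_assoc, Rinv_l by lra. nra. }
      unfold vratio. cbn [fst snd]. rewrite Cmod_mult, Cmod_pow, hw.
      set (P1 := psi1 _). set (P2 := psi2 _).
      assert (B1 : (Cmod P1 <= ee)%R).
      { specialize (Hd (k0 * / Z0, (RtoC r, w * / RtoC r))). replace P1 with (P1 - 0) by ring. apply Hd.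
        unfold dist3; cbn [fst snd]. replace (k0 * / Z0 - k0 * / Z0) with (RtoC 0) by ring.
        replace (RtoC r - 0) with (RtoC r) by ring. replace (w * / RtoC r - 0) with (w * / RtoC r) by ring.
        rewrite Cmod_0, hrC, hwr. lra. }
      assert (B2 : (Cmod P2 <= M1)%R) by (apply (psi_bound R0 hR H); lra).
      rewrite <- Cinv_mul, Cmod_mult, Cmod_inv by (apply Cmult_neq_0; auto; apply Cmult_neq_0; auto; apply Cmod_gt_0; rewrite Cmod_inv by auto; apply Rinv_0_lt_compat; lra).
      replace (RtoC r * (w * / RtoC r)) with w by (field; auto). rewrite hw, Cmod_mult.
      assert (B3 : ((r * r) ^ k <= r * r)%R).
      { destruct k as [|k]; [lia|]. simpl. rewrite <- (Rmult_1_r (r * r)) at 3. apply Rmult_le_compat_l; [lra|].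
        rewrite <- (pow1 k). apply pow_incr; lra. }
      apply Rle_trans with (ee * M1 * / (r * r) * (r * r))%R; [|right; field; lra].
      apply Rmult_le_compat; auto; [|apply pow_le; lra|].
      * apply Rmult_le_pos; [apply Rmult_le_pos; apply Cmod_ge_0|apply Rlt_le, Rinv_0_lt_compat; lra].
      * apply Rmult_le_compat_r; [apply Rlt_le, Rinv_0_lt_compat; lra|]. apply Rmult_le_compat; auto using Cmod_ge_0.
  - unfold ee. apply (Rmult_le_reg_r (1 + M1)); [lra|].
    replace (4 * PI * (e / (4 * PI * (1 + M1)) * M1) * (1 + M1))%R with (e * M1)%R by (field; lra).
    apply Rmult_le_compat_l; lra. }
(* The constant coefficient is unchanged by transport, so it is computed at a late time when [x] is
   at most [rho]; there the ratio is 1 up to [O(rho)], and [rho] is arbitrary. *)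
assert (Pzero : circle_int g s = RtoC (2 * PI)).
{ assert (E0 : circle_int g s - RtoC (2 * PI) = 0); [|replace (circle_int g s) with ((circle_int g s - RtoC (2 * PI)) + RtoC (2 * PI)) by ring; rewrite E0; ring].
  apply Cmod_0_eq. intros e he.
  set (CK := (18 * K + 81 * K * K)%R). assert (hCK : (0 <= CK)%R) by (unfold CK; nra).
  set (rho := Rmin (Rmin 1 (dl / 2)) (e / (4 * PI * (1 + CK)))).
  assert (h4 : (0 < 4 * PI * (1 + CK))%R) by (apply Rmult_lt_0_compat; lra).
  assert (hr0 : (0 < rho)%R) by (repeat apply Rmin_pos; try lra; apply Rdiv_lt_0_compat; auto).
  assert (r1 : (rho <= 1)%R) by (eapply Rle_trans; [apply Rmin_l|apply Rmin_l]).
  assert (r2 : (rho <= dl / 2)%R) by (eapply Rle_trans; [apply Rmin_l|apply Rmin_r]).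
  assert (r3 : (rho <= e / (4 * PI * (1 + CK)))%R) by apply Rmin_r.
  assert (hrr : (0 < rho * rho)%R) by (apply Rmult_lt_0_compat; lra).
  assert (hrrC : Cmod (RtoC (rho * rho)) = (rho * rho)%R) by (apply Cmod_pos_real; lra).
  destruct (Hdec (rho * dl / (2 * s))%R) as [T1 [hT1 HT1]].
  { apply Rdiv_lt_0_compat; [apply Rmult_lt_0_compat|]; lra. }
  destruct (xc_lim k0 Z0 1 R0 hR hZ0 rho hr0) as [T2 [hT2 HT2]].
  set (t := Rmax T1 T2). assert (t1 : (T1 <= t)%R) by apply Rmax_l. assert (t2 : (T2 <= t)%R) by apply Rmax_r.
  specialize (HT1 t t1). specialize (HT2 t t2).
  assert (EJ : circle_int g s = circle_int (h t rho) (RtoC (rho * rho))).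
  { transitivity (circle_int (fun v => g v * 1) s); [unfold circle_int; apply cint_ext; intros; ring|].
    rewrite (TR (fun _ => 1)) with (t := t) (rho := rho); try (intros; ring); try lra.
    - rewrite Cmult_1_l. unfold circle_int; apply cint_ext; intros; ring.
    - intros; eexists; apply cderiv_const.
    - apply Rle_lt_trans with (s * (rho * dl / (2 * s)))%R; [apply Rmult_le_compat_l; lra|].
      replace (s * (rho * dl / (2 * s)))%R with (rho * dl / 2)%R by (field; lra).
      assert (0 < rho * dl)%R by (apply Rmult_lt_0_compat; lra). lra. }
  assert (Hhc : forall w, Cmod w = Cmod (RtoC (rho * rho)) -> exists l, cderiv (fun v => h t rho v + - 1) w l).
  { intros w hw. destruct (Ch t rho ltac:(lra) ltac:(lra) w) as [l Hl].
    - rewrite hw, hrrC. split; auto. apply Rmult_lt_compat_r; lra.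
    - eexists. apply cderiv_plus; [exact Hl|apply cderiv_const]. }
  replace (circle_int g s - RtoC (2 * PI)) with (circle_int (fun v => h t rho v + - 1) (RtoC (rho * rho))).
  - apply Rle_trans with (4 * PI * (CK * rho))%R.
    + apply circle_int_bound; auto. intros w hw. rewrite hrrC in hw.
      replace (h t rho w + - 1) with (h t rho w - 1) by ring.
      apply (vratio_near_one R0 hR H (Zc Z0 1 t) (RtoC rho) w rho); auto; try lra.
      * apply (Zc_gt Z0 1 R0); auto; lra.
      * apply Cmod_pos_real; lra.
    + apply (Rmult_le_compat_l (4 * PI * (1 + CK))) in r3; [|lra].
      replace (4 * PI * (1 + CK) * (e / (4 * PI * (1 + CK))))%R with e in r3 by (field; lra).
      assert (4 * PI * (1 + CK) * rho - 4 * PI * (CK * rho) = 4 * PI * rho)%R by ring.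
      assert (0 < 4 * PI * rho)%R by (apply Rmult_lt_0_compat; lra). lra.
  - rewrite EJ. unfold circle_int. rewrite cint_plus, cint_const, Rminus_0_r; [ring| |].
    + apply ex_cint_cont; intros. apply (ccont_circle (h t rho)). intros w hw. apply Ch; try lra. rewrite hw, hrrC. split; auto. apply Rmult_lt_compat_r; lra.
    + apply ex_cint_cont; intros; apply ccont_const. }
intros v z hv hve hz. rewrite <- (gz v z) by auto.
assert (hvp : (0 < Cmod v)%R) by (apply Cmod_gt_0; auto).
assert (E : circle_int g v = RtoC (2 * PI) * g v).
{ apply circle_value; auto.
  - intros w hw. apply Cg. rewrite hw; lra.
  - intros k hk. transitivity (circle_int (fun z => g z * z ^ k) (RtoC s)); [|exact (Ppos k hk)]. apply (circle_int_indep _ 0 eta); [|lra|lra|].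
    + intros w hw. destruct (Cg w hw) as [l1 H1]. destruct (cderiv_pow k w) as [l2 H2]. eexists; apply cderiv_mult; eauto.
    + rewrite hsC; lra.
  - intros k hk. transitivity (circle_int (fun z => g z * (/ z) ^ k) (RtoC s)); [|exact (Pneg k hk)]. apply (circle_int_indep _ 0 eta); [|lra|lra|].
    + intros w hw. destruct (Cg w hw) as [l1 H1]. assert (hw0 : w <> 0) by (apply Cmod_gt_0; lra). destruct (cderiv_pow k (/ w)) as [l2 H2].
      eexists; apply cderiv_mult; [exact H1|]. apply (cderiv_comp (fun w => w ^ k) (fun w => / w) w l2 _ H2 (cderiv_inv w hw0)).
    + rewrite hsC; lra. }
rewrite (circle_int_indep g 0 eta v (RtoC s)), Pzero in E; auto; try lra.
assert (h2 : RtoC (2 * PI) <> 0) by (apply Cmod_gt_0; rewrite Cmod_pos_real; lra).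
apply (f_equal (fun w => / RtoC (2 * PI) * w)) in E. rewrite Cmult_assoc, Cinv_l, Cmult_1_l in E by auto. auto.
Qed.

(** Identity theorem along the complex line through 0 and [(y1, y2)]: what is known for small [y]
    extends to the whole polydisc. *)
Lemma line_identity (F : C -> C) (y1 y2 : C) (d : R) : (0 < d)%R -> (Cmod y1 < dl)%R -> (Cmod y2 < dl)%R ->
  (forall s : C, (Cmod (s * y1) < dl)%R -> (Cmod (s * y2) < dl)%R -> exists l, cderiv F s l) ->
  (forall s : C, (Cmod s < d)%R -> F s = 0) -> F 1 = 0.
Proof.
intros hd h1 h2 HF H0.
set (m := Rmax (Cmod y1) (Cmod y2)).
assert (m1 : (Cmod y1 <= m)%R) by apply Rmax_l. assert (m2 : (Cmod y2 <= m)%R) by apply Rmax_r.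
assert (hm : (m < dl)%R) by (apply Rmax_lub_lt; auto).
assert (hm0 : (0 <= m)%R) by (eapply Rle_trans; [apply Cmod_ge_0|exact m1]).
(* A number strictly between [m] and [dl] is positive even if [m = 0], and the disc of radius
   [dl / n > 1] contains the parameter 1. *)
set (n := ((m + dl) / 2)%R). assert (hn : (m < n < dl)%R) by (unfold n; lra).
apply (disc_identity F 0 (dl / n) d hd).
- intros s hs. replace (s - 0) with s in hs by ring.
  assert (X : forall y, (Cmod y <= m)%R -> (Cmod (s * y) < dl)%R).
  { intros y hy. rewrite Cmod_mult. apply Rle_lt_trans with (Cmod s * n)%R; [apply Rmult_le_compat_l; [apply Cmod_ge_0|lra]|].
    apply (Rmult_lt_compat_r n) in hs; [|lra]. replace (dl / n * n)%R with dl in hs by (field; lra). auto. }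
  apply HF; apply X; auto.
- intros s hs. apply H0. replace s with (s - 0) by ring; auto.
- replace (1 - 0) with (RtoC 1) by ring. rewrite Cmod_1.
  apply (Rmult_lt_reg_r n); [lra|]. unfold Rdiv; rewrite Rmult_assoc, Rinv_l; lra.
Qed.

Lemma isotropy_partials R0 : isotropy lam k0 a1 a2 cf sg R0 dl K psi1 psi2 -> forall Z0 y1 y2 : C, (R0 < fst Z0)%R ->
  (Cmod y1 < dl)%R -> (Cmod y2 < dl)%R ->
  (exists A B D, partials psi1 (k0 * / Z0, (y1, y2)) A B D) /\ (exists A B D, partials psi2 (k0 * / Z0, (y1, y2)) A B D).
Proof.
intros H Z0 y1 y2 hZ h1 h2. destruct (H Z0 y1 y2 hZ h1 h2) as [_ [_ [_ [A [B [D [A2 [B2 [D2 [H1 [H2 _]]]]]]]]]]].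
cbv zeta in H1, H2. split; [exists A, B, D; exact H1|exists A2, B2, D2; exact H2].
Qed.

Lemma cderiv_ray f (x y1 y2 s A B D : C) : partials f (x, (s * y1, s * y2)) A B D ->
  cderiv (fun s => f (x, (s * y1, s * y2))) s (B * y1 + D * y2).
Proof.
intros H. apply (cderiv_ext (fun s => f (x, (0 + s * y1, 0 + s * y2)))).
- intros; do 3 f_equal; ring.
- apply cderiv_yline with (A := A). rewrite !Cplus_0_l. exact H.
Qed.

Lemma small_param (eta : R) (y1 y2 s : C) : (0 < eta)%R -> (Cmod y1 < dl)%R -> (Cmod y2 < dl)%R -> y1 <> 0 -> y2 <> 0 -> s <> 0 ->
  (Cmod s < Rmin 1 (eta / (dl * dl)))%R ->
  let v := (s * y1) * (s * y2) in
  v <> 0 /\ (Cmod v < eta)%R /\ (Cmod v / dl < Cmod (s * y1) < dl)%R /\ s * y2 = v * / (s * y1).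
Proof.
intros he h1 h2 n1 n2 ns hs v. apply Rmin_Rgt in hs; destruct hs as [s1 s2].
assert (c1 := proj1 (Cmod_gt_0 _) n1). assert (c2 := proj1 (Cmod_gt_0 _) n2). assert (cs := proj1 (Cmod_gt_0 _) ns).
assert (hdd : (0 < dl * dl)%R) by (apply Rmult_lt_0_compat; auto).
repeat split.
- unfold v; repeat apply Cmult_neq_0; auto.
- unfold v. rewrite !Cmod_mult.
  apply (Rmult_lt_compat_r (dl * dl)) in s2; auto. replace (eta / (dl * dl) * (dl * dl))%R with eta in s2 by (field; lra).
  assert (Cmod s * Cmod s <= Cmod s)%R by nra. assert (Cmod y1 * Cmod y2 <= dl * dl)%R by nra.
  assert (Cmod s * Cmod s * (Cmod y1 * Cmod y2) <= Cmod s * (dl * dl))%R by (apply Rmult_le_compat; nra). nra.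
- unfold v. rewrite Cmod_mult. assert (hh : (0 < Cmod (s * y1))%R) by (apply Cmod_gt_0, Cmult_neq_0; auto).
  unfold Rdiv. rewrite Rmult_assoc. rewrite <- (Rmult_1_r (Cmod (s * y1))) at 2. apply Rmult_lt_compat_l; auto.
  apply (Rmult_lt_reg_r dl); auto. rewrite Rmult_assoc, Rinv_l, Rmult_1_r, Rmult_1_l by lra. rewrite Cmod_mult. nra.
- rewrite Cmod_mult; nra.
- unfold v. field; auto.
Qed.

(** On the line [s -> (s y1, s y2)] both products are holomorphic in [s]. They agree for small [s]
    by [vratio_one_near], where [v = s^2 y1 y2] is small, and at [s = 0] by the vanishing of [psi1]
    on the axis. *)
Lemma product_eq R0 : (0 < R0)%R -> isotropy lam k0 a1 a2 cf sg R0 dl K psi1 psi2 ->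
  forall Z0 y1 y2 : C, (R0 + 1 < fst Z0)%R -> (Cmod y1 < dl)%R -> (Cmod y2 < dl)%R -> y1 <> 0 -> y2 <> 0 ->
  psi1 (k0 * / Z0, (y1, y2)) * psi2 (k0 * / Z0, (y1, y2)) = y1 * y2.
Proof.
intros hR H Z0 y1 y2 hZ h1 h2 n1 n2.
destruct (vratio_one_near R0 hR H Z0 hZ) as [eta [heta He]].
pose (F := fun s => psi1 (k0 * / Z0, (s * y1, s * y2)) * psi2 (k0 * / Z0, (s * y1, s * y2)) + - (s * s) * (y1 * y2)).
assert (E : F 1 = 0).
{ apply (line_identity F y1 y2 (Rmin 1 (eta / (dl * dl)))); auto.
  - apply Rmin_pos; [lra|apply Rdiv_lt_0_compat; auto]. apply Rmult_lt_0_compat; auto.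
  - intros s hs1 hs2. destruct (isotropy_partials R0 H Z0 (s * y1) (s * y2) ltac:(lra) hs1 hs2) as [[A [B [D HD]]] [A2 [B2 [D2 HD2]]]].
    exists ((B * y1 + D * y2) * psi2 (k0 * / Z0, (s * y1, s * y2)) + psi1 (k0 * / Z0, (s * y1, s * y2)) * (B2 * y1 + D2 * y2)
       + (((0 * s + (-1) * 1) * s + (-1 * s) * 1) * (y1 * y2) + (- 1 * s * s) * 0)).
    unfold F. apply cderiv_plus.
    + apply (cderiv_mult (fun s => psi1 (k0 * / Z0, (s * y1, s * y2)))); eapply cderiv_ray; eauto.
    + apply (cderiv_ext (fun s => (-1 * s * s) * (y1 * y2))); [intros; ring|].
      apply (cderiv_mult (fun s => -1 * s * s) (fun _ => y1 * y2)); [|apply cderiv_const].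
      apply (cderiv_mult (fun s => -1 * s) (fun s => s)); [|apply cderiv_id].
      apply (cderiv_mult (fun _ => -1) (fun s => s)); [apply cderiv_const|apply cderiv_id].
  - intros s hs. destruct (Ceq_dec s 0) as [->|ns].
    + unfold F. rewrite !Cmult_0_l. rewrite (axis_psi1_zero R0 hR H Z0 hZ). ring.
    + destruct (small_param eta y1 y2 s heta h1 h2 n1 n2 ns hs) as [v0 [v1 [v2 v3]]].
      specialize (He _ _ v0 v1 v2). rewrite <- v3 in He. unfold vratio in He. cbn [fst snd] in He.
      unfold F. set (P1 := psi1 _) in *. set (P2 := psi2 _) in *.
      assert (s * y1 <> 0) by (apply Cmult_neq_0; auto). assert (s * y2 <> 0) by (apply Cmult_neq_0; auto).
      replace (P1 * P2) with ((P1 * P2 * (/ (s * y1) * / (s * y2))) * ((s * y1) * (s * y2))) by (field; auto).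
      rewrite He. ring. }
unfold F in E. rewrite !Cmult_1_l in E.
set (P1 := psi1 _) in *. set (P2 := psi2 _) in *.
replace (P1 * P2) with ((P1 * P2 + - (1) * (y1 * y2)) + y1 * y2) by ring. rewrite E; ring.
Qed.

Definition y1ratio (p : C3) : C := psi1 p * / fst (snd p).

(** Once the products agree, [c(psi1 psi2)] is [c(y1 y2)], and [psi1] and [y1] solve the same linear
    equation. The shift to [R0 + 1] is where the equality of products is available. *)
Lemma y1ratio_invariant R0 : (0 < R0)%R -> isotropy lam k0 a1 a2 cf sg R0 dl K psi1 psi2 -> invariant lam k0 a1 a2 cf (R0 + 1) dl y1ratio.
Proof.
intros hR H Z y1 y2 hZ h1 h2.
assert (n1 : y1 <> 0) by (apply Cmod_gt_0; lra). assert (n2 : y2 <> 0) by (apply Cmod_gt_0; lra).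
destruct (H Z y1 y2 ltac:(lra) (proj2 h1) (proj2 h2)) as [_ [_ [_ [A [B [D [A2 [B2 [D2 [H1 [H2 [H3 H4]]]]]]]]]]]]. cbv zeta in H1, H2, H3, H4.
rewrite (product_eq R0 hR H Z y1 y2 hZ (proj2 h1) (proj2 h2) n1 n2) in H3.
set (x := k0 * / Z) in *. set (p := (x, (y1, y2)) : C3) in *.
do 3 eexists. split.
- apply partials_mult; [exact H1|apply (partials_inv (fun w => fst (snd w)) p); [exact n1|apply partials_proj1]].
- cbn [fst snd p]. fold p. set (c := cf (y1 * y2)) in *. set (P1 := psi1 p) in *.
  transitivity (/ y1 * ((A * (x * x) + B * ((- lam + a1 * x - c) * y1) + D * ((lam + a2 * x + c) * y2))
    - P1 * (- lam + a1 * x - c))).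
  + field. auto.
  + rewrite H3. field; auto.
Qed.

Lemma y1ratio_bound R0 : (0 < R0)%R -> isotropy lam k0 a1 a2 cf sg R0 dl K psi1 psi2 ->
  forall Z y1 y2 : C, (R0 + 1 < fst Z)%R -> (0 < Cmod y1 < dl)%R -> (0 < Cmod y2 < dl)%R ->
  (Cmod (y1ratio ((k0 * / Z)%C, (y1, y2))) <= (psi_max R0 * dl) / Cmod (y1 * y2))%R.
Proof.
intros hR H Z y1 y2 hZ h1 h2.
assert (n1 : y1 <> 0) by (apply Cmod_gt_0; lra). assert (n2 : y2 <> 0) by (apply Cmod_gt_0; lra).
destruct (psi_bound R0 hR H Z y1 y2 ltac:(lra) (proj2 h1) (proj2 h2)) as [B1 _].
unfold y1ratio. cbn [fst snd]. rewrite !Cmod_mult, Cmod_inv by auto.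
set (P := Cmod (psi1 _)) in *. assert (hP : (0 <= P)%R) by apply Cmod_ge_0.
replace (P * / Cmod y1)%R with (P * Cmod y2 / (Cmod y1 * Cmod y2))%R by (field; lra).
apply Rmult_le_compat_r.
- apply Rlt_le, Rinv_0_lt_compat, Rmult_lt_0_compat; lra.
- apply Rmult_le_compat; auto; lra.
Qed.

(** Fixing [y1 = rho] and letting [t] grow, [x] and [y2 = v / rho] both become at most [rho];
    tangency then puts the ratio within [9 K rho] of 1. Being a function of the initial [v] alone,
    it is 1, and the line through 0 extends the equality to all of the polydisc off the axes. *)
Lemma psi1_eq_nonzero R0 : (0 < R0)%R -> isotropy lam k0 a1 a2 cf sg R0 dl K psi1 psi2 ->
  forall Z0 y1 y2 : C, (R0 + 2 < fst Z0)%R -> (Cmod y1 < dl)%R -> (Cmod y2 < dl)%R -> y1 <> 0 -> y2 <> 0 ->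
  psi1 (k0 * / Z0, (y1, y2)) = y1.
Proof.
intros hR H Z0 y1 y2 hZ h1 h2 n1 n2.
assert (hR1 : (0 < R0 + 1)%R) by lra. assert (hZ1 : (R0 + 1 + 1 < fst Z0)%R) by lra.
destruct (first_integral_const lam k0 a1 a2 q cf sg Lc (R0 + 1) dl Hk0 Hq Hlam Ha Hcf0 HLc Hcf hR1 Hdl Hsg
   y1ratio _ Z0 (y1ratio_invariant R0 hR H) (y1ratio_bound R0 hR H) hZ1) as [eta [heta FI]].
set (vf := vfactor Z0 1 (a1 + a2)) in *.
assert (One : forall v z : C, v <> 0 -> (Cmod v < eta)%R -> (Cmod v / dl < Cmod z < dl)%R -> y1ratio (k0 * / Z0, (z, v * / z)) = 1).
{ intros v z hv hve hz.
  assert (E0 : y1ratio (k0 * / Z0, (z, v * / z)) - 1 = 0); [|set (u := y1ratio _) in *; replace u with ((u - 1) + 1) by ring; rewrite E0; ring].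
  apply Cmod_0_eq. intros e he.
  set (rho := Rmin (dl / 2) (e / (9 * K + 1))).
  assert (hr0 : (0 < rho)%R) by (apply Rmin_pos; [lra|apply Rdiv_lt_0_compat; lra]).
  assert (r2 : (rho <= dl / 2)%R) by apply Rmin_l. assert (r3 : (rho <= e / (9 * K + 1))%R) by apply Rmin_r.
  assert (hvp : (0 < Cmod v)%R) by (apply Cmod_gt_0; auto).
  assert (hrr : (0 < rho * rho)%R) by (apply Rmult_lt_0_compat; lra).
  destruct (vfactor_decay Z0 1 (R0 + 1) hR1 hZ1 (a1 + a2) Ha) as [_ Hdec]. fold vf in Hdec.
  destruct (Hdec (rho * rho / Cmod v)%R) as [T1 [hT1 HT1]]; [apply Rdiv_lt_0_compat; auto|].
  destruct (xc_lim k0 Z0 1 (R0 + 1) hR1 hZ1 rho hr0) as [T2 [hT2 HT2]].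
  set (t := Rmax T1 T2). assert (t1 : (T1 <= t)%R) by apply Rmax_l. assert (t2 : (T2 <= t)%R) by apply Rmax_r.
  specialize (HT1 t t1). specialize (HT2 t t2).
  assert (hrC : Cmod (RtoC rho) = rho) by (apply Cmod_pos_real; lra).
  assert (hrn : RtoC rho <> 0) by (apply Cmod_gt_0; lra).
  assert (hvv : (Cmod (v * vf t) <= rho * rho)%R).
  { rewrite Cmod_mult. apply (Rmult_le_compat_l (Cmod v)) in HT1; [|lra].
    replace (Cmod v * (rho * rho / Cmod v))%R with (rho * rho)%R in HT1 by (field; lra). auto. }
  assert (hvr : (Cmod (v * vf t * / RtoC rho) <= rho)%R).
  { rewrite Cmod_mult, Cmod_inv, hrC by auto. apply (Rmult_le_reg_r rho); auto. rewrite Rmult_assoc, Rinv_l; lra. }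
  rewrite <- (FI v t z (RtoC rho)); auto; try lra.
  2:{ rewrite hrC. split; [|lra]. apply (Rmult_lt_reg_r dl); auto. unfold Rdiv. rewrite Rmult_assoc, Rinv_l by lra. nra. }
  unfold y1ratio. cbn [fst snd]. unfold xc in *.
  destruct (H (Zc Z0 1 t) (RtoC rho) (v * vf t * / RtoC rho)) as [_ [E1 _]].
  { apply Rlt_trans with (R0 + 1)%R; [lra|]. apply (Zc_gt Z0 1 (R0 + 1)); auto; lra. }
  { lra. } { lra. }
  cbv zeta in E1. rewrite hrC in E1. set (P := psi1 _) in *.
  replace (P * / RtoC rho - 1) with ((P - RtoC rho) * / RtoC rho) by (field; auto).
  rewrite Cmod_mult, Cmod_inv, hrC by auto.
  apply (Rmult_le_reg_r rho); auto. rewrite Rmult_assoc, Rinv_l, Rmult_1_r by lra.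
  eapply Rle_trans; [exact E1|].
  apply Rle_trans with (K * (3 * rho)²)%R.
  - apply Rmult_le_compat_l; auto. pose proof (Cmod_ge_0 (k0 * / Zc Z0 1 t)). pose proof (Cmod_ge_0 (v * vf t * / RtoC rho)).
    apply Rsqr_incr_1; lra.
  - unfold Rsqr. apply (Rmult_le_compat_l (9 * K + 1)) in r3; [|lra].
    replace ((9 * K + 1) * (e / (9 * K + 1)))%R with e in r3 by (field; lra).
    replace (K * (3 * rho * (3 * rho)))%R with ((9 * K * rho) * rho)%R by ring. apply Rmult_le_compat_r; lra. }
pose (F := fun s => psi1 (k0 * / Z0, (s * y1, s * y2)) + - y1 * s).
assert (E : F 1 = 0).
{ apply (line_identity F y1 y2 (Rmin 1 (eta / (dl * dl)))); auto.
  - apply Rmin_pos; [lra|apply Rdiv_lt_0_compat; [lra|]]. apply Rmult_lt_0_compat; auto.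
  - intros s hs1 hs2. destruct (isotropy_partials R0 H Z0 (s * y1) (s * y2) ltac:(lra) hs1 hs2) as [[A [B [D HD]]] _].
    eexists. unfold F. apply cderiv_plus.
    + eapply cderiv_ray; eauto.
    + apply (cderiv_mult (fun _ => - y1) (fun s => s)); [apply cderiv_const|apply cderiv_id].
  - intros s hs. destruct (Ceq_dec s 0) as [->|ns].
    + unfold F. rewrite !Cmult_0_l. rewrite (axis_psi1_zero R0 hR H Z0 ltac:(lra)). ring.
    + destruct (small_param eta y1 y2 s (proj1 heta) h1 h2 n1 n2 ns hs) as [v0 [v1 [v2 v3]]].
      specialize (One _ _ v0 v1 v2). rewrite <- v3 in One. unfold y1ratio in One. cbn [fst snd] in One.
      unfold F. set (P1 := psi1 _) in *.
      assert (s * y1 <> 0) by (apply Cmult_neq_0; auto).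
      replace P1 with ((P1 * / (s * y1)) * (s * y1)) by (field; auto).
      rewrite One. ring. }
unfold F in E. rewrite !Cmult_1_l in E.
set (P1 := psi1 _) in *.
replace P1 with ((P1 + - y1 * 1) + y1) by ring. rewrite E; ring.
Qed.

(** The axes are reached as limits along the diagonal [(y1 + s, y2 + s)], which avoids both of them
    for small real [s > 0]. *)
Lemma y_continuity f (x y1 y2 A B D : C) (g : C -> C) : partials f (x, (y1, y2)) A B D ->
  (forall s : C, s <> 0 -> y1 + s <> 0 -> y2 + s <> 0 -> (Cmod (y1 + s) < dl)%R -> (Cmod (y2 + s) < dl)%R -> f (x, (y1 + s, y2 + s)) = g s) ->
  (forall s, Cmod (g s - g 0) = Cmod s) ->
  (Cmod y1 < dl)%R -> (Cmod y2 < dl)%R ->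
  f (x, (y1, y2)) = g 0.
Proof.
intros HD Hg Hs h1 h2.
assert (E : f (x, (y1, y2)) - g 0 = 0); [|replace (f (x, (y1, y2))) with ((f (x, (y1, y2)) - g 0) + g 0) by ring; rewrite E; ring].
apply Cmod_0_eq. intros e he.
destruct (expands_cont _ _ _ _ HD (e / 2)%R ltac:(lra)) as [d [hd Hd]].
assert (nz : forall y : C, exists r, (0 < r)%R /\ forall s, (0 < s < r)%R -> y + RtoC s <> 0).
{ intros y. destruct (Ceq_dec y 0) as [->|hy].
  - exists 1%R; split; [lra|]. intros s hs E. rewrite Cplus_0_l in E. apply (f_equal fst) in E; simpl in E; lra.
  - exists (Cmod y). split; [apply Cmod_gt_0; auto|]. intros s hs E.
    assert (Ey : Cmod y = s). { replace y with (- RtoC s). rewrite Cmod_opp; apply Cmod_pos_real; lra.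
      replace y with ((y + RtoC s) - RtoC s) by ring. rewrite E; ring. }
    lra. }
destruct (nz y1) as [q1 [hq1 Hq1]]. destruct (nz y2) as [q2 [hq2 Hq2]].
set (s := (Rmin (Rmin (Rmin q1 q2) (Rmin (d / 2) (e / 2))) (Rmin (dl - Cmod y1) (dl - Cmod y2)) / 2)%R).
set (m := Rmin (Rmin (Rmin q1 q2) (Rmin (d / 2) (e / 2))) (Rmin (dl - Cmod y1) (dl - Cmod y2))) in *.
assert (hm : (0 < m)%R) by (repeat apply Rmin_pos; lra).
assert (hs : (0 < s < m)%R) by (unfold s; lra).
assert (mm : (s < m)%R) by lra. apply Rmin_Rgt in mm; destruct mm as [mm1 mm2]. apply Rmin_Rgt in mm1, mm2.
destruct mm1 as [mm1 mm3], mm2 as [mm4 mm5]. apply Rmin_Rgt in mm1, mm3. destruct mm1 as [mm1 mm6], mm3 as [mm3 mm7].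
assert (hsC : Cmod (RtoC s) = s) by (apply Cmod_pos_real; lra).
specialize (Hd (x, (y1 + RtoC s, y2 + RtoC s))).
rewrite Hg in Hd.
- specialize (Hs (RtoC s)). rewrite hsC in Hs.
  assert (X : (Cmod (g (RtoC s) - f (x, (y1, y2))) <= e / 2)%R).
  { apply Hd. unfold dist3; cbn [fst snd]. replace (x - x) with (RtoC 0) by ring.
    replace (y1 + RtoC s - y1) with (RtoC s) by ring. replace (y2 + RtoC s - y2) with (RtoC s) by ring. rewrite Cmod_0, hsC. lra. }
  rewrite Cmod_sub_comm in X. pose proof (Cmod_tri (f (x, (y1, y2))) (g (RtoC s)) (g 0)). lra.
- apply Cmod_gt_0; lra.
- apply Hq1; lra.
- apply Hq2; lra.
- pose proof (Cmod_triangle y1 (RtoC s)). lra.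
- pose proof (Cmod_triangle y2 (RtoC s)). lra.
Qed.

Theorem isotropy_trivial R0 : (0 < R0)%R -> isotropy lam k0 a1 a2 cf sg R0 dl K psi1 psi2 ->
  forall Z0 y1 y2 : C, (R0 + 2 < fst Z0)%R -> (Cmod y1 < dl)%R -> (Cmod y2 < dl)%R ->
  psi1 (k0 * / Z0, (y1, y2)) = y1 /\ psi2 (k0 * / Z0, (y1, y2)) = y2.
Proof.
intros hR H Z0 y1 y2 hZ h1 h2.
destruct (isotropy_partials R0 H Z0 y1 y2 ltac:(lra) h1 h2) as [[A [B [D HD]]] [A2 [B2 [D2 HD2]]]].
split.
- rewrite <- (Cplus_0_r y1) at 2. apply (y_continuity psi1 _ y1 y2 A B D (fun s => y1 + s) HD); auto.
  + intros s _ n1 n2 m1 m2. apply (psi1_eq_nonzero R0 hR H); auto.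
  + intros s. f_equal; ring.
- rewrite <- (Cplus_0_r y2) at 2. apply (y_continuity psi2 _ y1 y2 A2 B2 D2 (fun s => y2 + s) HD2); auto.
  + intros s _ n1 n2 m1 m2.
    pose proof (product_eq R0 hR H Z0 (y1 + s) (y2 + s) ltac:(lra) m1 m2 n1 n2) as E.
    rewrite (psi1_eq_nonzero R0 hR H Z0 _ _ hZ m1 m2 n1 n2) in E.
    apply (f_equal (fun w => / (y1 + s) * w)) in E. rewrite !Cmult_assoc, Cinv_l, !Cmult_1_l in E by auto. exact E.
  + intros s. f_equal; ring.
Qed.
End Iso.

(** * Power series and Frechet differentials *)

Lemma geometric_limit_R (u : nat -> R) (A : R) : (0 <= A)%R ->
  (forall n, Rabs (u (S n) - u n) <= A / 2 ^ n)%R -> exists l, forall n, (Rabs (u n - l) <= 2 * (A / 2 ^ n))%R.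
Proof.
intros hA H.
(* The intervals centered at [u n] of half-length [2 A / 2^n] are nested, since the steps are at
   most [A / 2^n]. *)
destruct (nested_limit (fun n => u n - 2 * (A / 2 ^ n))%R (4 * A)%R) as [x Hx].
- intros n. specialize (H n). apply Rabs_le_between in H. pose proof (half_pow A n).
  replace (4 * A / 2 ^ S n)%R with (4 * (A / 2 ^ S n))%R by (unfold Rdiv; ring).
  replace (4 * A / 2 ^ n)%R with (4 * (A / 2 ^ n))%R by (unfold Rdiv; ring). lra.
- lra.
- exists x. intros n. specialize (Hx n). replace (4 * A / 2 ^ n)%R with (4 * (A / 2 ^ n))%R in Hx by (unfold Rdiv; ring).
  apply Rabs_le_between. lra.
Qed.

Lemma geometric_limit (u : nat -> C) (A : R) : (0 <= A)%R ->
  (forall n, Cmod (u (S n) - u n) <= A / 2 ^ n)%R -> exists l, forall n, (Cmod (u n - l) <= 4 * (A / 2 ^ n))%R.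
Proof.
intros hA H.
destruct (geometric_limit_R (fun n => fst (u n)) A hA) as [a Ha].
{ intros n. eapply Rle_trans; [apply (Rabs_fst_le (u (S n) - u n))|apply H]. }
destruct (geometric_limit_R (fun n => snd (u n)) A hA) as [b Hb].
{ intros n. eapply Rle_trans; [apply (Rabs_snd_le (u (S n) - u n))|apply H]. }
exists (a, b). intros n. eapply Rle_trans; [apply Cmod_le_sum|]. simpl fst. simpl snd.
specialize (Ha n); specialize (Hb n). unfold Rminus in *. lra.
Qed.

Lemma geometric_small (A e : R) : (0 <= A)%R -> (0 < e)%R -> exists N, forall n, (N <= n)%nat -> (A / 2 ^ n <= e)%R.
Proof.
intros hA he. destruct (archimed_cor1 (e / (A + 1))%R) as [N [hN hN0]]; [apply Rdiv_lt_0_compat; lra|].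
exists N. intros n hn. assert (0 < INR N)%R by (apply lt_0_INR; auto).
assert (INR N <= 2 ^ n)%R by (eapply Rle_trans; [apply le_INR, hn|apply pow2_ge]).
apply Rle_trans with ((A + 1) * / INR N)%R.
- apply Rmult_le_compat; try lra; [apply Rlt_le, Rinv_0_lt_compat, pow_lt; lra|]. apply Rinv_le_contravar; auto.
- apply (Rmult_lt_compat_l (A + 1)) in hN; [|lra]. replace ((A + 1) * (e / (A + 1)))%R with e in hN by (field; lra). lra.
Qed.

Lemma CLim_geometric (u : nat -> C) (A : R) (l : C) : (0 <= A)%R ->
  (forall n, (Cmod (u n - l) <= A / 2 ^ n)%R) -> CLim u = l.
Proof.
intros hA H. unfold CLim.
assert (G : forall (f : C -> R), (forall z w, (Rabs (f z - f w) <= Cmod (z - w))%R) -> real (Lim_seq (fun n => f (u n))) = f l).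
{ intros f Hf. rewrite (is_lim_seq_unique _ (Finite (f l))); auto.
  apply is_lim_seq_Reals. intros e he. destruct (geometric_small A (e / 2) hA ltac:(lra)) as [N HN].
  exists N. intros n hn. unfold Rdist. specialize (HN n hn). specialize (H n). specialize (Hf (u n) l). lra. }
rewrite (injective_projections (real (Lim_seq (fun n => Re (u n))), real (Lim_seq (fun n => Im (u n)))) l); auto; simpl.
- apply (G fst). intros z w. apply (Rabs_fst_le (z - w)).
- apply (G snd). intros z w. apply (Rabs_snd_le (z - w)).
Qed.

Lemma Cpow_lip (v w : C) (s : R) n : (Cmod v <= s)%R -> (Cmod w <= s)%R ->
  (Cmod (v ^ S n - w ^ S n) <= INR (S n) * s ^ n * Cmod (v - w))%R.
Proof.
intros hv hw. assert (hs : (0 <= s)%R) by (pose proof (Cmod_ge_0 v); lra).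
induction n as [|n IH].
- simpl. replace (v * 1 - w * 1) with (v - w) by ring. lra.
- replace (v ^ S (S n) - w ^ S (S n)) with (v * (v ^ S n - w ^ S n) + (v - w) * w ^ S n) by (simpl; ring).
  eapply Rle_trans; [apply Cmod_triangle|]. rewrite !Cmod_mult, Cmod_pow.
  rewrite (S_INR (S n)).
  replace ((INR (S n) + 1) * s ^ S n * Cmod (v - w))%R with (s * (INR (S n) * s ^ n * Cmod (v - w)) + Cmod (v - w) * s ^ S n)%R by (simpl; ring).
  apply Rplus_le_compat.
  + apply Rmult_le_compat; auto using Cmod_ge_0.
  + apply Rmult_le_compat_l; [apply Cmod_ge_0|]. apply pow_incr; split; auto using Cmod_ge_0.
Qed.

(** On the disc of radius [rho / 4] the term of index [m] is Lipschitz with constant at most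
    [4 A / rho / 2^m], by [m <= 2^m]. The flow estimates see the function [c] through this bound and
    through [c(0) = 0]. *)
Lemma eval1_lipschitz (c : nat -> C) : convergent1 c -> exists s L : R, (0 < s)%R /\ (0 <= L)%R /\
  forall v w : C, (Cmod v < s)%R -> (Cmod w < s)%R -> (Cmod (eval1 c v - eval1 c w) <= L * Cmod (v - w))%R.
Proof.
intros [A [rho [hr Hc]]].
assert (hA : (0 <= A)%R). { specialize (Hc 0%nat). simpl in Hc. pose proof (Cmod_ge_0 (c 0%nat)). lra. }
assert (p2 : forall n, (0 < 2 ^ n)%R) by (intros; apply pow_lt; lra).
pose (S := fun v => sum_n (fun n => c n * v ^ n)).
assert (cb : forall n, (Cmod (c n) <= A * / rho ^ n)%R).
{ intros n. specialize (Hc n). assert (0 < rho ^ n)%R by (apply pow_lt; auto).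
  apply (Rmult_le_reg_r (rho ^ n)); auto. rewrite Rmult_assoc, Rinv_l; lra. }
assert (Conv : forall v, (Cmod v < rho / 4)%R -> exists l, (forall n, (Cmod (S v n - l) <= 4 * (A / 2 ^ n))%R) /\ eval1 c v = l).
{ intros v hv. destruct (geometric_limit (S v) A hA) as [l Hl].
  - intros n. unfold S. rewrite sum_Sn. change plus with Cplus.
    replace (sum_n (fun n => c n * v ^ n) n + c (Datatypes.S n) * v ^ Datatypes.S n - sum_n (fun n => c n * v ^ n) n) with (c (Datatypes.S n) * v ^ Datatypes.S n) by ring.
    rewrite Cmod_mult, Cmod_pow.
    apply Rle_trans with (A * / rho ^ Datatypes.S n * (rho / 2) ^ Datatypes.S n)%R.
    + apply Rmult_le_compat; auto using Cmod_ge_0; [apply pow_le, Cmod_ge_0|]. apply pow_incr; split; [apply Cmod_ge_0|lra].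
    + unfold Rdiv at 1. rewrite Rpow_mult_distr. replace (A * / rho ^ Datatypes.S n * (rho ^ Datatypes.S n * (/ 2) ^ Datatypes.S n))%R with (A * (/ 2) ^ Datatypes.S n)%R by (field; apply pow_nonzero; lra).
      rewrite pow_inv. apply Rmult_le_compat_l; auto. apply Rinv_le_contravar; auto. simpl. specialize (p2 n). lra.
  - exists l; split; auto. apply (CLim_geometric _ (4 * A)%R); [lra|]. intros n. specialize (Hl n).
    replace (4 * A / 2 ^ n)%R with (4 * (A / 2 ^ n))%R by (unfold Rdiv; ring). exact Hl. }
exists (rho / 4)%R, (8 * A / rho)%R. split; [lra|]. split; [apply Rmult_le_pos; [lra|apply Rlt_le, Rinv_0_lt_compat; auto]|].
intros v w hv hw. destruct (Conv v hv) as [lv [Hlv ->]]. destruct (Conv w hw) as [lw [Hlw ->]].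
(* The geometric sum of these constants in closed form, so that the induction closes exactly. *)
assert (Part : forall n, (Cmod (S v n - S w n) <= (8 * A / rho - 4 * A / rho / 2 ^ n) * Cmod (v - w))%R).
{ intros n. induction n as [|n IH].
  - unfold S. rewrite !sum_O. simpl. replace (c 0%nat * 1 - c 0%nat * 1) with (RtoC 0) by ring. rewrite Cmod_0.
    apply Rmult_le_pos; [|apply Cmod_ge_0]. assert (0 <= A / rho)%R by (apply Rmult_le_pos; [auto|apply Rlt_le, Rinv_0_lt_compat; auto]).
    replace (8 * A / rho - 4 * A / rho / 1)%R with (4 * (A / rho))%R by (field; lra). lra.
  - unfold S in *. rewrite !sum_Sn. change plus with Cplus.
    match goal with |- (Cmod (?a + ?b - (?a' + ?b')) <= _)%R => replace (a + b - (a' + b')) with ((a - a') + (b - b')) by ring end.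
    eapply Rle_trans; [apply Cmod_triangle|].
    set (m := Datatypes.S n). replace (c m * v ^ m - c m * w ^ m) with (c m * (v ^ m - w ^ m)) by ring. rewrite Cmod_mult.
    assert (T : (Cmod (c m) * Cmod (v ^ m - w ^ m) <= 4 * A / rho / 2 ^ m * Cmod (v - w))%R).
    { apply Rle_trans with (A * / rho ^ m * (2 ^ m * (rho / 4) ^ n * Cmod (v - w)))%R.
      - apply Rmult_le_compat; auto using Cmod_ge_0.
        eapply Rle_trans; [apply (Cpow_lip v w (rho / 4)); lra|]. apply Rmult_le_compat_r; [apply Cmod_ge_0|].
        apply Rmult_le_compat_r; [apply pow_le; lra|]. apply pow2_ge.
      - right. unfold m, Rdiv. rewrite Rpow_mult_distr, pow_inv. replace 4%R with (2 * 2)%R at 1 by ring. rewrite Rpow_mult_distr.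
        simpl. field. repeat split; try lra; apply pow_nonzero; lra. }
    replace (8 * A / rho - 4 * A / rho / 2 ^ m)%R with ((8 * A / rho - 4 * A / rho / 2 ^ n) + 4 * A / rho / 2 ^ m)%R.
    + rewrite Rmult_plus_distr_r. apply Rplus_le_compat; auto.
    + unfold m. simpl. field. split; [lra|apply pow_nonzero; lra]. }
apply Rle_plus_epsilon. intros e he.
destruct (geometric_small (8 * A) e ltac:(lra) he) as [N HN]. specialize (HN N (le_n _)).
specialize (Hlv N). specialize (Hlw N). specialize (Part N).
replace (lv - lw) with ((S v N - S w N) - (S v N - lv) + (S w N - lw)) by ring.
eapply Rle_trans; [apply Cmod_triangle|]. eapply Rle_trans; [apply Rplus_le_compat_r, Cmod_sub_le|].
assert (0 <= 4 * A / rho / 2 ^ N)%R.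
{ apply Rmult_le_pos; [|apply Rlt_le, Rinv_0_lt_compat; auto]. apply Rmult_le_pos; [lra|apply Rlt_le, Rinv_0_lt_compat; auto]. }
assert ((8 * A / rho - 4 * A / rho / 2 ^ N) * Cmod (v - w) <= 8 * A / rho * Cmod (v - w))%R.
{ apply Rmult_le_compat_r; [apply Cmod_ge_0|lra]. }
replace (8 * A / 2 ^ N)%R with (8 * (A / 2 ^ N))%R in HN by (unfold Rdiv; ring). lra.
Qed.

Lemma eval1_0 (c : nat -> C) : c 0%nat = 0 -> eval1 c 0 = 0.
Proof.
intros h. unfold eval1. apply (CLim_geometric _ 0%R); [lra|]. intros n.
replace (sum_n (fun n => c n * 0 ^ n) n) with (RtoC 0).
- replace (0 - 0) with (RtoC 0) by ring. rewrite Cmod_0. unfold Rdiv; lra.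
- induction n as [|n IH].
  + rewrite sum_O, h. ring.
  + rewrite sum_Sn, <- IH. change plus with Cplus. simpl. ring.
Qed.

Lemma C3_norm_bounds (h : C3) :
  (Cmod (fst h) <= norm h)%R /\ (Cmod (fst (snd h)) <= norm h)%R /\ (Cmod (snd (snd h)) <= norm h)%R /\
  (norm h <= Cmod (fst h) + Cmod (fst (snd h)) + Cmod (snd (snd h)))%R.
Proof.
destruct h as [a [b c]]. cbn [fst snd].
change (norm ((a, (b, c)) : C3)) with (sqrt ((Cmod a) ^ 2 + (sqrt ((Cmod b) ^ 2 + (Cmod c) ^ 2)) ^ 2))%R.
pose proof (Cmod_ge_0 a). pose proof (Cmod_ge_0 b). pose proof (Cmod_ge_0 c).
assert (hh : (0 <= (Cmod b) ^ 2 + (Cmod c) ^ 2)%R) by nra.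
rewrite (pow2_sqrt _ hh).
assert (X : forall u v, (0 <= u)%R -> (u ^ 2 <= v)%R -> (u <= sqrt v)%R).
{ intros u v hu huv. rewrite <- (sqrt_Rsqr u) by auto. apply sqrt_le_1_alt. unfold Rsqr. lra. }
repeat split; try (apply X; auto; nra).
rewrite <- (sqrt_Rsqr (Cmod a + Cmod b + Cmod c)) by lra. apply sqrt_le_1_alt. unfold Rsqr. nra.
Qed.

Definition coord (i : nat) (h : C3) : C := match i with O => fst h | 1%nat => fst (snd h) | _ => snd (snd h) end.

Lemma coord_le i (h : C3) : (Cmod (coord i h) <= norm h)%R.
Proof. destruct (C3_norm_bounds h) as [h0 [h1 [h2 _]]]. destruct i as [|[|i]]; auto. Qed.

Lemma coord_minus i (a b : C3) : coord i (minus a b) = coord i a - coord i b.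
Proof. destruct i as [|[|i]]; reflexivity. Qed.

Lemma locally_C3 (P : C3 -> Prop) (p : C3) : locally p P -> exists d : R, (0 < d)%R /\ forall w, (dist3 p w < d)%R -> P w.
Proof.
intros [e He]. exists e; split; [apply cond_pos|]. intros w hw. apply He. apply (norm_compat1 p w e).
eapply Rle_lt_trans; [|exact hw]. apply (C3_norm_bounds (minus w p)).
Qed.

Lemma C3_decomp (a b c : C) : ((a, (b, c)) : C3) =
  plus (plus (scal a ((RtoC 1, (RtoC 0, RtoC 0)) : C3)) (scal b ((RtoC 0, (RtoC 1, RtoC 0)) : C3))) (scal c ((RtoC 0, (RtoC 0, RtoC 1)) : C3)).
Proof.
transitivity ((a * 1 + b * 0 + c * 0, (a * 0 + b * 1 + c * 0, a * 0 + b * 0 + c * 1)) : C3); [|reflexivity].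
replace (a * 1 + b * 0 + c * 0) with a by ring. replace (a * 0 + b * 1 + c * 0) with b by ring.
replace (a * 0 + b * 0 + c * 1) with c by ring. reflexivity.
Qed.

Lemma linear_coords (df : C3 -> C3) (h : C3) i : is_linear df ->
  coord i (df h) = coord i (df (RtoC 1, (RtoC 0, RtoC 0))) * fst h
   + coord i (df (RtoC 0, (RtoC 1, RtoC 0))) * fst (snd h) + coord i (df (RtoC 0, (RtoC 0, RtoC 1))) * snd (snd h).
Proof.
intros Hl. destruct h as [a [b c]]. cbn [fst snd].
rewrite (C3_decomp a b c) at 1. rewrite !(linear_plus df Hl), !(linear_scal df Hl).
assert (P : forall u v : C3, coord i (plus u v) = coord i u + coord i v) by (intros; destruct i as [|[|j]]; reflexivity).
assert (Q : forall (k : C) (v : C3), coord i (scal k v) = k * coord i v) by (intros; destruct i as [|[|j]]; reflexivity).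
rewrite !P, !Q. ring.
Qed.

Lemma filterdiff_partials (f df : C3 -> C3) (p : C3) i : filterdiff f (locally p) df ->
  partials (fun w => coord i (f w)) p (coord i (df (RtoC 1, (RtoC 0, RtoC 0)))) (coord i (df (RtoC 0, (RtoC 1, RtoC 0)))) (coord i (df (RtoC 0, (RtoC 0, RtoC 1)))).
Proof.
intros [Hl Hd]. specialize (Hd p (fun P H => H)).
assert (Lin := fun h : C3 => linear_coords df h i Hl).
destruct (linear_norm df Hl) as [M [HM HMb]].
split.
- intros e he. destruct (locally_C3 _ _ (Hd (mkposreal e he))) as [d [hd Hdd]]. exists d; split; auto.
  intros w hw. specialize (Hdd w hw). simpl in Hdd.
  pose proof (Lin (minus w p)) as L.
  pose proof (coord_le i (minus (minus (f w) (f p)) (df (minus w p)))) as B. rewrite !coord_minus, L in B.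
  apply Rle_trans with (e * norm (minus w p))%R.
  + eapply Rle_trans; [exact B|]. exact Hdd.
  + apply Rmult_le_compat_l; [lra|]. apply (C3_norm_bounds (minus w p)).
- exists M. split; [lra|]. intros w. pose proof (Lin (minus w p)) as L.
  pose proof (coord_le i (df (minus w p))) as B. rewrite L in B.
  eapply Rle_trans; [exact B|]. eapply Rle_trans; [apply HMb|]. apply Rmult_le_compat_l; [lra|]. apply (C3_norm_bounds (minus w p)).
Qed.

Lemma minus_plus_l {G : AbelianGroup} (p h : G) : minus (plus p h) p = h.
Proof.
unfold minus. transitivity (plus h (plus p (opp p))).
- transitivity (plus (plus h p) (opp p)); [f_equal; apply plus_comm|symmetry; apply plus_assoc].
- transitivity (plus h zero); [f_equal; apply plus_opp_r|apply plus_zero_r].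
Qed.

Lemma plus_minus_l {G : AbelianGroup} (h k : G) : h = plus (minus h k) k.
Proof.
unfold minus. symmetry. transitivity (plus h (plus (opp k) k)); [symmetry; apply plus_assoc|].
transitivity (plus h zero); [f_equal; apply plus_opp_l|apply plus_zero_r].
Qed.

(** Uniqueness of the differential: at [p + t h] with [t] small the remainder is [t (h - df h)] by
    linearity, and it is [o(t)]. It will give [dg o dPhi = id] for a left inverse [g]. *)
Lemma filterdiff_id_unique (f df : C3 -> C3) (p : C3) (d : R) : (0 < d)%R -> (forall w, (dist3 p w < d)%R -> f w = w) ->
  filterdiff f (locally p) df -> forall h, df h = h.
Proof.
intros hd Hf [Hl Hd] h. specialize (Hd p (fun P H => H)).
assert (N : forall e, (0 < e)%R -> (norm (minus h (df h)) <= e * norm h)%R).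
{ intros e he. destruct (locally_C3 _ _ (Hd (mkposreal e he))) as [d1 [hd1 Hd1]]. simpl in Hd1.
  set (S := (Cmod (fst h) + Cmod (fst (snd h)) + Cmod (snd (snd h)))%R).
  assert (hS : (0 <= S)%R) by (unfold S; pose proof (Cmod_ge_0 (fst h)); pose proof (Cmod_ge_0 (fst (snd h))); pose proof (Cmod_ge_0 (snd (snd h))); lra).
  set (t := (Rmin d d1 / (2 * (S + 1)))%R).
  assert (hm : (0 < Rmin d d1)%R) by (apply Rmin_pos; auto).
  assert (ht : (0 < t)%R) by (apply Rdiv_lt_0_compat; lra).
  set (w := plus p (scal (RtoC t) h)).
  assert (Ew : minus w p = scal (RtoC t) h).
  { exact (minus_plus_l p (scal (RtoC t) h)). }
  assert (hw : (dist3 p w < Rmin d d1)%R).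
  { assert (E : dist3 p w = (t * S)%R).
    { unfold dist3. change (fst w - fst p) with (fst (minus w p)). change (fst (snd w) - fst (snd p)) with (fst (snd (minus w p))).
      change (snd (snd w) - snd (snd p)) with (snd (snd (minus w p))). rewrite Ew.
      change (fst (scal (RtoC t) h)) with (RtoC t * fst h). change (fst (snd (scal (RtoC t) h))) with (RtoC t * fst (snd h)).
      change (snd (snd (scal (RtoC t) h))) with (RtoC t * snd (snd h)).
      rewrite !Cmod_mult, Cmod_pos_real by lra. unfold S; ring. }
    rewrite E. apply Rle_lt_trans with (t * (S + 1))%R; [apply Rmult_le_compat_l; lra|].
    unfold t. replace (Rmin d d1 / (2 * (S + 1)) * (S + 1))%R with (Rmin d d1 / 2)%R by (field; lra). lra. }
  apply Rmin_Rgt in hw; destruct hw as [w1 w2]. specialize (Hd1 w w2).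
  rewrite (Hf w w1), (Hf p) in Hd1.
  2:{ unfold dist3. replace (fst p - fst p) with (RtoC 0) by ring. replace (fst (snd p) - fst (snd p)) with (RtoC 0) by ring.
      replace (snd (snd p) - snd (snd p)) with (RtoC 0) by ring. rewrite Cmod_0; lra. }
  rewrite Ew, (linear_scal df Hl) in Hd1.
  assert (Hd2 : (norm (scal (RtoC t) (minus h (df h) : C3) : C3) <= e * norm (scal (RtoC t) h : C3))%R).
  { eapply Rle_trans; [|exact Hd1]. right. f_equal. apply (scal_minus_distr_l (RtoC t) h (df h)). }
  assert (NS : forall u : C3, norm (scal (RtoC t) u) = (t * norm u)%R).
  { intros [a [b c]].
    change (norm (scal (RtoC t) ((a, (b, c)) : C3))) with (sqrt ((Cmod (RtoC t * a)) ^ 2 + (sqrt ((Cmod (RtoC t * b)) ^ 2 + (Cmod (RtoC t * c)) ^ 2)) ^ 2))%R.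
    change (norm ((a, (b, c)) : C3)) with (sqrt ((Cmod a) ^ 2 + (sqrt ((Cmod b) ^ 2 + (Cmod c) ^ 2)) ^ 2))%R.
    rewrite !Cmod_mult, !Cmod_pos_real by lra.
    assert (Q : forall x y, sqrt ((t * x) ^ 2 + (t * y) ^ 2) = (t * sqrt (x ^ 2 + y ^ 2))%R).
    { intros x y. replace ((t * x) ^ 2 + (t * y) ^ 2)%R with ((t * t) * (x ^ 2 + y ^ 2))%R by ring.
      rewrite sqrt_mult_alt by nra. rewrite sqrt_square by lra. reflexivity. }
    rewrite Q, Q. reflexivity. }
  rewrite (NS h), (NS (minus h (df h))) in Hd2. apply (Rmult_le_reg_l t); auto.
  eapply Rle_trans; [exact Hd2|]. right; ring. }
assert (Z : norm (minus h (df h)) = 0%R).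
{ apply Rle_antisym; [|apply norm_ge_0]. apply Rle_plus_epsilon. intros e he.
  assert (hn : (0 <= norm h)%R) by apply norm_ge_0. set (nh := norm h) in *.
  assert (he' : (0 < e / (nh + 1))%R) by (apply Rdiv_lt_0_compat; lra). specialize (N _ he').
  eapply Rle_trans; [exact N|]. apply Rle_trans with (e / (nh + 1) * (nh + 1))%R.
  - apply Rmult_le_compat_l; lra.
  - right; field; lra. }
apply norm_eq_zero in Z.
pose proof (plus_minus_l h (df h)) as E.
rewrite Z in E. rewrite E at 2. symmetry. apply plus_zero_l.
Qed.

(** * Inversion of maps tangent to the identity *)

Lemma mvt_C F (z w : C) L : (forall t, (0 <= t <= 1)%R -> exists l, cderiv F (z + RtoC t * (w - z)) l /\ (Cmod l <= L)%R) ->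
  (Cmod (F w - F z) <= 2 * (L * Cmod (w - z)))%R.
Proof.
intros H.
pose (c := fun t : R => z + RtoC t * (w - z)).
assert (Hc : forall t, rderiv c t (w - z)).
{ intros t. unfold c. eapply rderiv_eq; [|apply rderiv_plus; [apply rderiv_const|apply rderiv_mult; [apply rderiv_id|apply rderiv_const]]]. cbv beta; ring. }
assert (HF : forall t, (0 <= t <= 1)%R -> exists m, rderiv (fun t => F (c t)) t m /\ (Cmod m <= L * Cmod (w - z))%R).
{ intros t ht. destruct (H t ht) as [l [Hl hl]]. exists (l * (w - z)). split.
  - apply (rderiv_CD F c); auto.
  - rewrite Cmod_mult. apply Rmult_le_compat_r; auto using Cmod_ge_0. }
assert (G : forall (pr : C -> R), (forall u, (Rabs (pr u) <= Cmod u)%R) ->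
   (forall f t l, rderiv f t l -> is_derive (fun s => pr (f s)) t (pr l)) ->
   (Rabs (pr (F w) - pr (F z)) <= L * Cmod (w - z))%R).
{ intros pr Hpr Hd. set (f := fun t => pr (F (c t))).
  assert (E1 : f 1%R = pr (F w)) by (unfold f, c; do 2 f_equal; ring).
  assert (E0 : f 0%R = pr (F z)) by (unfold f, c; do 2 f_equal; ring).
  rewrite <- E1, <- E0.
  assert (D : forall t, (0 <= t <= 1)%R -> is_derive f t (Derive f t) /\ (Rabs (Derive f t) <= L * Cmod (w - z))%R).
  { intros t ht. destruct (HF t ht) as [m [Hm hm]]. pose proof (Hd _ _ _ Hm) as X. change (is_derive f t (pr m)) in X.
    rewrite (is_derive_unique _ _ _ X). split; auto. eapply Rle_trans; [apply Hpr|exact hm]. }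
  apply Rabs_le. split.
  - pose proof (derive_le (fun t => - f t)%R (fun t => - Derive f t)%R 0 1 (L * Cmod (w - z)) ltac:(lra)) as X. cbv beta in X.
    enough (- f 1 - - f 0 <= L * Cmod (w - z) * (1 - 0))%R by lra. apply X; intros t ht; destruct (D t ht) as [D1 D2].
    + apply (is_derive_opp f); auto.
    + apply Rabs_le_between in D2. lra.
  - pose proof (derive_le f (Derive f) 0 1 (L * Cmod (w - z)) ltac:(lra)) as X.
    enough (f 1 - f 0 <= L * Cmod (w - z) * (1 - 0))%R by lra. apply X; intros t ht; destruct (D t ht) as [D1 D2]; auto.
    apply Rabs_le_between in D2. lra. }
eapply Rle_trans; [apply Cmod_le_sum|].
pose proof (G fst Rabs_fst_le (fun f t l h => proj1 (proj1 (rderiv_iff f t l) h))) as G1.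
pose proof (G snd Rabs_snd_le (fun f t l h => proj2 (proj1 (rderiv_iff f t l) h))) as G2.
simpl. unfold Rminus in *. lra.
Qed.

(** What a normalizing germ gives on the region [Re Z > R0]. The constants [d] and [K] are kept
    explicit so that one choice can serve two maps. *)
Definition tame (X W : C3 -> C3) (k0 : C) (R0 d K : R) (Phi : C3 -> C3) : Prop :=
  forall Z y1 y2 : C, (R0 < fst Z)%R -> (Cmod y1 < d)%R -> (Cmod y2 < d)%R ->
  let x := k0 * / Z in let p := (x, (y1, y2)) : C3 in
  fst (Phi p) = x /\
  (Cmod (coord 1 (Phi p) - y1) <= K * (Cmod x + Cmod y1 + Cmod y2)²)%R /\
  (Cmod (coord 2 (Phi p) - y2) <= K * (Cmod x + Cmod y1 + Cmod y2)²)%R /\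
  exists df, filterdiff Phi (locally p) df /\ df (X p) = W (Phi p).

Section Tame.
Variables (X W : C3 -> C3) (k0 : C) (R0 d K : R) (Phi : C3 -> C3).
Hypothesis Hk0 : k0 <> 0.
Hypothesis HR0 : (0 < R0)%R.
Hypothesis Hd : (0 < d)%R.
Hypothesis HK : (0 <= K)%R.
Hypothesis Hx : (Cmod k0 <= R0 * d)%R.
(** Each component of [Phi - id] will be Lipschitz in [y] with constant [144 K d]; their sum
    contracts by 1/2 as soon as [576 K d <= 1], and 600 leaves a margin. *)
Hypothesis HKd : (600 * K * d <= 1)%R.
Hypothesis HPhi : tame X W k0 R0 d K Phi.

Lemma x_small (Z : C) : (R0 < fst Z)%R -> (Cmod (k0 * / Z) < d)%R.
Proof.
intros hZ. pose proof (fst_le_Cmod Z). assert (hz : Z <> 0) by (apply Cmod_gt_0; lra).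
rewrite Cmod_mult, Cmod_inv by auto. apply (Rmult_lt_reg_r (Cmod Z)); [lra|]. rewrite Rmult_assoc, Rinv_l, Rmult_1_r by lra.
apply Rle_lt_trans with (R0 * d)%R; auto. rewrite (Rmult_comm d). apply Rmult_lt_compat_r; lra.
Qed.

Definition dev (i : nat) (Z y1 y2 : C) : C := coord i (Phi (k0 * / Z, (y1, y2))) - coord i (k0 * / Z, (y1, y2)).

Lemma dev_bound i (Z y1 y2 : C) : (i = 1 \/ i = 2)%nat -> (R0 < fst Z)%R -> (Cmod y1 < d)%R -> (Cmod y2 < d)%R ->
  (Cmod (dev i Z y1 y2) <= 9 * K * (d * d))%R.
Proof.
intros hi hZ h1 h2. destruct (HPhi Z y1 y2 hZ h1 h2) as [_ [E1 [E2 _]]]. cbv zeta in E1, E2.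
assert (Y : (K * (Cmod (k0 * / Z) + Cmod y1 + Cmod y2)² <= 9 * K * (d * d))%R).
{ replace (9 * K * (d * d))%R with (K * (3 * d)²)%R by (unfold Rsqr; ring). apply Rmult_le_compat_l; auto.
  pose proof (x_small Z hZ). pose proof (Cmod_ge_0 (k0 * / Z)). pose proof (Cmod_ge_0 y1). pose proof (Cmod_ge_0 y2).
  apply Rsqr_incr_1; lra. }
destruct hi as [->| ->]; unfold dev; simpl coord in *; lra.
Qed.

(** The deviation from the identity is at most [9 K d^2]. Cauchy's estimate on a circle of radius
    [d / 4] gives a derivative of at most [72 K d] on the half disc, and the mean value inequality
    doubles the constant. *)
Lemma dev_line i (Z u1 w1 u2 w2 : C) : (i = 1 \/ i = 2)%nat -> (R0 < fst Z)%R ->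
  (forall s : C, (Cmod s < d)%R -> (Cmod (u1 + s * w1) < d)%R /\ (Cmod (u2 + s * w2) < d)%R) ->
  forall a b : C, (Cmod a <= d / 2)%R -> (Cmod b <= d / 2)%R ->
  (Cmod (dev i Z (u1 + b * w1) (u2 + b * w2) - dev i Z (u1 + a * w1) (u2 + a * w2)) <= 144 * K * d * Cmod (b - a))%R.
Proof.
intros hi hZ Hs a b ha hb.
pose (F := fun s => dev i Z (u1 + s * w1) (u2 + s * w2)).
assert (HF : forall s, (Cmod s < d)%R -> (exists l, cderiv F s l) /\ (Cmod (F s) <= 9 * K * (d * d))%R).
{ intros s hs. destruct (Hs s hs) as [h1 h2]. split; [|apply dev_bound; auto].
  destruct (HPhi Z _ _ hZ h1 h2) as [_ [_ [_ [df [Hdf _]]]]].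
  pose proof (cderiv_yline _ _ _ _ _ _ _ _ _ _ (filterdiff_partials _ _ _ i Hdf)) as E. cbv beta in E.
  destruct hi as [->| ->].
  - eexists. unfold F, dev. cbn [coord fst snd] in E |- *.
    apply (cderiv_ext (fun s => fst (snd (Phi (k0 * / Z, (u1 + s * w1, u2 + s * w2)))) + (- u1 + (- w1) * s))); [intros; cbn [coord fst snd]; ring|].
    apply cderiv_plus; [exact E|]. apply cderiv_plus; [apply cderiv_const|]. apply (cderiv_mult (fun _ => - w1) (fun s => s)); [apply cderiv_const|apply cderiv_id].
  - eexists. unfold F, dev. cbn [coord fst snd] in E |- *.
    apply (cderiv_ext (fun s => snd (snd (Phi (k0 * / Z, (u1 + s * w1, u2 + s * w2)))) + (- u2 + (- w2) * s))); [intros; cbn [coord fst snd]; ring|].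
    apply cderiv_plus; [exact E|]. apply cderiv_plus; [apply cderiv_const|]. apply (cderiv_mult (fun _ => - w2) (fun s => s)); [apply cderiv_const|apply cderiv_id]. }
change (Cmod (F b - F a) <= 144 * K * d * Cmod (b - a))%R.
replace (144 * K * d * Cmod (b - a))%R with (2 * ((72 * K * d) * Cmod (b - a)))%R by ring.
apply mvt_C. intros t ht.
assert (hs : (Cmod (a + RtoC t * (b - a)) <= d / 2)%R).
{ replace (a + RtoC t * (b - a)) with (RtoC (1 - t) * a + RtoC t * b) by (rewrite RtoC_minus; ring).
  eapply Rle_trans; [apply Cmod_triangle|]. rewrite !Cmod_mult, !Cmod_pos_real by lra.
  assert ((1 - t) * Cmod a <= (1 - t) * (d / 2))%R by (apply Rmult_le_compat_l; lra).
  assert (t * Cmod b <= t * (d / 2))%R by (apply Rmult_le_compat_l; lra). lra. }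
set (s := a + RtoC t * (b - a)) in *.
destruct (HF s ltac:(lra)) as [[l Hl] _]. exists l; split; auto.
pose proof (cauchy_estimate F s l (d / 2) (9 * K * (d * d)) (d / 4) ltac:(lra)) as Q.
apply (Rmult_le_reg_r (d / 4)); [lra|]. replace (72 * K * d * (d / 4))%R with (2 * (9 * K * (d * d)))%R by field.
apply Q; auto. intros z hz. apply HF. pose proof (Cmod_rev z s). lra.
Qed.

Lemma dev_lip i (Z y1 y2 z1 z2 : C) : (i = 1 \/ i = 2)%nat -> (R0 < fst Z)%R ->
  (Cmod y1 <= d / 2)%R -> (Cmod y2 <= d / 2)%R -> (Cmod z1 <= d / 2)%R -> (Cmod z2 <= d / 2)%R ->
  (Cmod (dev i Z y1 y2 - dev i Z z1 z2) <= 144 * K * d * (Cmod (y1 - z1) + Cmod (y2 - z2)))%R.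
Proof.
intros hi hZ h1 h2 h3 h4.
pose proof (dev_line i Z 0 1 y2 0 hi hZ) as A. pose proof (dev_line i Z z1 0 0 1 hi hZ) as B.
assert (A' := A ltac:(intros s hs; replace (0 + s * 1) with s by ring; replace (y2 + s * 0) with y2 by ring; split; lra) z1 y1 h3 h1).
assert (B' := B ltac:(intros s hs; replace (0 + s * 1) with s by ring; replace (z1 + s * 0) with z1 by ring; split; lra) z2 y2 h4 h2).
replace (0 + y1 * 1) with y1 in A' by ring. replace (0 + z1 * 1) with z1 in A' by ring.
replace (y2 + y1 * 0) with y2 in A' by ring. replace (y2 + z1 * 0) with y2 in A' by ring.
replace (0 + y2 * 1) with y2 in B' by ring. replace (0 + z2 * 1) with z2 in B' by ring.
replace (z1 + y2 * 0) with z1 in B' by ring. replace (z1 + z2 * 0) with z1 in B' by ring.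
eapply Rle_trans; [apply (Cmod_tri _ (dev i Z z1 y2))|]. lra.
Qed.

(** At fixed [x] the equation [Phi (x, y) = (x, z)] is the fixed point equation [y = z - dev y]; the
    iteration from 0 contracts by 1/2 and stays in the half polydisc, because [z] and [dev] are each
    at most [d / 4]. *)
Lemma tame_surjective (Z z1 z2 : C) : (R0 < fst Z)%R -> (Cmod z1 <= d / 4)%R -> (Cmod z2 <= d / 4)%R ->
  exists y1 y2 : C, (Cmod y1 <= d / 2)%R /\ (Cmod y2 <= d / 2)%R /\ Phi (k0 * / Z, (y1, y2)) = (k0 * / Z, (z1, z2)).
Proof.
intros hZ hz1 hz2.
assert (hKd : (0 <= K * d)%R) by (apply Rmult_le_pos; lra).
pose (y := fix y (n : nat) : C * C := match n with O => (RtoC 0, RtoC 0) | S m => (z1 - dev 1 Z (fst (y m)) (snd (y m)), z2 - dev 2 Z (fst (y m)) (snd (y m))) end).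
assert (yS : forall n, y (S n) = (z1 - dev 1 Z (fst (y n)) (snd (y n)), z2 - dev 2 Z (fst (y n)) (snd (y n)))) by reflexivity.
assert (small : (9 * K * (d * d) <= d / 4)%R).
{ replace (9 * K * (d * d))%R with (d * (9 * (K * d)))%R by ring. replace (d / 4)%R with (d * / 4)%R by field. apply Rmult_le_compat_l; lra. }
assert (inb : forall n, (Cmod (fst (y n)) <= d / 2)%R /\ (Cmod (snd (y n)) <= d / 2)%R).
{ intros n; induction n as [|n [I1 I2]].
  - simpl. rewrite Cmod_0. lra.
  - rewrite yS. cbn [fst snd].
    pose proof (dev_bound 1 Z _ _ (or_introl eq_refl) hZ (Rle_lt_trans _ _ d I1 ltac:(lra)) (Rle_lt_trans _ _ d I2 ltac:(lra))).
    pose proof (dev_bound 2 Z _ _ (or_intror eq_refl) hZ (Rle_lt_trans _ _ d I1 ltac:(lra)) (Rle_lt_trans _ _ d I2 ltac:(lra))).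
    pose proof (Cmod_sub_le z1 (dev 1 Z (fst (y n)) (snd (y n)))). pose proof (Cmod_sub_le z2 (dev 2 Z (fst (y n)) (snd (y n)))). split; lra. }
assert (half : forall a b a' b' : C, (Cmod a <= d / 2)%R -> (Cmod b <= d / 2)%R -> (Cmod a' <= d / 2)%R -> (Cmod b' <= d / 2)%R ->
   (Cmod (dev 1 Z a b - dev 1 Z a' b') + Cmod (dev 2 Z a b - dev 2 Z a' b') <= (Cmod (a - a') + Cmod (b - b')) / 2)%R).
{ intros a b a' b' i1 i2 i3 i4.
  pose proof (dev_lip 1 Z a b a' b' (or_introl eq_refl) hZ i1 i2 i3 i4).
  pose proof (dev_lip 2 Z a b a' b' (or_intror eq_refl) hZ i1 i2 i3 i4).
  set (S := (Cmod (a - a') + Cmod (b - b'))%R) in *. assert (0 <= S)%R by (unfold S; pose proof (Cmod_ge_0 (a - a')); pose proof (Cmod_ge_0 (b - b')); lra).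
  assert (144 * K * d * S <= / 4 * S)%R by (apply Rmult_le_compat_r; lra). lra. }
assert (geo : forall n, (Cmod (fst (y (S n)) - fst (y n)) + Cmod (snd (y (S n)) - snd (y n)) <= d / 2 ^ n)%R).
{ induction n as [|n IH].
  - destruct (inb 1%nat). simpl pow. replace (fst (y 0%nat)) with (RtoC 0) by reflexivity. replace (snd (y 0%nat)) with (RtoC 0) by reflexivity.
    replace (fst (y 1%nat) - 0) with (fst (y 1%nat)) by ring. replace (snd (y 1%nat) - 0) with (snd (y 1%nat)) by ring. lra.
  - assert (y1S : forall n, fst (y (S n)) = z1 - dev 1 Z (fst (y n)) (snd (y n))) by reflexivity.
    assert (y2S : forall n, snd (y (S n)) = z2 - dev 2 Z (fst (y n)) (snd (y n))) by reflexivity.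
    assert (e1 : fst (y (S (S n))) - fst (y (S n)) = - (dev 1 Z (fst (y (S n))) (snd (y (S n))) - dev 1 Z (fst (y n)) (snd (y n)))).
    { rewrite (y1S (S n)). pose proof (y1S n) as q. set (D := dev 1 Z (fst (y (S n))) (snd (y (S n)))). rewrite q. ring. }
    assert (e2 : snd (y (S (S n))) - snd (y (S n)) = - (dev 2 Z (fst (y (S n))) (snd (y (S n))) - dev 2 Z (fst (y n)) (snd (y n)))).
    { rewrite (y2S (S n)). pose proof (y2S n) as q. set (D := dev 2 Z (fst (y (S n))) (snd (y (S n)))). rewrite q. ring. }
    rewrite e1, e2.
    rewrite !Cmod_opp. destruct (inb n), (inb (S n)). eapply Rle_trans; [apply half; auto|].
    simpl pow. replace (d / (2 * 2 ^ n))%R with (d / 2 ^ n / 2)%R by (field; apply pow_nonzero; lra). lra. }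
destruct (geometric_limit (fun n => fst (y n)) d ltac:(lra)) as [l1 Hl1].
{ intros n. specialize (geo n). pose proof (Cmod_ge_0 (snd (y (S n)) - snd (y n))). lra. }
destruct (geometric_limit (fun n => snd (y n)) d ltac:(lra)) as [l2 Hl2].
{ intros n. specialize (geo n). pose proof (Cmod_ge_0 (fst (y (S n)) - fst (y n))). lra. }
assert (lb : forall (u : nat -> C) l, (forall n, (Cmod (u n - l) <= 4 * (d / 2 ^ n))%R) -> (forall n, (Cmod (u n) <= d / 2)%R) -> (Cmod l <= d / 2)%R).
{ intros u l Hu Hb. apply Rle_plus_epsilon. intros e he. destruct (geometric_small (4 * d) e ltac:(lra) he) as [N HN].
  specialize (HN N (le_n _)). specialize (Hu N). specialize (Hb N). pose proof (Cmod_rev l (u N)) as Q. rewrite (Cmod_sub_comm l) in Q.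
  replace (4 * d / 2 ^ N)%R with (4 * (d / 2 ^ N))%R in HN by (unfold Rdiv; ring). lra. }
pose proof (lb _ _ Hl1 (fun n => proj1 (inb n))) as b1. pose proof (lb _ _ Hl2 (fun n => proj2 (inb n))) as b2.
exists l1, l2. split; auto. split; auto.
assert (fix1 : l1 = z1 - dev 1 Z l1 l2 /\ l2 = z2 - dev 2 Z l1 l2).
{ assert (Q : forall e, (0 < e)%R -> (Cmod (l1 - (z1 - dev 1 Z l1 l2)) <= e)%R /\ (Cmod (l2 - (z2 - dev 2 Z l1 l2)) <= e)%R).
  { intros e he. destruct (geometric_small (8 * d) e ltac:(lra) he) as [N HN]. specialize (HN N (le_n _)).
    replace (8 * d / 2 ^ N)%R with (8 * (d / 2 ^ N))%R in HN by (unfold Rdiv; ring).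
    pose proof (Hl1 N). pose proof (Hl2 N). pose proof (Hl1 (S N)) as L1. pose proof (Hl2 (S N)) as L2. rewrite yS in L1, L2. cbn [fst snd] in L1, L2.
    destruct (inb N) as [n1 n2]. pose proof (half _ _ _ _ n1 n2 b1 b2) as hf.
    replace (d / 2 ^ S N)%R with (d / 2 ^ N / 2)%R in L1, L2 by (simpl; field; apply pow_nonzero; lra).
    set (D1 := dev 1 Z (fst (y N)) (snd (y N))) in *. set (D2 := dev 2 Z (fst (y N)) (snd (y N))) in *.
    pose proof (Cmod_ge_0 (D1 - dev 1 Z l1 l2)). pose proof (Cmod_ge_0 (D2 - dev 2 Z l1 l2)).
    split.
    - replace (l1 - (z1 - dev 1 Z l1 l2)) with (- ((z1 - D1 - l1) + (D1 - dev 1 Z l1 l2))) by ring. rewrite Cmod_opp.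
      eapply Rle_trans; [apply Cmod_triangle|]. lra.
    - replace (l2 - (z2 - dev 2 Z l1 l2)) with (- ((z2 - D2 - l2) + (D2 - dev 2 Z l1 l2))) by ring. rewrite Cmod_opp.
      eapply Rle_trans; [apply Cmod_triangle|]. lra. }
  split.
  - assert (E : l1 - (z1 - dev 1 Z l1 l2) = 0) by (apply Cmod_0_eq; intros e he; apply (Q e he)).
    replace l1 with ((l1 - (z1 - dev 1 Z l1 l2)) + (z1 - dev 1 Z l1 l2)) at 1 by ring. rewrite E; ring.
  - assert (E : l2 - (z2 - dev 2 Z l1 l2) = 0) by (apply Cmod_0_eq; intros e he; apply (Q e he)).
    replace l2 with ((l2 - (z2 - dev 2 Z l1 l2)) + (z2 - dev 2 Z l1 l2)) at 1 by ring. rewrite E; ring. }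
destruct fix1 as [f1 f2]. unfold dev in f1, f2. cbn [coord fst snd] in f1, f2.
assert (solve : forall l z P : C, l = z - (P - l) -> P = z).
{ intros l z P h. transitivity (z - (z - (P - l)) + l); [ring|rewrite <- h; ring]. }
destruct (HPhi Z l1 l2 hZ ltac:(lra) ltac:(lra)) as [E0 _]. cbv zeta in E0.
set (p := Phi (k0 * / Z, (l1, l2))) in *.
apply injective_projections; [exact E0|]. apply injective_projections; cbn [fst snd].
- exact (solve l1 z1 _ f1).
- exact (solve l2 z2 _ f2).
Qed.
End Tame.

(** * Sectors and the transition map *)

Lemma re_pos_arg (w : C) : (0 < fst w)%R -> exists t, (Rabs t < PI / 2)%R /\ w = RtoC (Cmod w) * (cos t, sin t).
Proof.
intros hw. pose proof (fst_le_Cmod w) as hm.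
set (m := Cmod w) in *. assert (hm0 : (0 < m)%R) by lra.
assert (E : (fst w * fst w + snd w * snd w = m * m)%R).
{ unfold m, Cmod. rewrite sqrt_sqrt; [ring|]. pose proof (pow2_ge_0 (fst w)); pose proof (pow2_ge_0 (snd w)); lra. }
set (a := (fst w / m)%R). set (b := (snd w / m)%R).
assert (ha : (0 < a)%R) by (apply Rdiv_lt_0_compat; auto).
assert (hab : (a * a + b * b = 1)%R).
{ unfold a, b. replace (fst w / m * (fst w / m) + snd w / m * (snd w / m))%R with ((fst w * fst w + snd w * snd w) / (m * m))%R by (field; lra).
  rewrite E. field; lra. }
assert (hb : (-1 < b < 1)%R) by (split; nra).
exists (asin b). split.
- pose proof (asin_bound_lt b hb). apply Rabs_def1; lra.
- rewrite cos_asin, sin_asin by lra. replace (1 - b²)%R with (a²)%R by (unfold Rsqr; lra). rewrite sqrt_Rsqr by lra.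
  destruct w as [u v]. unfold a, b, RtoC, Cmult. simpl. f_equal; field; lra.
Qed.

Lemma Ci_neq0 : Ci <> 0.
Proof. intros h; apply (f_equal snd) in h; simpl in h; lra. Qed.

Lemma Cmod_Ci : Cmod Ci = 1%R.
Proof. unfold Cmod; simpl. replace (0*(0*1)+1*(1*1))%R with 1%R by ring. apply sqrt_1. Qed.

(** * The sector in the coordinates [x = k0 / Z] and [x = k0 cexp u] *)

Section Sector.
Variables (la : C) (sgn eps : R).
Hypothesis Hla : la <> 0.
Hypothesis Hsgn : (sgn = 1 \/ sgn = -1)%R.
Hypothesis Heps : (0 < eps < PI / 2)%R.

Definition sector_axis : C := RtoC sgn * (Ci * la).

Lemma sgn_sq : RtoC sgn * RtoC sgn = 1.
Proof. rewrite <- RtoC_mult. f_equal. destruct Hsgn; subst; ring. Qed.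

Lemma sgn_neq0 : RtoC sgn <> 0.
Proof. intros h. pose proof sgn_sq as E. rewrite h, Cmult_0_l in E. apply (f_equal fst) in E; simpl in E; lra. Qed.

Lemma sector_axis_neq0 : sector_axis <> 0.
Proof. unfold sector_axis. repeat apply Cmult_neq_0; auto using sgn_neq0, Ci_neq0. Qed.

Lemma Cmod_sector_axis : Cmod sector_axis = Cmod la.
Proof.
unfold sector_axis. rewrite !Cmod_mult, Cmod_Ci. replace (Cmod (RtoC sgn)) with 1%R; [ring|].
rewrite Cmod_R. destruct Hsgn; subst; [rewrite Rabs_R1; auto|rewrite Rabs_left; lra].
Qed.

Lemma sector_axis_arg (u : C) : RtoC sgn * (sector_axis * u) / (Ci * la) = u.
Proof.
unfold sector_axis. transitivity ((RtoC sgn * RtoC sgn) * u); [field; split; auto using Ci_neq0|rewrite sgn_sq; ring].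
Qed.

(** For [x = k0 / Z] the number [sgn x / (i la)] is [/ Z], whose real part is positive together with
    that of [Z]; its argument is below [pi / 2]. *)
Lemma sector_halfplane r (Z : C) : (0 < fst Z)%R -> (Cmod (sector_axis * / Z) < r)%R -> sector la sgn eps r (sector_axis * / Z).
Proof.
intros hZ hr. assert (hz : Z <> 0) by (apply Cmod_gt_0; pose proof (fst_le_Cmod Z); lra).
assert (hiz : / Z <> 0).
{ apply Cmod_gt_0. rewrite Cmod_inv by auto. apply Rinv_0_lt_compat, Cmod_gt_0; auto. }
split.
- split; auto. apply Cmod_gt_0. apply Cmult_neq_0; auto using sector_axis_neq0.
- destruct (re_pos_arg (/ Z)) as [t [ht E]].
  { destruct Z as [a b]. unfold Cinv; simpl in *. apply Rdiv_lt_0_compat; auto. nra. }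
  exists t. split; [|lra]. unfold is_arg. rewrite sector_axis_arg. split; auto.
  apply Rabs_def2 in ht. pose proof PI_RGT_0. lra.
Qed.

(** A sector of opening larger than [pi] is not convex, but in the logarithm of [x / k0] it is a
    half-strip, which is. As [eps < pi / 2], the ordinate is the principal argument. *)
Lemma sector_exp r (ze : C) : (fst ze < ln (r / Cmod la))%R -> (0 < r)%R -> (Rabs (snd ze) < PI / 2 + eps)%R ->
  sector la sgn eps r (sector_axis * cexp ze).
Proof.
intros h1 hr h2. assert (hl : (0 < Cmod la)%R) by (apply Cmod_gt_0; auto).
split.
- rewrite Cmod_mult, Cmod_sector_axis, Cmod_cexp. split; [apply Rmult_lt_0_compat; auto; apply exp_pos|].
  apply exp_increasing in h1. rewrite exp_ln in h1 by (apply Rdiv_lt_0_compat; auto).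
  apply (Rmult_lt_compat_l (Cmod la)) in h1; auto. replace (Cmod la * (r / Cmod la))%R with r in h1 by (field; lra). auto.
- exists (snd ze). split; auto. unfold is_arg. rewrite sector_axis_arg. split.
  + apply Rabs_def2 in h2. lra.
  + rewrite Cmod_cexp. unfold cexp, RtoC, Cmult; simpl. f_equal; ring.
Qed.

Lemma exp_sector r (x : C) : (0 < r)%R -> sector la sgn eps r x -> exists ze : C, (fst ze < ln (r / Cmod la))%R /\ (Rabs (snd ze) < PI / 2 + eps)%R /\ x = sector_axis * cexp ze.
Proof.
intros hr [[hx1 hx2] [t [[_ E] ht]]]. assert (hl : (0 < Cmod la)%R) by (apply Cmod_gt_0; auto).
assert (hq : (0 < Cmod x / Cmod la)%R) by (apply Rdiv_lt_0_compat; auto).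
exists (ln (Cmod x / Cmod la), t). cbn [fst snd]. repeat split; auto.
- apply ln_increasing; auto. apply Rmult_lt_compat_r; auto. apply Rinv_0_lt_compat; auto.
- replace (cexp (ln (Cmod x / Cmod la), t)) with (RtoC sgn * x / (Ci * la)).
  + unfold sector_axis. transitivity (RtoC sgn * RtoC sgn * x); [rewrite sgn_sq; ring|field; split; auto using Ci_neq0].
  + rewrite E. replace (Cmod (RtoC sgn * x / (Ci * la))) with (Cmod x / Cmod la)%R.
    * unfold cexp. cbn [fst snd]. rewrite exp_ln by auto. unfold RtoC, Cmult; simpl. f_equal; ring.
    * unfold Cdiv. rewrite !Cmod_mult, Cmod_inv, Cmod_mult, Cmod_Ci by (apply Cmult_neq_0; auto using Ci_neq0).
      replace (Cmod (RtoC sgn)) with 1%R; [field; lra|].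
      rewrite Cmod_R. destruct Hsgn; subst; [rewrite Rabs_R1; auto|rewrite Rabs_left; lra].
Qed.

Lemma sector_weaken r r' x : (r <= r')%R -> sector la sgn eps r x -> sector la sgn eps r' x.
Proof. intros h [[h1 h2] h3]. split; auto. split; lra. Qed.
End Sector.

Lemma halfplane_open (k0 Z : C) R0 : k0 <> 0 -> (0 < R0)%R -> (R0 < fst Z)%R ->
  exists d : R, (0 < d)%R /\ forall x : C, (Cmod (x - k0 * / Z) < d)%R -> exists Z' : C, (R0 < fst Z')%R /\ x = k0 * / Z'.
Proof.
intros hk hR hZ. assert (hz : Z <> 0) by (apply (re_pos_neq0 Z R0); auto).
assert (hiz : / Z <> 0).
{ apply Cmod_gt_0. rewrite Cmod_inv by auto. apply Rinv_0_lt_compat, Cmod_gt_0; auto. }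
assert (hx : k0 * / Z <> 0) by (apply Cmult_neq_0; auto).
pose proof (cderiv_mult (fun _ => k0) (fun w => / w) (k0 * / Z) _ _ (cderiv_const _ _) (cderiv_inv _ hx)) as H.
destruct (cderiv_cont _ _ _ H ((fst Z - R0) / 2)%R ltac:(lra)) as [d [hd Hd]].
exists (Rmin d (Cmod (k0 * / Z))); split; [apply Rmin_pos; auto; apply Cmod_gt_0; auto|].
intros x hxx. apply Rmin_Rgt in hxx; destruct hxx as [x1 x2].
assert (hx0 : x <> 0).
{ intros ->. replace (0 - k0 * / Z) with (- (k0 * / Z)) in x2 by ring. rewrite Cmod_opp in x2. lra. }
exists (k0 * / x). split; [|field; auto].
specialize (Hd x x1). cbv beta in Hd. replace (k0 * / (k0 * / Z)) with Z in Hd by (field; auto).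
pose proof (fst_le_Cmod (- (k0 * / x - Z))) as Q3. rewrite Cmod_opp in Q3.
change (fst (- (k0 * / x - Z))) with (- (fst (k0 * / x)%C + - fst Z))%R in Q3. lra.
Qed.

Lemma tame_of_germ (Y : saddle_node) (N : normal_form) (sgn eps r : R) (Phi : C3 -> C3) :
  (sgn = 1 \/ sgn = -1)%R -> (0 < eps < PI / 2)%R -> (0 < r)%R ->
  sectorial_diffeo (sector (lam Y) sgn eps r) Phi -> tangent_to_id (sector (lam Y) sgn eps r) Phi ->
  normalizes Y N (sector (lam Y) sgn eps r) Phi ->
  exists d0 K : R, (0 < d0)%R /\ (0 <= K)%R /\ forall d K' R0, (0 < d <= d0)%R -> (K <= K')%R -> (0 < R0)%R -> (Cmod (lam Y) <= R0 * d)%R ->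
    tame (saddle_node_field Y) (normal_form_field (lam Y) N) (sector_axis (lam Y) sgn) R0 d K' Phi.
Proof.
intros hs he hr [r1 [r2 [hr1 [hr2 [Hfst _]]]]] [K [dt [hdt Ht]]] [dn [hdn Hn]].
exists (Rmin (Rmin r1 r2) (Rmin (Rmin dt dn) r)), (Rabs K).
split; [repeat apply Rmin_pos; auto|]. split; [apply Rabs_pos|].
intros d K' R0 [hd hd0] hK hR hx Z y1 y2 hZ h1 h2. cbv zeta.
assert (q1 : (d <= r1)%R) by (eapply Rle_trans; [exact hd0|]; eapply Rle_trans; [apply Rmin_l|apply Rmin_l]).
assert (q2 : (d <= r2)%R) by (eapply Rle_trans; [exact hd0|]; eapply Rle_trans; [apply Rmin_l|apply Rmin_r]).
assert (q3 : (d <= dt)%R) by (eapply Rle_trans; [exact hd0|]; eapply Rle_trans; [apply Rmin_r|]; eapply Rle_trans; [apply Rmin_l|apply Rmin_l]).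
assert (q4 : (d <= dn)%R) by (eapply Rle_trans; [exact hd0|]; eapply Rle_trans; [apply Rmin_r|]; eapply Rle_trans; [apply Rmin_l|apply Rmin_r]).
assert (q5 : (d <= r)%R) by (eapply Rle_trans; [exact hd0|]; eapply Rle_trans; [apply Rmin_r|apply Rmin_r]).
set (k0 := sector_axis (lam Y) sgn) in *.
assert (hk0 : Cmod k0 = Cmod (lam Y)) by (apply Cmod_sector_axis; auto).
assert (hxs : (Cmod (k0 * / Z) < d)%R) by (apply (x_small k0 R0 d hR); auto; rewrite hk0; auto).
assert (hsec : sector (lam Y) sgn eps r (k0 * / Z)) by (apply sector_halfplane; auto; [apply lam_neq0|lra|eapply Rlt_le_trans; [exact hxs|exact q5]]).
set (p := (k0 * / Z, (y1, y2)) : C3).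
assert (hp : forall dd, (d <= dd)%R -> small_tube (sector (lam Y) sgn eps r) dd p).
{ intros dd hdd. split; [split; [exact hsec|split; cbn [p fst snd]; lra]|cbn [p fst]; lra]. }
split; [apply Hfst; split; [exact hsec|split; cbn [p fst snd]; lra]|].
assert (T : forall i, (Cmod (coord i (Phi p) - coord i p) <= K' * (Cmod (k0 * / Z) + Cmod y1 + Cmod y2)²)%R).
{ intros i. rewrite <- coord_minus. eapply Rle_trans; [apply coord_le|]. eapply Rle_trans; [apply (Ht p (hp dt q3))|].
  pose proof (proj2 (proj2 (proj2 (C3_norm_bounds p)))) as NB. cbn [p fst snd] in NB. fold p in NB.
  assert (hn : (0 <= norm p)%R) by apply norm_ge_0.
  apply Rle_trans with (K' * norm p ^ 2)%R.
  - apply Rmult_le_compat_r; [apply pow2_ge_0|]. eapply Rle_trans; [apply Rle_abs|exact hK].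
  - apply Rmult_le_compat_l; [eapply Rle_trans; [apply Rabs_pos|exact hK]|]. rewrite <- Rsqr_pow2. apply Rsqr_incr_1; auto.
    eapply Rle_trans; eauto. }
split; [apply (T 1%nat)|]. split; [apply (T 2%nat)|].
apply (Hn p (hp dn q4)).
Qed.

(** * The transition map [phi o Phi^-1] *)

Section Transition.
Variables (Y : saddle_node) (N : normal_form) (k0 : C) (R0 d K sg : R) (Phi phi g : C3 -> C3).
Let X := saddle_node_field Y.
Let W := normal_form_field (lam Y) N.
Hypothesis Hk0 : k0 <> 0.
Hypothesis HR0 : (0 < R0)%R.
Hypothesis Hd : (0 < d)%R.
Hypothesis HK : (0 <= K)%R.
Hypothesis Hx : (Cmod k0 <= R0 * d)%R.
Hypothesis HKd : (600 * K * d <= 1)%R.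
Hypothesis Hsg : (d * d <= sg)%R.
Hypothesis HPhi : tame X W k0 R0 d K Phi.
Hypothesis Hphi : tame X W k0 R0 d K phi.
Hypothesis Hg : forall Z y1 y2 : C, (R0 < fst Z)%R -> (Cmod y1 < d)%R -> (Cmod y2 < d)%R ->
  g (Phi (k0 * / Z, (y1, y2))) = (k0 * / Z, (y1, y2)) /\ ex_filterdiff g (locally (Phi (k0 * / Z, (y1, y2)))).

(** [Phi] reaches every [z] of size [d / 4], so [phi o g] is defined there with [g] the inverse. If
    [y] is the preimage, both [phi] and [Phi] are within [K S^2] of [y], with [S <= 2 T] comparing
    the sizes of the points over [y] and over [z]: hence [2 K (2 T)^2 = 8 K T^2]. *)
Lemma transition_isotropy : isotropy (lam Y) k0 (nf_a1 N) (nf_a2 N) (eval1 (nf_c N)) sg R0 (d / 4) (8 * K)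
  (fun q => coord 1 (phi (g q))) (fun q => coord 2 (phi (g q))).
Proof.
intros Z z1 z2 hZ h1 h2. cbv zeta.
destruct (tame_surjective X W k0 R0 d K Phi HR0 Hd HK Hx HKd HPhi Z z1 z2 hZ ltac:(lra) ltac:(lra)) as [y1 [y2 [b1 [b2 EP]]]].
destruct (Hg Z y1 y2 hZ ltac:(lra) ltac:(lra)) as [Eg [dg Hdg]].
destruct (HPhi Z y1 y2 hZ ltac:(lra) ltac:(lra)) as [_ [P1 [P2 [dP [HdP EdP]]]]].
destruct (Hphi Z y1 y2 hZ ltac:(lra) ltac:(lra)) as [f0 [f1 [f2 [df [Hdf Edf]]]]].
cbv zeta in *. rewrite EP in *.
set (p := (k0 * / Z, (y1, y2)) : C3) in *. set (q := (k0 * / Z, (z1, z2)) : C3) in *.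
rewrite Eg. cbn [coord] in P1, P2, f1, f2 |- *. cbn [q fst snd] in P1, P2.
pose proof (x_small k0 R0 d HR0 Hd Hx Z hZ) as hxs.
set (a := Cmod (k0 * / Z)) in *. assert (ha : (0 <= a)%R) by apply Cmod_ge_0.
set (S := (a + Cmod y1 + Cmod y2)%R) in *. set (T := (a + Cmod z1 + Cmod z2)%R).
pose proof (Cmod_ge_0 y1). pose proof (Cmod_ge_0 y2). pose proof (Cmod_ge_0 z1). pose proof (Cmod_ge_0 z2).
assert (hS : (0 <= S <= 2 * d)%R) by (unfold S; lra).
assert (hKS : (K * S² <= S / 12)%R).
{ assert (0 <= K * d)%R by (apply Rmult_le_pos; lra). unfold Rsqr. replace (K * (S * S))%R with (S * (K * S))%R by ring. replace (S / 12)%R with (S * / 12)%R by field.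
  apply Rmult_le_compat_l; [lra|]. assert (K * S <= K * (2 * d))%R by (apply Rmult_le_compat_l; lra). lra. }
assert (hST : (S <= 2 * T)%R).
{ pose proof (Cmod_rev y1 z1) as A1. pose proof (Cmod_rev y2 z2) as A2. rewrite Cmod_sub_comm in A1, A2. unfold T. unfold S in *. lra. }
assert (hS2 : (K * S² <= 4 * K * T²)%R).
{ replace (4 * K * T²)%R with (K * (2 * T)²)%R by (unfold Rsqr; ring). apply Rmult_le_compat_l; auto. apply Rsqr_incr_1; unfold T in *; lra. }
assert (B1 : (Cmod (fst (snd (phi p)) - z1) <= 8 * K * T²)%R).
{ eapply Rle_trans; [apply (Cmod_tri _ y1)|]. rewrite (Cmod_sub_comm y1). lra. }
assert (B2 : (Cmod (snd (snd (phi p)) - z2) <= 8 * K * T²)%R).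
{ eapply Rle_trans; [apply (Cmod_tri _ y2)|]. rewrite (Cmod_sub_comm y2). lra. }
split; [|split; [exact B1|split; [exact B2|]]].
- assert (hT : (8 * K * T² <= d / 4)%R).
  { assert (T² <= (3 / 2 * d)²)%R by (apply Rsqr_incr_1; unfold T in *; lra). unfold Rsqr in *.
    assert (8 * K * (T * T) <= 8 * K * (3 / 2 * d * (3 / 2 * d)))%R by (apply Rmult_le_compat_l; lra).
    replace (8 * K * (3 / 2 * d * (3 / 2 * d)))%R with (18 * (K * d) * d)%R in * by field.
    assert (18 * (K * d) * d <= / 4 * d)%R by (apply Rmult_le_compat_r; lra). lra. }
  pose proof (Cmod_rev (fst (snd (phi p))) z1). pose proof (Cmod_rev (snd (snd (phi p))) z2).
  rewrite Cmod_mult. apply Rle_lt_trans with ((d / 2) * (d / 2))%R; [apply Rmult_le_compat; auto using Cmod_ge_0; lra|].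
  assert (0 < d * d)%R by (apply Rmult_lt_0_compat; auto). lra.
- assert (Hcomp : filterdiff (fun w => phi (g w)) (locally q) (fun w => df (dg w))).
  { apply filterdiff_comp'; auto. rewrite Eg. exact Hdf. }
  (* [g o Phi] is the identity near [p], the region being open; so [dg] carries the normal form
     field at [q] back to the field of [Y] at [p], and [df] sends that to the normal form at
     [phi p]. *)
  assert (Hid : forall h, dg (dP h) = h).
  { destruct (halfplane_open k0 Z R0 Hk0 HR0 hZ) as [dz [hdz Hdz]].
    apply (filterdiff_id_unique (fun w => g (Phi w)) (fun h => dg (dP h)) p (Rmin dz (d / 2))); [apply Rmin_pos; lra| |].
    - intros [x [u1 u2]] hw. apply Rmin_Rgt in hw. destruct hw as [w1 w2]. unfold dist3 in w1, w2. cbn [p fst snd] in w1, w2.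
      pose proof (Cmod_ge_0 (x - k0 * / Z)). pose proof (Cmod_ge_0 (u1 - y1)). pose proof (Cmod_ge_0 (u2 - y2)).
      destruct (Hdz x ltac:(lra)) as [Z' [hZ' ->]]. apply (Hg Z' u1 u2 hZ').
      + pose proof (Cmod_rev u1 y1). lra.
      + pose proof (Cmod_rev u2 y2). lra.
    - apply filterdiff_comp'; auto. rewrite EP. exact Hdg. }
  assert (Hval : df (dg (W q)) = W (phi p)) by (rewrite <- EdP, Hid; exact Edf).
  do 6 eexists. split; [exact (filterdiff_partials _ _ _ 1 Hcomp)|]. split; [exact (filterdiff_partials _ _ _ 2 Hcomp)|].
  assert (Hlin : is_linear (fun w => df (dg w))) by (destruct Hcomp; auto).
  pose proof (linear_coords _ (W q) 1 Hlin) as L1. pose proof (linear_coords _ (W q) 2 Hlin) as L2. cbv beta in L1, L2.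
  rewrite Hval in L1, L2. cbn [coord] in L1, L2.
  unfold W, normal_form_field in L1, L2. cbn [q fst snd] in L1, L2. rewrite f0 in L1, L2.
  assert (sq : forall A B D u b e r : C, r = A * u ^ 2 + B * b + D * e -> A * (u * u) + B * b + D * e = r).
  { intros A B D u b e r ->. simpl. ring. }
  split; [exact (sq _ _ _ _ _ _ _ L1)|exact (sq _ _ _ _ _ _ _ L2)].
Qed.
End Transition.

(** * Uniqueness of sectorial normalizations *)

(** At fixed [y], the difference of the two maps is holomorphic on the convex half-strip of the
    logarithm of [x / k0] and vanishes near a point far to the left. *)
Lemma germ_propagation (la : C) (sgn eps r r1 r2 B : R) (phi Phi : C3 -> C3) :
  la <> 0 -> (sgn = 1 \/ sgn = -1)%R -> (0 < eps < PI / 2)%R -> (0 < r)%R -> (0 < B)%R ->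
  (forall p, tube (sector la sgn eps r) r1 r2 p -> ex_filterdiff phi (locally p)) ->
  (forall p, tube (sector la sgn eps r) r1 r2 p -> ex_filterdiff Phi (locally p)) ->
  (forall Z y1 y2 : C, (B < fst Z)%R -> (Cmod y1 < r1)%R -> (Cmod y2 < r2)%R ->
     phi (sector_axis la sgn * / Z, (y1, y2)) = Phi (sector_axis la sgn * / Z, (y1, y2))) ->
  forall p, tube (sector la sgn eps r) r1 r2 p -> phi p = Phi p.
Proof.
intros hla hs he hr hB Hphi HPhi Heq.
enough (Main : forall x y1 y2 : C, sector la sgn eps r x -> (Cmod y1 < r1)%R -> (Cmod y2 < r2)%R -> phi (x, (y1, y2)) = Phi (x, (y1, y2)))
  by (intros [x [y1 y2]] [hx [h1 h2]]; exact (Main x y1 y2 hx h1 h2)).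
intros x y1 y2 hx h1 h2.
assert (hl : (0 < Cmod la)%R) by (apply Cmod_gt_0; auto).
set (k0 := sector_axis la sgn) in *.
assert (pp := PI_RGT_0).
destruct (exp_sector la sgn eps hla hs r x hr hx) as [ze [hz1 [hz2 ->]]]. fold k0.
pose (D := fun u : C => (fst u < ln (r / Cmod la))%R /\ (Rabs (snd u) < PI / 2 + eps)%R).
assert (Sec : forall u, D u -> tube (sector la sgn eps r) r1 r2 (k0 * cexp u, (y1, y2))).
{ intros u [u1 u2]. split; [apply sector_exp; auto|split; auto]. }
assert (K : forall i, coord i (phi (k0 * cexp ze, (y1, y2))) - coord i (Phi (k0 * cexp ze, (y1, y2))) = 0).
{ intros i. set (s0 := Rmin (ln (r / Cmod la) - 1) (- ln (B + 2))).
  assert (s1 : (s0 <= ln (r / Cmod la) - 1)%R) by apply Rmin_l. assert (s2 : (s0 <= - ln (B + 2))%R) by apply Rmin_r.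
  set (z0 := (s0, 0%R) : C).
  pose proof (cderiv_comp cexp (fun w => -1 * w) z0 _ _ (cderiv_cexp _) (cderiv_mult (fun _ => -1) (fun w => w) z0 _ _ (cderiv_const _ _) (cderiv_id _))) as HC.
  destruct (cderiv_cont _ _ _ HC 1%R ltac:(lra)) as [dz [hdz Hdz]]. cbv beta in Hdz.
  pose (F := fun u => coord i (phi (k0 * cexp u, (y1, y2))) - coord i (Phi (k0 * cexp u, (y1, y2)))).
  apply (convex_identity D F z0 dz); auto.
  - intros z [d1 d2].
    exists (Rmin (ln (r / Cmod la) - fst z) (PI / 2 + eps - Rabs (snd z))). split; [apply Rmin_pos; lra|].
    intros w hw. apply Rmin_Rgt in hw; destruct hw as [w1 w2].
    pose proof (Rabs_fst_le (w - z)) as e1. pose proof (Rabs_snd_le (w - z)) as e2.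
    change (fst (w - z)) with (fst w - fst z)%R in e1. change (snd (w - z)) with (snd w - snd z)%R in e2. split.
    + pose proof (Rle_abs (fst w - fst z)). lra.
    + pose proof (Rabs_triang (snd w - snd z) (snd z)) as e3. replace (snd w - snd z + snd z)%R with (snd w) in e3 by ring. lra.
  - intros z w t ht [d1 d2] [e1 e2].
    assert (E1 : fst (z + RtoC t * (w - z)) = ((1 - t) * fst z + t * fst w)%R) by (unfold RtoC, Cplus, Cmult, Cminus, Copp; simpl; ring).
    assert (E2 : snd (z + RtoC t * (w - z)) = ((1 - t) * snd z + t * snd w)%R) by (unfold RtoC, Cplus, Cmult, Cminus, Copp; simpl; ring).
    split.
    + rewrite E1. destruct (Req_dec t 0) as [->|hn]; [lra|].
      assert (t * fst w < t * ln (r / Cmod la))%R by (apply Rmult_lt_compat_l; lra).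
      assert ((1 - t) * fst z <= (1 - t) * ln (r / Cmod la))%R by (apply Rmult_le_compat_l; lra). lra.
    + rewrite E2. eapply Rle_lt_trans; [apply Rabs_triang|]. rewrite !Rabs_mult, (Rabs_pos_eq t), (Rabs_pos_eq (1 - t)) by lra.
      destruct (Req_dec t 0) as [->|hn]; [lra|].
      assert (t * Rabs (snd w) < t * (PI / 2 + eps))%R by (apply Rmult_lt_compat_l; lra).
      assert ((1 - t) * Rabs (snd z) <= (1 - t) * (PI / 2 + eps))%R by (apply Rmult_le_compat_l; lra). lra.
  - intros z hz.
    assert (G : forall f : C3 -> C3, (forall p, tube (sector la sgn eps r) r1 r2 p -> ex_filterdiff f (locally p)) ->
       exists l, cderiv (fun u => coord i (f (k0 * cexp u, (y1, y2)))) z l).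
    { intros f Hf. destruct (Hf _ (Sec z hz)) as [df Hdf].
      pose proof (filterdiff_partials _ _ _ i Hdf) as H3.
      pose proof (cderiv_mult (fun _ => k0) cexp z _ _ (cderiv_const _ _) (cderiv_cexp z)) as H1.
      pose proof (expands_partials _ (fun _ => Cmod_ge_0 _) _ (k0 * cexp z, (y1, y2)) _ _ _ _ _ _ _ _ _ H3 H1 (cderiv_const y1 z) (cderiv_const y2 z)) as X.
      exists (coord i (df (RtoC 1, (RtoC 0, RtoC 0))) * (0 * cexp z + k0 * cexp z)).
      eapply expands_ext; [| |exact X]; [reflexivity|]. intros q; cbv beta; ring. }
    destruct (G phi Hphi) as [l1 L1]. destruct (G Phi HPhi) as [l2 L2].
    exists (l1 + (0 * coord i (Phi (k0 * cexp z, (y1, y2))) + -1 * l2)).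
    apply (cderiv_ext (fun u => coord i (phi (k0 * cexp u, (y1, y2))) + -1 * coord i (Phi (k0 * cexp u, (y1, y2))))); [intros; unfold F; ring|].
    apply cderiv_plus; [exact L1|]. apply (cderiv_mult (fun _ => -1)); [apply cderiv_const|exact L2].
  - split; cbn [z0 fst snd]; [lra|rewrite Rabs_R0; lra].
  - intros z hz. specialize (Hdz z hz).
    replace (-1 * z) with (- z) in Hdz by ring. replace (-1 * z0) with (- z0) in Hdz by ring.
    assert (hre : (B < fst (cexp (- z)))%R).
    { pose proof (Rabs_fst_le (cexp (- z) - cexp (- z0))) as Q.
      change (fst (cexp (- z) - cexp (- z0))) with (fst (cexp (- z)) - fst (cexp (- z0)))%R in Q.
      assert (E : (B + 2 <= fst (cexp (- z0)))%R).
      { unfold cexp, z0. simpl. rewrite Ropp_0, cos_0, Rmult_1_r. rewrite <- (exp_ln (B + 2)) by lra.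
        assert (hh : (ln (B + 2) <= - s0)%R) by lra. destruct hh as [hh|hh]; [apply Rlt_le, exp_increasing; auto|rewrite hh; lra]. }
      pose proof (Rle_abs (- (fst (cexp (- z)) - fst (cexp (- z0))))) as Q2. rewrite Rabs_Ropp in Q2. lra. }
    unfold F. assert (E : k0 * cexp z = k0 * / cexp (- z)) by (rewrite <- cexp_inv; do 2 f_equal; ring).
    rewrite E, (Heq _ y1 y2 hre h1 h2). ring.
  - split; auto. }
assert (eqC : forall i, coord i (phi (k0 * cexp ze, (y1, y2))) = coord i (Phi (k0 * cexp ze, (y1, y2)))).
{ intros i. specialize (K i). set (u := coord i (phi _)) in *. set (v := coord i (Phi _)) in *.
  replace u with ((u - v) + v) by ring. rewrite K; ring. }
apply injective_projections; [exact (eqC 0%nat)|]. apply injective_projections; [exact (eqC 1%nat)|exact (eqC 2%nat)].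
Qed.

Theorem sectorial_uniqueness (Y : saddle_node) (N : normal_form) (sgn eps r rPhi : R) (Phi phi : C3 -> C3) :
  (sgn = 1 \/ sgn = -1)%R -> (0 < eps < PI / 2)%R -> (0 < r)%R -> (0 < rPhi)%R -> (0 < fst (nf_a1 N + nf_a2 N)%C)%R ->
  sectorial_diffeo (sector (lam Y) sgn eps rPhi) Phi -> tangent_to_id (sector (lam Y) sgn eps rPhi) Phi ->
  normalizes Y N (sector (lam Y) sgn eps rPhi) Phi ->
  sectorial_diffeo (sector (lam Y) sgn eps r) phi -> tangent_to_id (sector (lam Y) sgn eps r) phi ->
  normalizes Y N (sector (lam Y) sgn eps r) phi ->
  eq_germ (sector (lam Y) sgn eps (Rmin r rPhi)) phi Phi.
Proof.
intros hs he hr hrP ha A1 A2 A3 B1 B2 B3.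
destruct (tame_of_germ Y N sgn eps rPhi Phi hs he hrP A1 A2 A3) as [dP [KP [hdP [hKP TP]]]].
destruct (tame_of_germ Y N sgn eps r phi hs he hr B1 B2 B3) as [dp [Kp [hdp [hKp Tp]]]].
destruct A1 as [R1 [R2 [hR1 [hR2 [_ [HolP [_ [g [Hg Hgi]]]]]]]]].
destruct B1 as [S1 [S2 [hS1 [hS2 [_ [Holp _]]]]]].
destruct (eval1_lipschitz (nf_c N) (nf_c_convergent N)) as [sg [Lc [hsg [hLc Lip]]]].
assert (hla := lam_neq0 Y). assert (hl : (0 < Cmod (lam Y))%R) by (apply Cmod_gt_0; auto).
set (k0 := sector_axis (lam Y) sgn).
assert (hk0 : k0 <> 0) by (apply sector_axis_neq0; auto).
assert (hkm : Cmod k0 = Cmod (lam Y)) by (apply Cmod_sector_axis; auto).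
set (K := Rmax KP Kp). assert (k1 : (KP <= K)%R) by apply Rmax_l. assert (k2 : (Kp <= K)%R) by apply Rmax_r.
assert (hK : (0 <= K)%R) by lra.
set (d := Rmin (Rmin (Rmin dP dp) (Rmin R1 R2)) (Rmin (Rmin 1 sg) (Rmin rPhi (/ (600 * (K + 1)))))).
assert (hd : (0 < d)%R).
{ repeat apply Rmin_pos; auto; try lra. apply Rinv_0_lt_compat; lra. }
assert (d1 : (d <= dP)%R) by (eapply Rle_trans; [apply Rmin_l|]; eapply Rle_trans; [apply Rmin_l|apply Rmin_l]).
assert (d2 : (d <= dp)%R) by (eapply Rle_trans; [apply Rmin_l|]; eapply Rle_trans; [apply Rmin_l|apply Rmin_r]).
assert (d3 : (d <= R1)%R) by (eapply Rle_trans; [apply Rmin_l|]; eapply Rle_trans; [apply Rmin_r|apply Rmin_l]).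
assert (d4 : (d <= R2)%R) by (eapply Rle_trans; [apply Rmin_l|]; eapply Rle_trans; [apply Rmin_r|apply Rmin_r]).
assert (d5 : (d <= 1)%R) by (eapply Rle_trans; [apply Rmin_r|]; eapply Rle_trans; [apply Rmin_l|apply Rmin_l]).
assert (d6 : (d <= sg)%R) by (eapply Rle_trans; [apply Rmin_r|]; eapply Rle_trans; [apply Rmin_l|apply Rmin_r]).
assert (d7 : (d <= rPhi)%R) by (eapply Rle_trans; [apply Rmin_r|]; eapply Rle_trans; [apply Rmin_r|apply Rmin_l]).
assert (d8 : (d <= / (600 * (K + 1)))%R) by (eapply Rle_trans; [apply Rmin_r|]; eapply Rle_trans; [apply Rmin_r|apply Rmin_r]).
assert (hKd : (600 * K * d <= 1)%R).
{ apply (Rmult_le_compat_l (600 * (K + 1))) in d8; [|lra]. rewrite Rinv_r in d8 by lra.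
  assert (600 * (K + 1) * d = 600 * K * d + 600 * d)%R by ring. lra. }
assert (hdd : (d * d <= sg)%R) by nra.
set (R0 := (Cmod (lam Y) / d)%R). assert (hR0 : (0 < R0)%R) by (apply Rdiv_lt_0_compat; auto).
assert (hRd : (Cmod (lam Y) <= R0 * d)%R) by (right; unfold R0; field; lra).
assert (hx : (Cmod k0 <= R0 * d)%R) by (rewrite hkm; auto).
specialize (TP d K R0 (conj hd d1) k1 hR0 hRd). specialize (Tp d K R0 (conj hd d2) k2 hR0 hRd).
fold k0 in TP, Tp.
assert (Hgg : forall Z y1 y2 : C, (R0 < fst Z)%R -> (Cmod y1 < d)%R -> (Cmod y2 < d)%R ->
  g (Phi (k0 * / Z, (y1, y2))) = (k0 * / Z, (y1, y2)) /\ ex_filterdiff g (locally (Phi (k0 * / Z, (y1, y2))))).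
{ intros Z y1 y2 hZ h1 h2.
  assert (tb : tube (sector (lam Y) sgn eps rPhi) R1 R2 (k0 * / Z, (y1, y2))).
  { split; [|split; cbn [fst snd]; lra]. apply sector_halfplane; auto; [lra|].
    eapply Rlt_le_trans; [apply (x_small k0 R0 d hR0 hd hx Z hZ)|exact d7]. }
  split; [apply Hgi; auto|]. apply Hg. exists (k0 * / Z, (y1, y2)). split; auto. }
pose proof (transition_isotropy Y N k0 R0 d K sg Phi phi g hk0 hR0 hd hK hx hKd hdd TP Tp Hgg) as Iso.
assert (hlam : lam Y = (0%R, (- sgn)%R) * k0).
{ unfold k0, sector_axis. destruct (lam Y) as [u v]. unfold RtoC, Ci, Cmult; simpl. destruct hs; subst; f_equal; ring. }
assert (hq : (- sgn)%R <> 0%R) by (destruct hs; lra).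
assert (hdd4 : (d / 4 * (d / 4) <= sg)%R) by nra.
assert (Triv := isotropy_trivial (lam Y) k0 (nf_a1 N) (nf_a2 N) (- sgn) (eval1 (nf_c N)) sg Lc (d / 4) (8 * K)
  hk0 hq hlam ha (eval1_0 _ (nf_c_0 N)) hLc Lip ltac:(lra) hdd4 ltac:(lra) _ _ R0 hR0 Iso).
assert (Near : forall Z y1 y2 : C, (R0 + 2 < fst Z)%R -> (Cmod y1 < d / 8)%R -> (Cmod y2 < d / 8)%R ->
   phi (k0 * / Z, (y1, y2)) = Phi (k0 * / Z, (y1, y2))).
{ intros Z y1 y2 hZ h1 h2. destruct (Hgg Z y1 y2 ltac:(lra) ltac:(lra) ltac:(lra)) as [Eg _].
  destruct (TP Z y1 y2 ltac:(lra) ltac:(lra) ltac:(lra)) as [E0 [E1 [E2 _]]].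
  destruct (Tp Z y1 y2 ltac:(lra) ltac:(lra) ltac:(lra)) as [F0 _]. cbv zeta in E0, E1, E2, F0.
  pose proof (x_small k0 R0 d hR0 hd hx Z ltac:(lra)) as hxs. pose proof (Cmod_ge_0 (k0 * / Z)).
  pose proof (Cmod_ge_0 y1). pose proof (Cmod_ge_0 y2).
  set (p := (k0 * / Z, (y1, y2)) : C3) in *. cbn [coord] in E1, E2.
  assert (B : (K * (Cmod (k0 * / Z) + Cmod y1 + Cmod y2)² < d / 8)%R).
  { apply Rle_lt_trans with (K * (2 * d)²)%R; [apply Rmult_le_compat_l; auto; apply Rsqr_incr_1; lra|].
    unfold Rsqr. replace (K * (2 * d * (2 * d)))%R with (4 * (K * d) * d)%R by ring. replace (d / 8)%R with (/ 8 * d)%R by field.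
    apply Rmult_lt_compat_r; lra. }
  assert (b1 : (Cmod (fst (snd (Phi p))) < d / 4)%R) by (pose proof (Cmod_rev (fst (snd (Phi p))) y1); lra).
  assert (b2 : (Cmod (snd (snd (Phi p))) < d / 4)%R) by (pose proof (Cmod_rev (snd (snd (Phi p))) y2); lra).
  destruct (Triv Z _ _ hZ b1 b2) as [T1 T2]. cbv beta in T1, T2.
  assert (EP : ((k0 * / Z, (fst (snd (Phi p)), snd (snd (Phi p)))) : C3) = Phi p).
  { apply injective_projections; [symmetry; exact E0|]. apply injective_projections; reflexivity. }
  assert (comp : forall i, coord i (phi p) = coord i (phi (g (k0 * / Z, (fst (snd (Phi p)), snd (snd (Phi p))))))).
  { intros i. exact (eq_trans (f_equal (fun u => coord i (phi u)) (eq_sym Eg)) (f_equal (fun u => coord i (phi (g u))) (eq_sym EP))). }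
  apply injective_projections; [rewrite E0; exact F0|]. apply injective_projections; [exact (eq_trans (comp 1%nat) T1)|exact (eq_trans (comp 2%nat) T2)]. }
set (rho1 := Rmin (d / 8) (Rmin R1 S1)). set (rho2 := Rmin (d / 8) (Rmin R2 S2)).
exists rho1, rho2. split; [repeat apply Rmin_pos; lra|]. split; [repeat apply Rmin_pos; lra|].
assert (a1 : (rho1 <= d / 8)%R) by apply Rmin_l. assert (a2 : (rho2 <= d / 8)%R) by apply Rmin_l.
assert (a3 : (rho1 <= R1)%R) by (eapply Rle_trans; [apply Rmin_r|apply Rmin_l]).
assert (a4 : (rho1 <= S1)%R) by (eapply Rle_trans; [apply Rmin_r|apply Rmin_r]).
assert (a5 : (rho2 <= R2)%R) by (eapply Rle_trans; [apply Rmin_r|apply Rmin_l]).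
assert (a6 : (rho2 <= S2)%R) by (eapply Rle_trans; [apply Rmin_r|apply Rmin_r]).
apply (germ_propagation (lam Y) sgn eps (Rmin r rPhi) rho1 rho2 (R0 + 2)); auto.
- apply Rmin_pos; auto.
- lra.
- intros p [h1 [h2 h3]]. apply Holp. split; [eapply sector_weaken; [apply Rmin_l|exact h1]|split; lra].
- intros p [h1 [h2 h3]]. apply HolP. split; [eapply sector_weaken; [apply Rmin_r|exact h1]|split; lra].
- intros Z y1 y2 hZ h1 h2. apply Near; auto; lra.
Qed.

Local Close Scope C_scope.

Theorem proposition1p13 (Y : saddle_node) (N : normal_form) (u1 u2 : fps)
    (eps r rPhi : R) (Phi_p Phi_m phi_p phi_m : C3 -> C3)
    (hY : strictly_nondegenerate Y)
    (hdiv : div_integrable Y)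
    (hN : formal_normalization Y N u1 u2)
    (heps : (0 < eps < PI / 2)%R)
    (hr : (0 < r)%R)
    (hrPhi : (0 < rPhi)%R)
    (hPhi_p : sectorial_normalizing_map Y N u1 u2 (sector (lam Y) 1 eps rPhi) Phi_p)
    (hPhi_m : sectorial_normalizing_map Y N u1 u2 (sector (lam Y) (-1) eps rPhi) Phi_m)
    (hp_diffeo : sectorial_diffeo (sector (lam Y) 1 eps r) phi_p)
    (hm_diffeo : sectorial_diffeo (sector (lam Y) (-1) eps r) phi_m)
    (hp_tangent : tangent_to_id (sector (lam Y) 1 eps r) phi_p)
    (hm_tangent : tangent_to_id (sector (lam Y) (-1) eps r) phi_m)
    (hp_conj : normalizes Y N (sector (lam Y) 1 eps r) phi_p)
    (hm_conj : normalizes Y N (sector (lam Y) (-1) eps r) phi_m) :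
  eq_germ (sector (lam Y) 1 eps (Rmin r rPhi)) phi_p Phi_p /\
  eq_germ (sector (lam Y) (-1) eps (Rmin r rPhi)) phi_m Phi_m.
Proof.
assert (ha : (0 < fst (nf_a1 N + nf_a2 N)%C)%R) by (rewrite (proj1 hN); exact hY).
destruct hPhi_p as [P1 [P2 [P3 _]]]. destruct hPhi_m as [M1 [M2 [M3 _]]].
split; [apply (sectorial_uniqueness Y N 1)|apply (sectorial_uniqueness Y N (-1))]; auto.
Qed.
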